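(* Let $G_1$ and $G_2$ be groups with a shared finitely generated subgroup $A$ that is central in both $G_1$ and $G_2$. If $G_1/A$ and $G_2/A$ both belong to $\mathcal{C}$, then the free product with amalgamation $G_1\ast_A G_2$ belongs to $\mathcal{C}$.
   Context: For a group $G$ and prime $p$, $\hat{G}^p$ denotes the pro-$p$ completion of $G$ and $c_G^p:G\to\hat{G}^p$ the completion map. $\mathbb Z/p$ is regarded as a trivial module for discrete groups and as a trivial discrete topological module for pro-$p$ groups. $\mathcal{C}$ is the class of all groups $G$ such that for every prime $p$ and every integer $n\ge 0$, the map $H^n_{\rm cont}(\hat{G}^p,\mathbb Z/p)\to H^n(G,\mathbb Z/p)$ induced by $c_G^p$ (from continuous cohomology of the pro-$p$ group to discrete group cohomology) is an isomorphism. *)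

(* Defs.v *)
From Stdlib Require List.
From mathcomp Require Import all_boot all_algebra.
Set Implicit Arguments. Unset Strict Implicit. Unset Printing Implicit Defensive.
Import GRing.Theory.
Local Open Scope ring_scope.

Record group := Group {
  gcar :> Type;
  gmul : gcar -> gcar -> gcar;
  gone : gcar;
  ginv : gcar -> gcar;
  gmulA : forall x y z, gmul x (gmul y z) = gmul (gmul x y) z;
  gmul1 : forall x, gmul gone x = x;
  gmulV : forall x, gmul (ginv x) x = gone }.
Arguments gmul {g}. Arguments gone {g}. Arguments ginv {g}.

Definition is_hom (G H : group) (f : G -> H) : Prop :=
  forall x y, f (gmul x y) = gmul (f x) (f y).

Definition is_subgroup (G : group) (N : G -> Prop) : Prop :=
  [/\ N gone, (forall x y, N x -> N y -> N (gmul x y)) & (forall x, N x -> N (ginv x))].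

Definition is_normal (G : group) (N : G -> Prop) : Prop :=
  is_subgroup N /\ forall g x, N x -> N (gmul (gmul (ginv g) x) g).

Definition has_p_power_index (G : group) (p : nat) (N : G -> Prop) : Prop :=
  exists k (r : 'I_(p ^ k) -> G), forall g, exists! i, N (gmul (ginv (r i)) g).

Definition pnormal (G : group) (p : nat) (N : G -> Prop) : Prop :=
  is_normal N /\ has_p_power_index p N.

Inductive gen_by (G : group) (S : list G) : G -> Prop :=
| gen_one : gen_by S gone
| gen_in x : List.In x S -> gen_by S x
| gen_mul x y : gen_by S x -> gen_by S y -> gen_by S (gmul x y)
| gen_inv x : gen_by S x -> gen_by S (ginv x).

Definition fin_gen (G : group) : Prop := exists S : list G, forall x, gen_by S x.

Definition is_quotient (G Q : group) (A : G -> Prop) : Prop :=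
  exists pi : G -> Q, [/\ is_hom pi, (forall q, exists g, pi g = q)
                        & forall g, pi g = gone <-> A g].

Definition is_amalgam (A G1 G2 : group) (j1 : A -> G1) (j2 : A -> G2)
    (P : group) (i1 : G1 -> P) (i2 : G2 -> P) : Prop :=
  [/\ is_hom i1, is_hom i2, (forall a, i1 (j1 a) = i2 (j2 a)) &
   forall (H : group) (f1 : G1 -> H) (f2 : G2 -> H),
     is_hom f1 -> is_hom f2 -> (forall a, f1 (j1 a) = f2 (j2 a)) ->
     exists phi : P -> H,
       [/\ is_hom phi, (forall x, phi (i1 x) = f1 x), (forall y, phi (i2 y) = f2 y)
         & forall psi : P -> H, is_hom psi -> (forall x, psi (i1 x) = f1 x) ->
             (forall y, psi (i2 y) = f2 y) -> forall z, psi z = phi z]].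

(* Inhomogeneous cochains with trivial coefficients Z/p.              *)
(* Cochains are functions ('I_n -> T) -> 'Z_p, T carrying a           *)
(* multiplication m; only the points of a domain D matter.            *)
Section Cochains.
Variables (T : Type) (m : T -> T -> T) (p : nat).

Definition face (n : nat) (k : nat) (x : 'I_n.+1 -> T) : 'I_n -> T :=
  fun j => if (j < k)%N then x (widen_ord (leqnSn n) j)
           else if (j == k :> nat) then m (x (widen_ord (leqnSn n) j)) (x (lift ord0 j))
           else x (lift ord0 j).

Definition coboundary_map (n : nat) (f : ('I_n -> T) -> 'Z_p) : ('I_n.+1 -> T) -> 'Z_p :=
  fun x => f (fun j => x (lift ord0 j))
           + \sum_(k < n) (-1) ^+ k.+1 * f (face k x)
           + (-1) ^+ n.+1 * f (fun j => x (widen_ord (leqnSn n) j)).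

Variable D : T -> Prop.
Definition in_dom (n : nat) (x : 'I_n -> T) : Prop := forall i, D (x i).

Definition is_cocycle (n : nat) (f : ('I_n -> T) -> 'Z_p) : Prop :=
  forall x : 'I_n.+1 -> T, in_dom x -> coboundary_map f x = 0.

(* adm: the admissible cochains (all, or the continuous ones) *)
Variable adm : forall n, (('I_n -> T) -> 'Z_p) -> Prop.

Definition is_coboundary (n : nat) : (('I_n -> T) -> 'Z_p) -> Prop :=
  match n with
  | 0 => fun f => forall x, in_dom x -> f x = 0
  | n'.+1 => fun f => exists h, adm h /\ forall x, in_dom x -> f x = coboundary_map h x
  end.
End Cochains.

(* Pro-p completion.  An element is a compatible family of cosets     *)
(* (x_N)_N, N ranging over normal subgroups of p-power index.         *)
Section ProP.
Variables (G : group) (p : nat).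

Definition psub := {N : G -> Prop | pnormal p N}.
Definition raw_hat := psub -> G -> Prop.

Definition is_lcoset (N : G -> Prop) (S : G -> Prop) : Prop :=
  exists g, forall x, S x <-> N (gmul (ginv g) x).

Definition in_hat (x : raw_hat) : Prop :=
  (forall N : psub, is_lcoset (sval N) (x N)) /\
  (forall N M : psub, (forall g, sval N g -> sval M g) -> forall g, x N g -> x M g).

Definition hat_mul (x y : raw_hat) : raw_hat :=
  fun N g => exists a, x N a /\ y N (gmul (ginv a) g).

Definition completion_map (g : G) : raw_hat :=
  fun N x => sval N (gmul (ginv g) x).

(* continuity for the (product of) inverse-limit topologies on hat G^n,
   with values in the discrete module Z/p *)
Definition hat_continuous (n : nat) (f : ('I_n -> raw_hat) -> 'Z_p) : Prop :=
  forall x, in_dom in_hat x ->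
    exists Ns : 'I_n -> psub, forall y, in_dom in_hat y ->
      (forall i g, y i (Ns i) g <-> x i (Ns i) g) -> f y = f x.
End ProP.

(* H^n_cont(hat G^p, Z/p) -> H^n(G, Z/p), induced by c_G^p, is bijective
   (it is additive, so this means isomorphism). *)
Definition cohom_iso (G : group) (p n : nat) : Prop :=
  let T := raw_hat G p in
  let c := completion_map (p := p) in
  let Gall := fun _ : G => True in
  let allc := fun k (_ : ('I_k -> G) -> 'Z_p) => True in
  (forall f : ('I_n -> G) -> 'Z_p, is_cocycle (@gmul G) Gall f ->
     exists g : ('I_n -> T) -> 'Z_p,
       [/\ hat_continuous g, is_cocycle (@hat_mul G p) (@in_hat G p) g &
           is_coboundary (@gmul G) Gall allc (fun x => f x - g (fun i => c (x i)))]) /\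
  (forall g : ('I_n -> T) -> 'Z_p,
     hat_continuous g -> is_cocycle (@hat_mul G p) (@in_hat G p) g ->
     is_coboundary (@gmul G) Gall allc (fun x => g (fun i => c (x i))) ->
     is_coboundary (@hat_mul G p) (@in_hat G p) (@hat_continuous G p) g).

Definition in_class_C (G : group) : Prop :=
  forall p n : nat, prime p -> cohom_iso G p n.

(* Main.v *)
(** A group [G] is in the class exactly when, for every [p], the complex of
    cochains on [G] modulo the locally constant ones (for the pro-p topology) is
    acyclic.  A double complex shows that this holds as soon as every cohomology
    class of positive degree of a subgroup [N] of p-power index dies on a smaller
    such subgroup; conversely, dévissage along a chain of subgroups of index [p]
    propagates acyclicity from trivial coefficients to the functions on [G / N],
    which gives the vanishing.  This vanishing property passes

    - from [G1 / A] and [G2 / A] to their free product [P / A]: local solutions on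
      the two factors, obtained through the retractions of the free product, are
      glued with the Mayer-Vietoris argument, where a function on [P] is split
      into a [G1]-invariant and a [G2]-invariant one by extending a derivation
      from the factors to [P];
    - from [G / <z>] to [G] for [z] central: the degree two case provides subgroups
      of p-power index meeting [<z>] in arbitrarily small subgroups, which kills the
      cohomology of [<z>], and a double complex does the rest.

    Applying the second step once per generator of [A] climbs from [P / A] to [P]. *)

Require Import Defs.
From mathcomp Require Import all_boot all_algebra all_fingroup all_solvable.
From mathcomp Require Import boolp.
From Stdlib Require List.
From mathcomp Require Import ring.
Import Defs.
Set Implicit Arguments. Unset Strict Implicit. Unset Printing Implicit Defensive.
Import GRing.Theory.
Local Open Scope ring_scope.
Local Infix "⋅" := gmul (at level 40, left associativity).
Local Notation Forall2 := List.Forall2.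

(** All cochains live on one ambient group, as functions on lists: size n + 1 carries degree n and
    the empty list is the augmentation. Passing to a subgroup [N] only weakens the diagonal
    invariance [dinv], and passing to the quotient by a central [A] only adds the constancy [cinv]
    on cosets. So the quotient of the amalgam by [A] is never formed, and no restriction or
    inflation map appears.

    Membership in the class concerns trivial coefficients and fixed groups, whereas gluing and
    central extensions need to shrink a subgroup of p-power index several times. Effaceability is
    the form of the property that tolerates this, since it quantifies over all such subgroups and
    may answer with a smaller one.

    Treating one central cyclic group at a time keeps the cohomology of the fibre explicit:
    averaging when the order is finite and prime to p, summation along the integers when it is
    infinite. Gluing lowers the degree by one, so degree one of the amalgam is handled apart,
    through homomorphisms to Z/p. *)

Section GroupFacts.
Variable G : group.
Implicit Types x y z : G.

Lemma gmulKV x y : ginv x ⋅ (x ⋅ y) = y.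
Proof. by rewrite gmulA gmulV gmul1. Qed.

Lemma gmulVr x : x ⋅ ginv x = gone.
Proof.
by rewrite -[x ⋅ _]gmul1 -{1}(gmulV (ginv x)) -gmulA (gmulKV x) gmulV.
Qed.

Lemma gmulr1 x : x ⋅ gone = x.
Proof. by rewrite -(gmulV x) gmulA gmulVr gmul1. Qed.

Lemma gmulK x y : x ⋅ y ⋅ ginv y = x.
Proof. by rewrite -gmulA gmulVr gmulr1. Qed.

Lemma gmulKr x y : x ⋅ ginv y ⋅ y = x.
Proof. by rewrite -gmulA gmulV gmulr1. Qed.

Lemma gmulVK x y : x ⋅ (ginv x ⋅ y) = y.
Proof. by rewrite gmulA gmulVr gmul1. Qed.

Lemma gmulI x : injective (gmul x).
Proof. by move=> y z e; rewrite -(gmulKV x y) e gmulKV. Qed.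

Lemma ginv_uniq x y : x ⋅ y = gone -> y = ginv x.
Proof. by move=> e; rewrite -(gmulKV x y) e gmulr1. Qed.

Lemma ginvK x : ginv (ginv x) = x.
Proof. by symmetry; apply: ginv_uniq; rewrite gmulV. Qed.

Lemma ginvM x y : ginv (x ⋅ y) = ginv y ⋅ ginv x.
Proof. by symmetry; apply: ginv_uniq; rewrite gmulA gmulK gmulVr. Qed.

Lemma ginv1 : ginv (gone : G) = gone.
Proof. by symmetry; apply: ginv_uniq; rewrite gmul1. Qed.

End GroupFacts.

Definition grpE := (gmulA, ginvM, ginvK, ginv1, gmul1, gmulr1, gmulV, gmulVr, gmulK, gmulKr).
Ltac gs := rewrite ?grpE //.

Section HomFacts.
Variables (G H : group) (f : G -> H).
Hypothesis fM : is_hom f.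

Lemma hom1 : f gone = gone.
Proof. by apply: (@gmulI _ (f gone)); rewrite -fM gmul1 gmulr1. Qed.

Lemma homV x : f (ginv x) = ginv (f x).
Proof. by apply: ginv_uniq; rewrite -fM gmulVr hom1. Qed.
End HomFacts.

(** * Powers, subgroups and congruence modulo a subgroup *)

Fixpoint gpow (G : group) (x : G) (n : nat) : G :=
  if n is m.+1 then x ⋅ gpow x m else gone.

Section Powers.
Variable G : group.
Implicit Types x y : G.

Lemma gpowD x m n : gpow x (m + n) = gpow x m ⋅ gpow x n.
Proof. by elim: m => [|m IH]; rewrite ?gmul1 // addSn /= IH gmulA. Qed.

Lemma gpowSr x n : gpow x n.+1 = gpow x n ⋅ x.
Proof. by rewrite -addn1 gpowD /= gmulr1. Qed.

Lemma gpowM x m n : gpow x (m * n) = gpow (gpow x m) n.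
Proof. by elim: n => [|n IH]; rewrite ?muln0 // mulnS gpowD IH. Qed.

Lemma hom_gpow (H : group) (f : G -> H) : is_hom f ->
  forall x n, f (gpow x n) = gpow (f x) n.
Proof. by move=> fM x; elim=> [|n IH] /=; rewrite ?(hom1 fM) // fM IH. Qed.

End Powers.

Section Subgroups.
Variables (G : group) (N : G -> Prop).
Hypothesis sN : is_subgroup N.

Lemma sub1 : N gone. Proof. by case: sN. Qed.
Lemma subM x y : N x -> N y -> N (x ⋅ y). Proof. by case: sN => _ h _; apply: h. Qed.
Lemma subV x : N x -> N (ginv x). Proof. by case: sN => _ _; apply. Qed.
Lemma sub_gpow x n : N x -> N (gpow x n).
Proof. by move=> Nx; elim: n => [|n IH]; [exact: sub1 | exact: subM]. Qed.
Lemma subMr x y : N y -> N (x ⋅ y) <-> N x.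
Proof.
move=> Ny; split=> [Nxy|Nx]; last exact: subM.
by rewrite -(gmulK x y); apply: subM => //; apply: subV.
Qed.
Lemma subMl x y : N x -> N (x ⋅ y) <-> N y.
Proof.
move=> Nx; split=> [Nxy|Ny]; last exact: subM.
by rewrite -(gmulKV x y); apply: subM => //; apply: subV.
Qed.
Lemma subVE x : N (ginv x) <-> N x.
Proof. by split=> [/subV|/subV//]; rewrite ginvK. Qed.
End Subgroups.

Definition cong (G : group) (N : G -> Prop) (x y : G) : Prop := N (ginv x ⋅ y).

Section Congruence.
Variables (G : group) (N : G -> Prop).

Section Subgroup.
Hypothesis sN : is_subgroup N.
Lemma cong_refl x : cong N x x.
Proof. by rewrite /cong gmulV; apply: sub1 sN. Qed.
Lemma cong_sym x y : cong N x y -> cong N y x.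
Proof. by move=> /(subV sN); rewrite ginvM ginvK. Qed.
Lemma cong_trans y x z : cong N x y -> cong N y z -> cong N x z.
Proof. by move=> a b; have := subM sN a b; rewrite /cong !gmulA gmulK. Qed.
Lemma congM2l g x y : cong N (g ⋅ x) (g ⋅ y) <-> cong N x y.
Proof. by rewrite /cong; gs. Qed.
End Subgroup.

Hypothesis nN : is_normal N.
Lemma normal_conjV g x : N x -> N (g ⋅ x ⋅ ginv g).
Proof. by case: nN => _ h /(h (ginv g)); rewrite ginvK. Qed.
Lemma congM2r g x y : cong N x y -> cong N (x ⋅ g) (y ⋅ g).
Proof. by case: nN => _ h /(h g); rewrite /cong; gs. Qed.
Lemma congM x y x' y' : cong N x x' -> cong N y y' -> cong N (x ⋅ y) (x' ⋅ y').
Proof.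
move=> a b; apply: (cong_trans (proj1 nN)) (congM2r y' a).
by apply/congM2l.
Qed.
Lemma congV x y : cong N x y -> cong N (ginv x) (ginv y).
Proof.
move=> a; have := congM2r (ginv x) a.
by move=> /(congM2l (ginv y) _ _).2 /(cong_sym (proj1 nN)); gs.
Qed.
End Congruence.

Lemma cong1 (G : group) (x y : G) : cong (fun z => z = gone) x y <-> x = y.
Proof.
split=> [/ginv_uniq|->]; last exact: gmulV.
by rewrite ginvK.
Qed.

(** * Homogeneous cochains on lists *)

Section Cochains.
Variable k : comPzRingType.

Section OneType.
Variable X : Type.
Implicit Types (f g : seq X -> k) (s : seq X).

(* The simplicial coboundary, augmented in degree 0: deleting the head of the
   list gives the first face, and the other faces keep the head. *)
Fixpoint cobd f s : k :=
  if s is x :: s' then f s' - cobd (fun t => f (x :: t)) s' else 0.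

Definition supp (m : nat) f : Prop := forall s, size s != m -> f s = 0.

Lemma eq_cobd f g : (forall s, f s = g s) -> forall s, cobd f s = cobd g s.
Proof. by move=> /funext ->. Qed.

Lemma cobd0 s : cobd (fun=> 0) s = 0.
Proof. by elim: s => //= x s ->; rewrite subr0. Qed.

Lemma cobdD f g s : cobd (fun t => f t + g t) s = cobd f s + cobd g s.
Proof.
elim: s f g => [|x s IH] f g /=; first by rewrite addr0.
by rewrite IH opprD addrACA.
Qed.

Lemma cobdN f s : cobd (fun t => - f t) s = - cobd f s.
Proof. by elim: s f => [|x s IH] f /=; rewrite ?oppr0 // IH opprB addrC opprK. Qed.

Lemma cobdB f g s : cobd (fun t => f t - g t) s = cobd f s - cobd g s.
Proof. by rewrite cobdD cobdN. Qed.

Lemma cobd_sum (I : finType) (f : I -> seq X -> k) s :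
  cobd (fun t => \sum_i f i t) s = \sum_i cobd (f i) s.
Proof.
elim: s f => [|x s IH] f /=; first by rewrite big1.
by rewrite IH sumrB.
Qed.

Lemma cobdZ c f s : cobd (fun t => c * f t) s = c * cobd f s.
Proof. by elim: s f => [|x s IH] f /=; rewrite ?mulr0 // IH mulrBr. Qed.

Lemma cobdK f s : cobd (cobd f) s = 0.
Proof.
elim: s f => //= x s IH f.
by rewrite (cobdB f) IH subr0 subrr.
Qed.

(** Prepending a fixed point contracts the augmented complex of all functions. The cone breaks
    diagonal invariance, which is the only source of cohomology here; the double complexes below
    take the cone point from the other list to keep it. *)
Lemma cobd_cone f x : (forall s, cobd f s = 0) ->
  forall s, cobd (fun t => f (x :: t)) s = f s.
Proof. by move=> df s; have /= := df (x :: s) => /eqP; rewrite subr_eq0 => /eqP. Qed.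

Lemma supp_cobd m f : supp m f -> supp m.+1 (cobd f).
Proof.
move=> fm s; elim: s m f fm => //= x s IH m f fm; rewrite eqSS => ne.
rewrite fm // sub0r; apply/eqP; rewrite oppr_eq0; apply/eqP.
case: m fm ne => [|m] fm ne; last by apply: (IH m) => // t nt; apply: fm.
by rewrite -(cobd0 s); apply: eq_cobd => t; apply: fm.
Qed.

Lemma supp_cone m f x : supp m.+1 f -> supp m (fun t => f (x :: t)).
Proof. by move=> fm t nt; apply: fm. Qed.

Lemma suppD m f g : supp m f -> supp m g -> supp m (fun s => f s + g s).
Proof. by move=> a b s ns; rewrite a ?b ?addr0. Qed.
Lemma suppB m f g : supp m f -> supp m g -> supp m (fun s => f s - g s).
Proof. by move=> a b s ns; rewrite a ?b ?subr0. Qed.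
End OneType.

Section TwoTypes.
Variables X Y : Type.

Lemma cobd_map (r : X -> Y) (f : seq Y -> k) s :
  cobd f (map r s) = cobd (fun t => f (map r t)) s.
Proof. by elim: s f => //= x s IH f; rewrite IH. Qed.

(** With [X = Y] and [R] a congruence, this is the stability of constancy on cosets under the
    coboundary. *)
Lemma cobd_rel (R : X -> Y -> Prop) (f : seq X -> k) (g : seq Y -> k) :
  (forall s t, Forall2 R s t -> f s = g t) ->
  forall s t, Forall2 R s t -> cobd f s = cobd g t.
Proof.
move=> fg s t st; elim: st f g fg => //= x y {}s {}t xy st IH f g fg.
rewrite (fg _ _ st); congr (_ - _); apply: IH => s' t' st'.
by apply: fg; constructor.
Qed.

Definition cobdl (phi : seq X -> seq Y -> k) s t := cobd (phi^~ t) s.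
Definition cobdr (phi : seq X -> seq Y -> k) s t := cobd (phi s) t.

Lemma cobdlr phi s t : cobdl (cobdr phi) s t = cobdr (cobdl phi) s t.
Proof.
rewrite /cobdl /cobdr; elim: s phi => [|x s IH] phi /=; first by rewrite cobd0.
by rewrite cobdB (IH (fun s' => phi (x :: s'))).
Qed.

Definition supp2 i j (phi : seq X -> seq Y -> k) :=
  forall s t, (size s != i) || (size t != j) -> phi s t = 0.

Lemma supp2l i j phi t : supp2 i j phi -> supp i (phi^~ t).
Proof. by move=> h s ns; rewrite h ?ns. Qed.
Lemma supp2r i j phi s : supp2 i j phi -> supp j (phi s).
Proof. by move=> h t nt; rewrite h ?nt ?orbT. Qed.
Lemma supp2_cobdl i j phi : supp2 i j phi -> supp2 i.+1 j (cobdl phi).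
Proof.
move=> h s t /orP[ns|nt]; first exact: (supp_cobd (supp2l t h)).
by rewrite -(cobd0 s); apply: eq_cobd => s'; rewrite h ?nt ?orbT.
Qed.
Lemma supp2_cobdr i j phi : supp2 i j phi -> supp2 i j.+1 (cobdr phi).
Proof.
move=> h s t /orP[ns|nt]; last exact: (supp_cobd (supp2r s h)).
by rewrite -(cobd0 t); apply: eq_cobd => t'; rewrite h ?ns.
Qed.
Lemma supp2B i j phi psi : supp2 i j phi -> supp2 i j psi ->
  supp2 i j (fun s t => phi s t - psi s t).
Proof. by move=> a b s t ne; rewrite a ?b ?subr0. Qed.

End TwoTypes.

(* The prism homotopy between pullback along a self-map [r] and the identity. *)
Fixpoint prism X (r : X -> X) (f : seq X -> k) (s : seq X) : k :=
  if s is x :: s' then f (x :: map r s) - prism r (fun t => f (x :: t)) s' else 0.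

Section Prism.
Variable X : Type.
Implicit Types (f g : seq X -> k) (r : X -> X).

Lemma prism0 r s : prism r (fun=> 0) s = 0.
Proof. by elim: s => //= x s ->; rewrite subr0. Qed.

Lemma prismB r f g s : prism r (fun t => f t - g t) s = prism r f s - prism r g s.
Proof.
elim: s f g => [|x s IH] f g /=; first by rewrite subr0.
by rewrite IH !opprD !opprK addrACA.
Qed.

Lemma prismP r f s :
  cobd (prism r f) s + prism r (cobd f) s = f (map r s) - f s.
Proof.
elim: s f => [|x s IH] f; first by rewrite /= addr0 subrr.
have -> : prism r (cobd f) (x :: s) =
    cobd f (x :: map r (x :: s)) - prism r (fun t => cobd f (x :: t)) s by [].
rewrite /= cobdB prismB cobd_map.
have /eqP := IH (fun t => f (x :: t)); rewrite addrC -subr_eq => /eqP /= <-.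
by ring.
Qed.

Lemma prism_rel Y r (r' : Y -> Y) (R : X -> Y -> Prop) f (g : seq Y -> k) :
  (forall x y, R x y -> R (r x) (r' y)) ->
  (forall s t, Forall2 R s t -> f s = g t) ->
  forall s t, Forall2 R s t -> prism r f s = prism r' g t.
Proof.
move=> rr fg s t st; elim: st f g fg => //= x y {}s {}t xy st IH f g fg.
congr (_ - _).
  apply: fg; do 2 (constructor; auto).
  by elim: st => //=; constructor; auto.
by apply: IH => s' t' st'; apply: fg; constructor.
Qed.

Lemma supp_prism m r f : supp m.+1 f -> supp m (prism r f).
Proof.
move=> fm s ne; have : forall t, size t = (size s).+1 -> f t = 0.
  by move=> t et; rewrite fm // et eqSS.
elim: s f {fm ne} => //= x s IH f f0; rewrite IH => [|t et]; last first.
  by apply: f0; rewrite /= et.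
by rewrite f0 ?subr0 //= size_map.
Qed.
End Prism.
End Cochains.

(** * Diagram chase in a double complex with a subcomplex *)

Section Zigzag.
Variables (k : comPzRingType) (X Y : Type).
Variables K L : nat -> nat -> (seq X -> seq Y -> k) -> Prop.
Hypothesis K0 : forall i j, K i j (fun _ _ => 0).
Hypothesis KB : forall i j phi psi, K i j phi -> K i j psi ->
  K i j (fun s t => phi s t - psi s t).
Hypothesis Kl : forall i j phi, K i j phi -> K i.+1 j (cobdl phi).
Hypothesis Kr : forall i j phi, K i j phi -> K i j.+1 (cobdr phi).
Hypothesis LK : forall i j phi, L i j phi -> K i j phi.
Hypothesis LB : forall i j phi psi, L i j phi -> L i j psi ->
  L i j (fun s t => phi s t - psi s t).
Hypothesis Ll : forall i j phi, L i j phi -> L i.+1 j (cobdl phi).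
Hypothesis Lr : forall i j phi, L i j phi -> L i j.+1 (cobdr phi).
Hypothesis exKl : forall i j phi, K i.+1 j.+1 phi -> (forall s t, cobdl phi s t = 0) ->
  exists psi, K i j.+1 psi /\ forall s t, cobdl psi s t = phi s t.
Hypothesis exKr : forall i j phi, K i.+1 j.+1 phi -> (forall s t, cobdr phi s t = 0) ->
  exists psi, K i.+1 j psi /\ forall s t, cobdr psi s t = phi s t.
Hypothesis exKr0 : forall i phi, K i.+1 0 phi -> (forall s t, cobdr phi s t = 0) ->
  forall s t, phi s t = 0.
Hypothesis exLl : forall i j phi, L i.+1 j.+1 phi -> (forall s t, cobdl phi s t = 0) ->
  exists psi, L i j.+1 psi /\ forall s t, cobdl psi s t = phi s t.
Hypothesis exLr : forall i j phi, L i.+1 j.+1 phi -> (forall s t, cobdr phi s t = 0) ->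
  exists psi, L i.+1 j psi /\ forall s t, cobdr psi s t = phi s t.

(* The last conjunct encodes that [K] vanishes in negative degrees. *)
Definition splits i j phi := exists alpha beta lambda,
  [/\ K i.-1 j alpha, K i j.-1 beta, L i j lambda,
      forall s t, phi s t = cobdl alpha s t + cobdr beta s t + lambda s t &
      (i = 0 -> alpha = fun _ _ => 0) /\ (j = 0 -> beta = fun _ _ => 0)].

(** Chase along an antidiagonal, by induction on [i]. Modulo [L], the hypothesis makes [cobdr phi]
    closed for [cobdl], so exactness produces a [psi] one step nearer to the edge [i = 0], and a
    splitting of [psi] yields one of [phi]. Exactness of [L] in both directions keeps the error
    terms inside [L]. *)
Lemma zigzag m :
  (forall phi, K 0 m phi -> L 1 m.+1 (cobdl (cobdr phi)) -> splits 0 m phi) ->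
  forall i j phi, (i + j)%N = m -> K i j phi ->
    L i.+1 j.+1 (cobdl (cobdr phi)) -> splits i j phi.
Proof.
move=> base; elim=> [|i IH] j phi; first by rewrite add0n => ->; apply: base.
rewrite addSnnS => ij Kphi Lphi.
have [la [Lla dla]] := exLl Lphi (fun s t => cobdK (fun s' => cobdr phi s' t) s).
have [psi [Kpsi dpsi]] : exists psi, K i j.+1 psi /\
    forall s t, cobdl psi s t = cobdr phi s t - la s t.
  apply: exKl => [|s t]; first by apply: KB (Kr Kphi) (LK Lla).
  by rewrite {1}/cobdl cobdB -/(cobdl _ s t) -/(cobdl la s t) dla subrr.
have [|a [b [ka [Ka Kb Lka psiE [a0 _]]]]] := IH _ _ ij Kpsi.
  have -> : cobdl (cobdr psi) = (fun s t => 0 - cobdr la s t).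
    apply: funext => s; apply: funext => t; rewrite cobdlr sub0r /cobdr.
    by rewrite (eq_cobd (dpsi s)) cobdB [X in X - _]cobdK sub0r.
  have := LB (Lr Lla) (Lr Lla) => /LB /(_ (Lr Lla)).
  by congr (L _ _ _); apply: funext => s; apply: funext => t; rewrite subrr.
(* The splitting of [psi] makes [rho] the [cobdr] of [phi - cobdl b]. As [rho] lies in [L], a
   primitive [si] can be taken in [L], and what remains of [phi] is closed for [cobdr]. *)
pose rho s t := la s t + cobdl ka s t.
have Lrho : L i.+1 j.+1 rho.
  have L0 : L i.+1 j.+1 (fun s t => 0).
    by have := LB Lla Lla; congr (L _ _ _); apply: funext=> s; apply: funext=> t; rewrite subrr.
  have := LB Lla (LB L0 (Ll Lka)).
  by congr (L _ _ _); apply: funext => s; apply: funext => t; rewrite sub0r opprK.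
have rhoE s t : rho s t = cobdr (fun s t => phi s t - cobdl b s t) s t.
  rewrite {1}/cobdr cobdB -/(cobdr phi s t) -/(cobdr (cobdl b) s t).
  rewrite -[cobdr phi s t](subrK (la s t)) -dpsi /rho.
  have -> : cobdl psi s t = cobdr (cobdl b) s t + cobdl ka s t.
    rewrite -cobdlr /cobdl (eq_cobd (psiE^~ t)) !cobdD.
    by rewrite [X in X + _ + _]cobdK add0r.
  by ring.
have drho s t : cobdr rho s t = 0.
  by rewrite /cobdr (eq_cobd (rhoE s)) cobdK.
have [si [Lsi dsi]] := exLr Lrho drho.
have Krest := KB (KB Kphi (Kl Kb)) (LK Lsi).
have drest s t : cobdr (fun s t => phi s t - cobdl b s t - si s t) s t = 0.
  by rewrite /cobdr cobdB -/(cobdr si s t) dsi rhoE subrr.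
have [j0|/prednK jE] := posnP j.
  subst j.
  exists b, (fun _ _ => 0), si; split=> // s t.
  rewrite [X in _ + X + _]cobd0 addr0; have /eqP := exKr0 Krest drest s t.
  by rewrite subr_eq0 subr_eq addrC => /eqP.
move: Krest; rewrite -{1}jE => /exKr/(_ drest)[ga [Kga dga]].
exists b, ga, si; split=> // [s t|]; first by rewrite dga; ring.
by split=> // j0; rewrite j0 in jE.
Qed.
End Zigzag.

(* A choice that depends only on the extension of the predicate, so that it
   provides invariant orbit representatives. *)
Definition pick_one (T : Type) (x0 : T) (P : T -> Prop) : T :=
  if pselect (exists x, P x) is left e then projT1 (cid e) else x0.

Lemma pick_oneP (T : Type) (x0 : T) (P : T -> Prop) :
  (exists x, P x) -> P (pick_one x0 P).
Proof. by rewrite /pick_one; case: pselect => // e _; case: (cid e). Qed.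

Lemma eq_pick_one (T : Type) (x0 : T) (P Q : T -> Prop) :
  (forall x, P x <-> Q x) -> pick_one x0 P = pick_one x0 Q.
Proof. by move=> PQ; have -> : P = Q by apply: funext => x; apply/propext. Qed.

(** * Subgroups of p-power index *)

Section FiniteIndex.
Variables (G : group) (N : G -> Prop).
Hypothesis nN : is_normal N.
Let sN := proj1 nN.

Definition fin_index (c : nat) : Prop :=
  exists r : 'I_c -> G, forall g, exists! i, N (ginv (r i) ⋅ g).

(** The map [q] need not be constant on cosets. Evaluated at canonical representatives only, it
    becomes a complete invariant of the coset, and its values there count the cosets exactly. *)
Lemma fin_index_of_map (T : finType) (q : G -> T) :
  (forall g h, q g = q h -> cong N g h) -> exists c, fin_index c.
Proof.
move=> qN; pose can g := pick_one gone (cong N g).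
have canN g : cong N g (can g) by apply: pick_oneP; exists g; apply: cong_refl.
have canE g h : cong N g h -> can g = can h.
  move=> gh; apply: eq_pick_one => x; split; apply: (cong_trans sN) => //.
  exact: cong_sym.
pose E := [set t : T | `[< exists g, q (can g) = t >]].
have repE (i : 'I_#|E|) : exists x, x = can x /\ q x = enum_val i.
  have := enum_valP i; rewrite inE => /asboolP[g <-].
  by exists (can g); split=> //; apply/canE/canN.
have [r rP] := choice repE.
exists #|E|, r => g.
have Eg : q (can g) \in E by rewrite inE; apply/asboolP; exists g.
exists (enum_rank_in Eg (q (can g))); split=> [|i Ni].
  apply: cong_trans (cong_sym sN (canN g)) => //; apply: qN.
  by rewrite (rP _).2 enum_rankK_in.
by apply: enum_val_inj; rewrite enum_rankK_in // -(canE _ _ Ni) -(rP i).1 (rP i).2.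
Qed.

Lemma coset_perm c : fin_index c ->
  exists (phi : G -> 'S_c) (H : {group 'S_c}),
    [/\ forall x y, phi (x ⋅ y) = (phi x * phi y)%g,
        forall x, phi x = 1%g <-> N x, forall s, s \in H <-> exists x, phi x = s
      & #|H| = c].
Proof.
move=> [r rP].
have rU g i j : cong N (r i) g -> cong N (r j) g -> i = j.
  by have [l [_ lU]] := rP g => /lU <- /lU.
have idx0 g : exists i, cong N (r i) g by have [i [Ni _]] := rP g; exists i.
have [idx idxP] := choice idx0.
pose f x i := idx (ginv x ⋅ r i).
have f_inj x : injective (f x).
  move=> i j e; apply: (rU (r j)); last exact: cong_refl.
  apply/(congM2l N (ginv x)); apply: (cong_trans sN (y := r (f x i))).
    exact/(cong_sym sN)/idxP.
  by rewrite e; apply: idxP.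
pose phi x : 'S_c := perm (@f_inj x).
have idxE g h : cong N g h -> idx g = idx h.
  by move=> gh; apply: (rU h) (idxP h); apply: cong_trans (idxP g) gh.
have phiM x y : phi (x ⋅ y) = (phi x * phi y)%g.
  apply/permP => i; rewrite permM !permE /f; apply: idxE.
  by rewrite ginvM -gmulA; apply/congM2l; apply: (cong_sym sN); apply: idxP.
have phi1 x : phi x = 1%g <-> N x.
  have conjN i : cong N (r i) (ginv x ⋅ r i) <-> N x.
    rewrite -(subVE sN x); split=> [/(normal_conjV nN (r i))|Nx]; first by gs.
    by rewrite /cong gmulA; apply: (proj2 nN).
  split=> [e|Nx].
    apply/(conjN (idx gone)); have /permP/(_ (idx gone)) := e.
    by rewrite permE perm1 => {1}<-; apply: idxP.
  apply/permP => i; rewrite permE perm1; apply: (rU (ginv x ⋅ r i)) (idxP _) _.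
  exact/conjN.
have phi_gone : phi gone = 1%g by apply/phi1/(sub1 sN).
have gH : group_set [set s | `[< exists x, phi x = s >]].
  apply/group_setP; split; first by rewrite inE; apply/asboolP; exists gone.
  move=> s t; rewrite !inE => /asboolP[x <-] /asboolP[y <-].
  by apply/asboolP; exists (x ⋅ y).
exists phi, (fingroup.group gH); split=> // [s|].
  by rewrite inE; split=> [/asboolP|] // h; apply/asboolP.
rewrite -[RHS]card_ord -(card_imset (f := fun i => phi (r i))); last first.
  move=> i j e; apply: (rU (r j)); last exact: cong_refl.
  apply/phi1; rewrite phiM -e -phiM; apply/phi1.
  by rewrite gmulV; apply: sub1.
apply: eq_card => s; rewrite inE; apply/asboolP/imsetP => [[x <-]|[i _ ->]]; last by exists (r i).
exists (idx x) => //; have /phi1 := idxP x; rewrite phiM => e.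
apply: (mulgI (phi (ginv (r (idx x))))); rewrite e -phiM.
by rewrite gmulV.
Qed.

Section PrimePower.
Variable p : nat.
Hypothesis p_pr : prime p.

(** Cauchy's theorem in the finite quotient: if every element has p-power order, no other prime
    divides the order of the group. *)
Lemma p_power_indexP : has_p_power_index p N <->
  (exists c, fin_index c) /\ (forall g, exists j, N (gpow g (p ^ j))).
Proof.
have pow1 c (phi : G -> 'S_c) : (forall x y, phi (x ⋅ y) = (phi x * phi y)%g) ->
    phi gone = 1%g -> forall x n, phi (gpow x n) = (phi x ^+ n)%g.
  by move=> phiM phi1 x; elim=> //= n IH; rewrite phiM IH expgS.
split=> [[j [r rP]]|[[c ic] Np]].
  have ic : fin_index (p ^ j) by exists r.
  split; first by exists (p ^ j)%N.
  move=> g; exists j; have [phi [H [phiM phi1 HP cH]]] := coset_perm ic.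
  have /expg_cardG : phi g \in H by apply/HP; exists g.
  rewrite cH => e; apply/phi1; rewrite pow1 //.
  by apply/phi1/(sub1 sN).
have [phi [H [phiM phi1 HP cH]]] := coset_perm ic.
have pH : (p.-group H)%g.
  apply/pgroupP => l l_pr /(Cauchy l_pr)[s /HP[g <-] ol].
  have [j /phi1] := Np g; rewrite pow1 //; last by apply/phi1/(sub1 sN).
  move/eqP; rewrite -order_dvdn ol => lj.
  by rewrite inE -(dvdn_prime2 l_pr p_pr); move: lj; rewrite Euclid_dvdX // => /andP[].
by exists (logn p #|H|); rewrite -card_pgroup // cH; exact: ic.
Qed.

Lemma p_power_quotient : has_p_power_index p N ->
  exists (c : nat) (phi : G -> 'S_c) (H : {group 'S_c}),
    [/\ forall x y, phi (x ⋅ y) = (phi x * phi y)%g,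
        forall x, phi x = 1%g <-> N x, forall s, s \in H <-> exists x, phi x = s
      & (p.-group H)%g].
Proof.
move=> [j ic]; have [phi [H [a b e cH]]] := coset_perm ic.
by exists (p ^ j)%N, phi, H; split=> //; rewrite /pgroup cH pnatX pnat_id.
Qed.
End PrimePower.
End FiniteIndex.

Section PNormal.
Variable p : nat.
Hypothesis p_pr : prime p.

(** Finiteness is witnessed by any map to a finite type that separates cosets. In this form
    intersections, preimages and images require no counting of cosets. *)
Lemma pnormalP (G : group) (N : G -> Prop) : pnormal p N <->
  [/\ is_normal N, exists (T : finType) (q : G -> T), forall g h, q g = q h -> cong N g h
    & forall g, exists j, N (gpow g (p ^ j))].
Proof.
split=> [[nN /(p_power_indexP nN p_pr)[[c ic] Np]]|[nN [T [q qN]] Np]].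
  split=> //; have [phi [_ [phiM phi1 _ _]]] := coset_perm nN ic.
  exists 'S_c, phi => g h e; apply/phi1; rewrite phiM -e -phiM.
  by apply/phi1; rewrite gmulV; apply: sub1 (proj1 nN).
split=> //; apply/(p_power_indexP nN p_pr); split=> //.
exact: fin_index_of_map qN.
Qed.

Lemma pnormal_sub (G : group) (N : G -> Prop) : pnormal p N -> is_subgroup N.
Proof. by case=> -[]. Qed.

Lemma pnormal_normal (G : group) (N : G -> Prop) : pnormal p N -> is_normal N.
Proof. by case. Qed.

Lemma pnormalT (G : group) : pnormal p (fun _ : G => True).
Proof.
by apply/pnormalP; split; [split | exists unit, (fun=> tt) | exists 0%N].
Qed.

Lemma pnormalI (G : group) (M N : G -> Prop) :
  pnormal p M -> pnormal p N -> pnormal p (fun x => M x /\ N x).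
Proof.
move=> /pnormalP[[sM nM] [S [q qM]] Mp] /pnormalP[[sN nN] [T [r rN]] Np]; apply/pnormalP; split.
- split; last by move=> g x [/nM h /nN].
  split; first by split; apply: sub1.
    by move=> x y [? ?] [? ?]; split; apply: subM.
  by move=> x [? ?]; split; apply: subV.
- by exists (S * T)%type, (fun g => (q g, r g)) => g h [/qM ? /rN].
- move=> g; have [i Mi] := Mp g; have [j Nj] := Np g; exists (i + j)%N.
  by rewrite expnD; split; [|rewrite mulnC]; rewrite gpowM; apply: sub_gpow => //; split.
Qed.

Lemma pnormal_preim (G H : group) (f : G -> H) (N : H -> Prop) : is_hom f ->
  pnormal p N -> pnormal p (fun x => N (f x)).
Proof.
move=> fM /pnormalP[[sN nN] [T [q qN]] Np]; apply/pnormalP; split.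
- split; last by move=> g x; rewrite !fM (homV fM); apply: nN.
  split; rewrite ?(hom1 fM); first exact: sub1.
    by move=> x y; rewrite fM; apply: subM.
  by move=> x; rewrite (homV fM); apply: subV.
- by exists T, (fun g => q (f g)) => g h /qN; rewrite /cong fM homV.
- by move=> g; have [j Nj] := Np (f g); exists j; rewrite (hom_gpow fM).
Qed.

Lemma pnormalS (G : group) (M N : G -> Prop) : pnormal p M -> is_normal N ->
  (forall x, M x -> N x) -> pnormal p N.
Proof.
move=> /pnormalP[_ [T [q qM]] Mp] nN MN; apply/pnormalP; split=> //.
  by exists T, q => g h /qM /MN.
by move=> g; have [j /MN] := Mp g; exists j.
Qed.

Lemma pnormal_bigI (G : group) (I : finType) (N : I -> G -> Prop) :
  (forall i, pnormal p (N i)) -> pnormal p (fun x => forall i, N i x).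
Proof.
move=> pN; have : pnormal p (fun x => forall i, i \in enum I -> N i x).
  elim: (enum I) => [|i s IH].
    by apply: pnormalS (pnormalT G) _ _ => //; apply: (pnormal_normal (pnormalT G)).
  rewrite (_ : (fun x => _) = fun x => N i x /\ forall j, j \in s -> N j x).
    exact: pnormalI.
  apply: funext => x; apply/propext; split=> [h|[hi hs] j].
    by split=> [|j js]; apply: h; rewrite inE ?eqxx ?js ?orbT.
  by rewrite inE => /predU1P[->|/hs].
congr (pnormal p _); apply: funext => x; apply/propext; split=> h i //.
by apply: h; rewrite mem_enum.
Qed.

Lemma pnormal_cosets (G : group) (N : G -> Prop) : pnormal p N ->
  exists (I : finType) (r : I -> G) (c : G -> I), [/\ forall g, cong N (r (c g)) g
    & forall g h, cong N g h -> c g = c h].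
Proof.
move=> [nN [j [r rP]]]; exists 'I_(p ^ j), r.
have c0 g : exists i, cong N (r i) g by have [i [Ni _]] := rP g; exists i.
have [c cP] := choice c0; exists c; split=> // g h gh.
have [l [_ lU]] := rP h; rewrite -(lU (c h) (cP h)); apply/esym/lU.
by apply: cong_trans (cP g) gh; apply: proj1 nN.
Qed.
End PNormal.

(** * Entrywise related lists and invariant cochains *)

Section ListRelations.
Variables X Y X' Y' : Type.
Implicit Types R : X -> Y -> Prop.

Lemma F2_size R s t : Forall2 R s t -> size s = size t.
Proof. by elim=> //= x y {}s {}t _ _ ->. Qed.

Lemma F2_map R (R' : X' -> Y' -> Prop) (f : X -> X') (g : Y -> Y') s t :
  (forall x y, R x y -> R' (f x) (g y)) -> Forall2 R s t -> Forall2 R' (map f s) (map g t).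
Proof. by move=> h; elim=> /= [|x y {}s {}t xy _ IH]; constructor; auto. Qed.

Lemma F2_imp R R' s t : (forall x y, R x y -> R' x y) -> Forall2 R s t -> Forall2 R' s t.
Proof. by move=> h; elim=> [|x y {}s {}t xy _ IH]; constructor; auto. Qed.

Lemma F2_diag (R : X -> X -> Prop) s : (forall x, R x x) -> Forall2 R s s.
Proof. by move=> h; elim: s => [|x s IH]; constructor. Qed.

Lemma F2_maps (R : X' -> Y' -> Prop) (f : X -> X') (g : X -> Y') s :
  (forall x, R (f x) (g x)) -> Forall2 R (map f s) (map g s).
Proof. by move=> h; elim: s => [|x s IH] /=; constructor. Qed.

Lemma F2_mapr (R : X -> Y' -> Prop) (g : X -> Y') s :
  (forall x, R x (g x)) -> Forall2 R s (map g s).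
Proof. by move=> h; elim: s => [|x s IH] /=; constructor. Qed.

End ListRelations.

Lemma map_mul1 (G : group) (s : seq G) : map (gmul gone) s = s.
Proof. by elim: s => //= x s ->; rewrite gmul1. Qed.

Lemma map_mulM (G : group) (g h : G) s : map (gmul (g ⋅ h)) s = map (gmul g) (map (gmul h) s).
Proof. by elim: s => //= x s ->; rewrite gmulA. Qed.

Lemma map_mulKV (G : group) (g : G) s : map (gmul (ginv g)) (map (gmul g) s) = s.
Proof. by rewrite -map_mulM gmulV map_mul1. Qed.

Lemma map_mulVK (G : group) (g : G) s : map (gmul g) (map (gmul (ginv g)) s) = s.
Proof. by rewrite -map_mulM gmulVr map_mul1. Qed.

Section Invariance.
Variables (k : comPzRingType) (G : group).
Implicit Types (A N M : G -> Prop) (f h : seq G -> k).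

(** It has two roles: cochains of the quotient when [N] is a central subgroup, and uniform local
    constancy when [N] has p-power index. *)
Definition cinv N f := forall s t, Forall2 (cong N) s t -> f s = f t.
Definition dinv N f := forall g s, N g -> f (map (gmul g) s) = f s.

Lemma cinvS M N f : (forall x, M x -> N x) -> cinv N f -> cinv M f.
Proof. by move=> MN fN s t st; apply: fN; apply: F2_imp st => x y /MN. Qed.
Lemma dinvS M N f : (forall x, M x -> N x) -> dinv N f -> dinv M f.
Proof. by move=> MN fN g s /MN; apply: fN. Qed.
Lemma cinv_cobd N f : cinv N f -> cinv N (cobd f).
Proof. exact: cobd_rel. Qed.
Lemma dinv_cobd N f : dinv N f -> dinv N (cobd f).
Proof. by move=> fN g s Ng; rewrite cobd_map; apply: eq_cobd => t; apply: fN. Qed.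
Lemma cinvB N f h : cinv N f -> cinv N h -> cinv N (fun s => f s - h s).
Proof. by move=> a b s t st; rewrite (a _ _ st) (b _ _ st). Qed.
Lemma dinvB N f h : dinv N f -> dinv N h -> dinv N (fun s => f s - h s).
Proof. by move=> a b g s Ng; rewrite a ?b. Qed.
Lemma cinvD N f h : cinv N f -> cinv N h -> cinv N (fun s => f s + h s).
Proof. by move=> a b s t st; rewrite (a _ _ st) (b _ _ st). Qed.
Lemma dinvD N f h : dinv N f -> dinv N h -> dinv N (fun s => f s + h s).
Proof. by move=> a b g s Ng; rewrite a ?b. Qed.
Lemma cinv_cone N f x : is_subgroup N -> cinv N f -> cinv N (fun s => f (x :: s)).
Proof. by move=> sN fN s t st; apply: fN; constructor=> //; apply: cong_refl. Qed.
Lemma cinv1 f : cinv (fun x => x = gone) f.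
Proof.
by move=> s t st; congr f; elim: st => // x y {}s {}t /cong1 -> _ ->.
Qed.
Lemma cinv_dinv N f : is_normal N -> cinv N f -> dinv N f.
Proof.
move=> nN fN g s Ng; apply/esym/fN; apply: F2_mapr => x.
by rewrite /cong gmulA; apply: (proj2 nN).
Qed.
Lemma cinv_central A f : is_subgroup A -> (forall a x, A a -> a ⋅ x = x ⋅ a) ->
  cinv A f -> forall a s, A a -> f (map (gmul a) s) = f s.
Proof.
move=> sA cA fA a s Aa; apply/esym/fA; apply: F2_mapr => x.
by rewrite cA // /cong; gs.
Qed.
End Invariance.

(** * Effaceability and acyclicity modulo locally constant cochains *)

Section Effaceability.
Variable p : nat.
Hypothesis p_pr : prime p.
Notation k := 'Z_p.

(* Every class of positive degree of every subgroup [N] of p-power index of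
   [G / A] dies on a smaller one: the [N]-invariant functions on lists
   compute the cohomology of [N] because [N] acts freely on [G]. *)
Definition effaceable (G : group) (A : G -> Prop) : Prop :=
  forall m N (f : seq G -> k), pnormal p N -> (forall x, A x -> N x) ->
    supp m.+2 f -> cinv A f -> dinv N f -> (forall s, cobd f s = 0) ->
  exists M h, [/\ pnormal p M, forall x, A x -> M x, supp m.+1 h, cinv A h &
    dinv M h /\ forall s, cobd h s = f s].

Definition loc_const (G : group) (f : seq G -> k) : Prop :=
  exists N, pnormal p N /\ cinv N f.

(* Acyclicity of the quotient of the complex of all equivariant cochains by the
   locally constant ones. *)
Definition lc_acyclic (G : group) : Prop := forall m (f : seq G -> k),
  supp m.+1 f -> dinv (fun=> True) f -> loc_const (cobd f) ->
  exists h, [/\ supp m h, dinv (fun=> True) h & loc_const (fun s => f s - cobd h s)].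

Lemma loc_constB (G : group) (f h : seq G -> k) : loc_const f -> loc_const h ->
  loc_const (fun s => f s - h s).
Proof.
move=> [M [pM fM]] [N [pN hN]]; exists (fun x => M x /\ N x); split; first exact: pnormalI.
by apply: cinvB; [apply: cinvS fM | apply: cinvS hN] => x [].
Qed.

Lemma loc_constD (G : group) (f h : seq G -> k) : loc_const f -> loc_const h ->
  loc_const (fun s => f s + h s).
Proof.
move=> [M [pM fM]] [N [pN hN]]; exists (fun x => M x /\ N x); split; first exact: pnormalI.
by apply: cinvD; [apply: cinvS fM | apply: cinvS hN] => x [].
Qed.

Lemma loc_const_cobd (G : group) (f : seq G -> k) : loc_const f -> loc_const (cobd f).
Proof. by move=> [N [pN fN]]; exists N; split=> //; apply: cinv_cobd. Qed.

Lemma effaceable_family (G : group) (A : G -> Prop) : effaceable A ->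
  forall m N (I : finType) (f : I -> seq G -> k), pnormal p N -> (forall x, A x -> N x) ->
  (forall i, [/\ supp m.+2 (f i), cinv A (f i), dinv N (f i) & forall s, cobd (f i) s = 0]) ->
  exists M h, [/\ pnormal p M, forall x, A x -> M x, forall x, M x -> N x &
    forall i, [/\ supp m.+1 (h i), cinv A (h i), dinv M (h i) & forall s, cobd (h i) s = f i s]].
Proof.
move=> effA m N I f pN AN fP.
have /choice[Mh MhP] i : exists Mh : (G -> Prop) * (seq G -> k), [/\ pnormal p Mh.1,
    forall x, A x -> Mh.1 x, supp m.+1 Mh.2, cinv A Mh.2 &
    dinv Mh.1 Mh.2 /\ forall s, cobd Mh.2 s = f i s].
  have [a b c d] := fP i; have [M [h hP]] := effA m N (f i) pN AN a b c d.
  by exists (M, h).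
exists (fun x => N x /\ forall i, (Mh i).1 x), (fun i => (Mh i).2); split.
- by apply: pnormalI => //; apply: pnormal_bigI => // i; case: (MhP i).
- by move=> x Ax; split=> [|i]; [apply: AN | case: (MhP i) => _ h _ _ _; apply: h].
- by move=> x [].
- move=> i; have [_ _ a b [c d]] := MhP i; split=> //.
  by apply: dinvS c => x [_]; apply.
Qed.

Section EffToAcyclic.
Variable G : group.
Hypothesis effG : effaceable (fun x : G => x = gone).

Definition eqv2 (phi : seq G -> seq G -> k) :=
  forall g s t, phi (map (gmul g) s) (map (gmul g) t) = phi s t.
(** This is the ambient double complex for the zigzag and [lc2_cochain] the inner one. Both are
    locally constant on the right, so the passage from one to the other compares arbitrary with
    locally constant cochains on the left. *)
Definition lcr_cochain i j (phi : seq G -> seq G -> k) := [/\ supp2 i j phi, eqv2 phi &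
  exists2 N, pnormal p N & forall s, cinv N (phi s)].
Definition lc2_cochain i j (phi : seq G -> seq G -> k) := [/\ supp2 i j phi, eqv2 phi &
  exists2 N, pnormal p N & forall s s' t t', Forall2 (cong N) s s' -> Forall2 (cong N) t t' ->
    phi s t = phi s' t'].

Lemma eqv2B phi psi : eqv2 phi -> eqv2 psi -> eqv2 (fun s t => phi s t - psi s t).
Proof. by move=> a b g s t; rewrite a b. Qed.

Lemma eqv2_cobdl phi : eqv2 phi -> eqv2 (cobdl phi).
Proof. by move=> a g s t; rewrite /cobdl cobd_map; apply: eq_cobd => u; apply: a. Qed.

Lemma eqv2_cobdr phi : eqv2 phi -> eqv2 (cobdr phi).
Proof. by move=> a g s t; rewrite /cobdr cobd_map; apply: eq_cobd => u; apply: a. Qed.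

(** This is the exactness that needs effaceability: the head of [t] is no admissible cone point, as
    [phi] need not be locally constant on the left. For fixed [t], the cocycle [phi^~ t] is
    [N]-invariant and depends only on the cosets of the entries of [t]. So finitely many cocycles
    have to be killed, and one subgroup [M] serves them all. *)
Lemma lcr_exact_l i j phi : lcr_cochain i.+1 j.+1 phi -> (forall s t, cobdl phi s t = 0) ->
  exists psi, lcr_cochain i j.+1 psi /\ forall s t, cobdl psi s t = phi s t.
Proof.
case: i => [|i] [sphi ephi [N pN Nphi]] dphi.
  (* Closed in degree 0 means constant, and the constant is a value on the empty list of the
     augmentation. *)
  have cst x y t : phi [:: x] t = phi [:: y] t.
    have /eqP := dphi [:: x; y] t; rewrite /cobdl /= subr0 subr_eq0.
    by move/eqP.
  exists (fun s t => if s is [::] then phi [:: gone] t else 0); split.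
    split; [move=> [|x s] t //= nt | move=> g [|x s] t //= | exists N => // -[|x s] //].
      by apply: sphi; rewrite nt orbT.
    by rewrite -(ephi g [:: gone] t) /=; apply: cst.
  move=> [|x [|y s]] t; rewrite /cobdl /=; first by rewrite sphi.
    by rewrite subr0; apply: cst.
  by rewrite sphi // sub0r cobd0 subr0 oppr0.
have [I [r [c [rc cE]]]] := pnormal_cosets pN.
pose f (u : j.+1.-tuple I) s := phi s (map r u).
have [|u|M [h [pM _ MN hP]]] := effaceable_family effG (m := i) (I := _) (f := f) pN.
- by move=> x ->; apply: sub1 (pnormal_sub pN).
- split; [exact: (supp2l (map r u) sphi) | exact: cinv1 | | by move=> s; apply: dphi].
  move=> g s Ng; rewrite /f -(ephi g s); apply: Nphi; apply: F2_mapr => x.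
  by rewrite /cong gmulA; apply: (proj2 (pnormal_normal pN)).
pose u y t : j.+1.-tuple I := [tuple c (ginv y ⋅ nth gone t l) | l < j.+1].
have uE y t : size t = j.+1 -> Forall2 (cong N) (map r (u y t)) (map (gmul (ginv y)) t).
  move=> st; rewrite (_ : map r _ = map (fun x => r (c (ginv y ⋅ x))) t).
    by apply: F2_maps => x; apply: rc.
  apply: (eq_from_nth (x0 := gone)); first by rewrite size_map size_tuple size_map st.
  move=> l; rewrite size_map size_tuple => lj.
  rewrite (nth_map (c gone)) ?size_tuple // (nth_map gone) ?st //.
  by rewrite -(tnth_nth _ _ (Ordinal lj)) tnth_mktuple.
(* Translation by the head [y] of [t] makes [psi] equivariant whatever primitives [h] were chosen;
   their [M]-invariance absorbs a change of [y] within its coset modulo [M]. *)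
pose psi s t := if t is y :: _ then if size t == j.+1 then h (u y t) (map (gmul (ginv y)) s) else 0 else 0.
exists psi; split; last first.
  move=> s [|y t]; rewrite /cobdl /psi; first by rewrite cobd0 sphi ?orbT.
  case: eqP => [st|/eqP nt]; last by rewrite cobd0 sphi ?nt ?orbT.
  rewrite -(cobd_map _ (h _)); have [_ _ _ ->] := hP (u y (y :: t)).
  by rewrite /f (Nphi _ _ _ (uE _ _ st)) ephi.
split.
- move=> s [|y t] //= ne; case: eqP => // /eqP st; move: ne; rewrite st orbF => ne.
  by have [-> //] := hP (u y (y :: t)); rewrite size_map.
- move=> g s [|y t] //; rewrite /psi map_cons -(map_cons (gmul g)) size_map.
  case: eqP => // st; rewrite -map_comp; congr (h _ _).
    apply: eq_from_tnth => l; rewrite !tnth_mktuple; congr c.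
    by rewrite (nth_map gone) ?st ?ltn_ord //; gs.
  by apply: eq_map => x /=; gs.
- exists M => // s t t' tt'; case: tt' (tt') => // y y' {}t {}t' yy' _ tt'.
  rewrite /psi (F2_size tt'); case: eqP => // st'.
  have -> : u y (y :: t) = u y' (y' :: t').
    apply: eq_from_tnth => l; rewrite !tnth_mktuple; apply: cE.
    apply: congM; [exact: pnormal_normal pN | |].
      by apply: congV; [exact: pnormal_normal pN | apply: MN].
    have: (l < size (y :: t))%N by rewrite (F2_size tt') st' ltn_ord.
    elim: tt' (nat_of_ord l) => // a b {}s1 {}t1 ab _ IH [|l'] //=; last exact: IH.
    by move=> _; apply: MN.
  have [_ _ hM _] := hP (u y' (y' :: t')).
  rewrite -(hM (ginv y' ⋅ y)); first by rewrite -map_mulM; gs.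
  exact: (cong_sym (pnormal_sub pM)).
Qed.

(** The head of [s] is an equivariant cone point for [t], and prepending it does not disturb local
    constancy on the right. *)
Lemma lcr_exact_r i j phi : lcr_cochain i.+1 j.+1 phi -> (forall s t, cobdr phi s t = 0) ->
  exists psi, lcr_cochain i.+1 j psi /\ forall s t, cobdr psi s t = phi s t.
Proof.
move=> [sphi ephi [N pN Nphi]] dphi.
exists (fun s t => if s is x :: _ then phi s (x :: t) else 0); split.
  split.
  - by move=> [|x s] t //= ne; apply: sphi; rewrite /= eqSS.
  - by move=> g [|x s] t //; apply: (ephi g (x :: s) (x :: t)).
  - exists N => // -[|x s] // t t' tt'; apply: Nphi; constructor=> //.
    by apply: cong_refl; apply: (pnormal_sub pN).
move=> [|x s] t; first by rewrite [LHS]cobd0 sphi.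
by apply: (cobd_cone (f := phi (x :: s))) => u; apply: dphi.
Qed.

Lemma lc2_exact_l i j phi : lc2_cochain i.+1 j.+1 phi -> (forall s t, cobdl phi s t = 0) ->
  exists psi, lc2_cochain i j.+1 psi /\ forall s t, cobdl psi s t = phi s t.
Proof.
move=> [sphi ephi [N pN Nphi]] dphi.
exists (fun s t => if t is y :: _ then phi (y :: s) t else 0); split.
  split.
  - by move=> s [|y t] //= ne; apply: sphi; rewrite /= eqSS.
  - by move=> g s [|y t] //; apply: (ephi g (y :: s) (y :: t)).
  - exists N => // s s' t t' ss' tt'; case: tt' (tt') => // y y' {}t {}t' yy' _ tt'.
    by apply: Nphi => //; constructor.
move=> s [|y t]; first by rewrite [LHS]cobd0 sphi // orbT.
by apply: (cobd_cone (f := phi^~ (y :: t))) => u; apply: dphi.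
Qed.

Lemma lc2_exact_r i j phi : lc2_cochain i.+1 j.+1 phi -> (forall s t, cobdr phi s t = 0) ->
  exists psi, lc2_cochain i.+1 j psi /\ forall s t, cobdr psi s t = phi s t.
Proof.
move=> [sphi ephi [N pN Nphi]] dphi.
exists (fun s t => if s is x :: _ then phi s (x :: t) else 0); split.
  split.
  - by move=> [|x s] t //= ne; apply: sphi; rewrite /= eqSS.
  - by move=> g [|x s] t //; apply: (ephi g (x :: s) (x :: t)).
  - exists N => // s s' t t' ss'; case: ss' (ss') => // x x' {}s {}s' xx' _ ss' tt'.
    by apply: Nphi => //; constructor.
move=> [|x s] t; first by rewrite [LHS]cobd0 sphi.
by apply: (cobd_cone (f := phi (x :: s))) => u; apply: dphi.
Qed.

Theorem effaceable_acyclic : lc_acyclic G.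
Proof.
move=> m f sf invf [N [pN Nf]].
(* The cochain [f] sits on the edge [j = 0]. Its mixed coboundary is [cobd f] placed at [j = 1],
   locally constant by hypothesis. A splitting on that edge has no [cobdr] term, so it writes [f] as
   a coboundary plus a locally constant cochain. *)
pose phi (s t : seq G) := if t is [::] then f s else 0.
have phiE s t : cobdl (cobdr phi) s t = if t is [:: y] then cobd f s else 0.
  rewrite /cobdl /cobdr; case: t => [|y [|z t]]; rewrite /= /phi ?cobd0 //.
    by apply: eq_cobd => u; rewrite subr0.
  rewrite -[RHS](cobd0 _ s); apply: eq_cobd => u.
  by rewrite !subr0.
have Kphi : lcr_cochain m.+1 0 phi.
  split; last by exists N => // s t t' [].
    by move=> s [|y t] //=; rewrite orbF; apply: sf.
  by move=> g s [|y t] //=; apply: invf.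
have Lphi : lc2_cochain m.+2 1 (cobdl (cobdr phi)).
  split.
  - by apply/supp2_cobdl/supp2_cobdr; case: Kphi.
  - by apply/eqv2_cobdl/eqv2_cobdr; case: Kphi.
  - exists N => // s s' t t' ss' tt'; rewrite !phiE.
    by case: tt' => // y y' _ _ _ []//; apply: Nf.
have [||||||||||a [b [la [[sa ea _] _ [_ ela [M pM Mla]] phiE' [_ b0]]]]] := @zigzag _ _ _ lcr_cochain lc2_cochain
  _ _ _ _ _ _ _ _ lcr_exact_l lcr_exact_r _ lc2_exact_l lc2_exact_r m.+1 _ m.+1 0 phi (addn0 _) Kphi Lphi.
- by move=> i j; split=> //; exists (fun=> True); [apply: pnormalT | ].
- move=> i j u v [su eu [M pM Mu]] [sv ev [M' pM' Mv]]; split.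
  + exact: supp2B.
  + exact: eqv2B.
  + exists (fun x => M x /\ M' x); first exact: pnormalI.
    by move=> s; apply: cinvB; [apply: cinvS (Mu s) | apply: cinvS (Mv s)] => x [].
- move=> i j u [su eu [M pM Mu]]; split; [exact: supp2_cobdl | exact: eqv2_cobdl |].
  by exists M => // s t t' tt'; apply: eq_cobd => s'; apply: Mu.
- move=> i j u [su eu [M pM Mu]]; split; [exact: supp2_cobdr | exact: eqv2_cobdr |].
  by exists M => // s; apply: cinv_cobd.
- move=> i j u [su eu [M pM Mu]]; split=> //; exists M => // s t t'; apply: Mu.
  by apply: F2_diag => x; apply: cong_refl; apply: (pnormal_sub pM).
- move=> i j u v [su eu [M pM Mu]] [sv ev [M' pM' Mv]]; split.
  + exact: supp2B.
  + exact: eqv2B.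
  + exists (fun x => M x /\ M' x); first exact: pnormalI.
    move=> s s' t t' ss' tt'; rewrite (Mu s s' t t') ?(Mv s s' t t') //.
    * by apply: F2_imp ss' => x y [].
    * by apply: F2_imp tt' => x y [].
    * by apply: F2_imp ss' => x y [].
    * by apply: F2_imp tt' => x y [].
- move=> i j u [su eu [M pM Mu]]; split; [exact: supp2_cobdl | exact: eqv2_cobdl |].
  exists M => // s s' t t' ss' tt'.
  by apply: cobd_rel ss' => s1 s2 ss; apply: Mu.
- move=> i j u [su eu [M pM Mu]]; split; [exact: supp2_cobdr | exact: eqv2_cobdr |].
  exists M => // s s' t t' ss' tt'.
  by apply: cobd_rel tt' => s1 s2 ss; apply: Mu.
- move=> i u [su _ _] du s [|y t]; last by apply: su; rewrite orbT.
  by have := du s [:: gone]; rewrite /cobdr /= subr0.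
(* On the edge [i = 0] the left list is empty, so a cochain of the ambient complex already belongs
   to the inner one. *)
- move=> u Ku _; exists (fun _ _ => 0), (fun _ _ => 0), u; split=> //.
  + by split=> //; exists (fun=> True); [apply: pnormalT | ].
  + by split=> //; exists (fun=> True); [apply: pnormalT | ].
  + case: Ku => su eu [M pM Mu]; split=> //; exists M => // s s' t t'.
    case=> [|x y s1 s2 _ _] tt'; [exact: Mu | by rewrite !su].
  + by move=> s t; rewrite /cobdl /cobdr !cobd0 !add0r.
exists (a^~ [::]); split; [exact: supp2l sa | by move=> g s _; apply: (ea g s [::]) |].
exists M; split=> // s s' ss'.
have e t : f t - cobd (a^~ [::]) t = la t [::].
  by rewrite -[f t]/(phi t [::]) phiE' b0 // /cobdr /= addr0 addrC addKr.
by rewrite !e; apply: Mla.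
Qed.
End EffToAcyclic.
End Effaceability.

(** * Dévissage along a chain of subgroups of index p *)

Section Devissage.
Variable p : nat.
Hypothesis p_pr : prime p.
Notation k := 'Z_p.

Lemma Zp_char0 : p%:R = 0 :> k.
Proof. exact/pchar_Zp/prime_gt1. Qed.

Lemma Zp_dvd0 n : (p %| n)%N -> n%:R = 0 :> k.
Proof. by move=> /dvdnP[q ->]; rewrite natrM Zp_char0 mulr0. Qed.

Section Difference.
Variables (G : group) (t : G).
Implicit Types (f h : seq G -> k).

Definition tdiff f s := f (map (gmul t) s) - f s.

Lemma iter_tdiffB n f h s :
  iter n tdiff (fun s => f s - h s) s = iter n tdiff f s - iter n tdiff h s.
Proof. by elim: n s => //= n IH s; rewrite /tdiff !IH; ring. Qed.

Lemma iter_tdiffD n f h s :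
  iter n tdiff (fun s => f s + h s) s = iter n tdiff f s + iter n tdiff h s.
Proof. by elim: n s => //= n IH s; rewrite /tdiff !IH; ring. Qed.

Lemma iter_tdiff0 n s : iter n tdiff (fun=> 0) s = 0.
Proof. by elim: n s => //= n IH s; rewrite /tdiff !IH subr0. Qed.

Lemma iter_tdiff_cobd n f s : cobd (iter n tdiff f) s = iter n tdiff (cobd f) s.
Proof.
elim: n s => //= n IH s.
transitivity (cobd (fun u => iter n tdiff f (map (gmul t) u) - iter n tdiff f u) s) => //.
by rewrite cobdB -cobd_map !IH.
Qed.

Lemma supp_tdiff n m f : supp m f -> supp m (iter n tdiff f).
Proof.
by move=> fm; elim: n => //= n IH s ns; rewrite /tdiff !IH ?subr0 ?size_map.
Qed.

Lemma dinv_tdiff n N f : is_normal N -> dinv N f -> dinv N (iter n tdiff f).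
Proof.
move=> nN fN; elim: n => //= n IH g s Ng; rewrite /tdiff (IH g s Ng); congr (_ - _).
have -> : map (gmul t) (map (gmul g) s) = map (gmul (t ⋅ g ⋅ ginv t)) (map (gmul t) s).
  by rewrite -!map_mulM; gs.
by apply: IH; apply: normal_conjV.
Qed.

Lemma lc_tdiff n f : loc_const f -> loc_const (iter n tdiff f).
Proof.
move=> [N [pN fN]]; exists N; split=> //; elim: n => //= n IH.
apply: cinvB => // s s' ss'; apply: IH; apply: F2_map ss' => x y xy.
exact/congM2l.
Qed.

Lemma iter_tdiffE n f s : iter n tdiff f s =
  \sum_(i < n.+1) (('X - 1%:P) ^+ n : {poly k})`_i * f (map (gmul (gpow t i)) s).
Proof.
elim: n f s => [|n IH] f s.
  by rewrite big_ord_recl big_ord0 expr0 coef1 mul1r addr0 map_mul1.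
rewrite iterSr IH; pose P : {poly k} := ('X - 1%:P) ^+ n.
have P0 : P`_n.+1 = 0 by rewrite nth_default // size_exp_XsubC.
under eq_bigr do rewrite /tdiff mulrBr -map_mulM.
rewrite sumrB exprS mulrBl mul1r -/P.
under [RHS]eq_bigr do rewrite coefB coefXM mulrBl.
rewrite sumrB; congr (_ - _); last first.
  by rewrite [RHS]big_ord_recr /= P0 mul0r addr0.
by rewrite [RHS]big_ord_recl /= mul0r add0r; apply: eq_bigr => i _.
Qed.

(** In characteristic p the polynomials [(X - 1)^p] and [X^p - 1] agree, so the p-th iterate of the
    difference operator is the difference for [gpow t p], an element of [N]. *)
Lemma iter_tdiff_prime N f : is_subgroup N -> N (gpow t p) -> dinv N f ->
  forall s, iter p tdiff f s = 0.
Proof.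
move=> sN Np fN s; have pch : p \in [pchar {poly k}].
  by rewrite pchar_poly inE p_pr Zp_char0 eqxx.
rewrite iter_tdiffE (_ : ('X - 1%:P) ^+ p = 'X^p - 1%:P); last first.
  rewrite -(pFrobenius_autE pch) pFrobenius_autB_comm; last exact: commr1.
  by rewrite !pFrobenius_autE expr1n.
rewrite (eq_bigr (fun i : 'I_p.+1 => (i == p :> nat)%:R * f (map (gmul (gpow t i)) s)
  - (i == 0 :> nat)%:R * f (map (gmul (gpow t i)) s))); last first.
  by move=> i _; rewrite coefB coefXn coef1 mulrBl.
rewrite sumrB big_ord_recr big_ord_recl big1 /=; last first.
  by move=> i _; rewrite ltn_eqF ?mul0r // ltn_ord.
rewrite eqxx big1 /= ?addr0 ?add0r => [|i _]; last by rewrite mul0r.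
by rewrite fN // map_mul1 subrr.
Qed.
End Difference.

(** Acyclicity with coefficients in the functions on [G / N], encoded by weakening the diagonal
    invariance from [G] to [N]. *)
Definition rel_acyclic (G : group) (N : G -> Prop) : Prop := forall m (f : seq G -> k),
  supp m.+1 f -> dinv N f -> loc_const (cobd f) ->
  exists h, [/\ supp m h, dinv N h & loc_const (fun s => f s - cobd h s)].

Section IndexStep.
Variables (G : group) (M N : G -> Prop) (t : G).
Hypotheses (sM : is_subgroup M) (pN : pnormal p N) (NM : forall x, N x -> M x).
Hypotheses (Mt : M t) (Ntp : N (gpow t p)).
Hypothesis cyc : forall x, M x -> exists2 i, (i < p)%N & N (ginv (gpow t i) ⋅ x).
Hypothesis cycU : forall i j, (i < p)%N -> (j < p)%N ->
  N (ginv (gpow t i) ⋅ gpow t j) -> i = j.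
Hypothesis acM : rel_acyclic M.

Let nN := pnormal_normal pN.
Let sN := pnormal_sub pN.

Lemma exponent_exists : exists e : G -> nat, [/\ forall x, (e x < p)%N,
  forall x y, cong N x y -> e x = e y, forall x y, N x -> e (x ⋅ y) = e y
  & forall x, e (t ⋅ x) = if (e x).+1 == p then 0%N else (e x).+1].
Proof.
pose r x := pick_one gone (fun y => M (x ⋅ ginv y)).
have rP x : M (x ⋅ ginv (r x)).
  apply: (@pick_oneP _ gone (fun y => M (x ⋅ ginv y))); exists x.
  by rewrite gmulVr; apply: sub1.
have rE x m : M m -> r (m ⋅ x) = r x.
  by move=> Mm; apply: eq_pick_one => y; rewrite -gmulA; apply: subMl.
have /choice[e eP] x : exists i, (i < p)%N /\ N (ginv (gpow t i) ⋅ (x ⋅ ginv (r x))).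
  by have [i ip Ni] := cyc (rP x); exists i.
have eU x i : (i < p)%N -> N (ginv (gpow t i) ⋅ (x ⋅ ginv (r x))) -> e x = i.
  move=> ip Ni; have [ep Ne] := eP x; apply: cycU => //.
  have := subM sN Ne (subV sN Ni); rewrite !grpE => h.
  exact: h.
have eN x y : N x -> e (x ⋅ y) = e y.
  move=> Nx; have [ep Ne] := eP y; apply: eU => //; rewrite rE; last exact: NM.
  have := subM sN (proj2 nN (gpow t (e y)) x Nx) Ne; by rewrite !grpE.
exists e; split=> [x|x y xy|//|x]; first by case: (eP x).
  have -> : y = x ⋅ (ginv x ⋅ y) ⋅ ginv x ⋅ x by gs.
  by rewrite eN //; apply: normal_conjV.
have [ep Ne] := eP x; case: eqP => [e1|/eqP e1]; apply: eU.
- exact: prime_gt0.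
- rewrite rE //= ginv1 gmul1.
  have := subM sN Ntp Ne; rewrite -{1}e1 /=.
  by rewrite !grpE.
- by rewrite ltn_neqAle e1.
- by move: Ne; rewrite rE //= !grpE.
Qed.

(** The kernels of the powers of the difference operator along [t] filter the [N]-invariant
    cochains, and the p-th power kills them all. The last nonzero difference of a cochain is
    [M]-invariant, where acyclicity is known; multiplication by a binomial coefficient of the
    exponent lifts the solution back. *)
Lemma rel_acyclic_step : rel_acyclic N.
Proof.
have [e [ep eN' eN et]] := exponent_exists.
pose beta j x : k := 'C(e x, j)%:R.
(* Pascal's rule survives the wrap-around: at exponent [p - 1] the translate has exponent 0, and the
   binomial coefficient of [p] over [j.+1] vanishes modulo [p]. *)
have betat j x : (j.+1 < p)%N -> beta j.+1 (t ⋅ x) = beta j.+1 x + beta j x.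
  move=> jp; rewrite /beta et -natrD; case: eqP => [e1|_]; last by rewrite binS.
  by rewrite -binS e1 bin0n [RHS]Zp_dvd0 // prime_dvd_bin.
pose w j (u : seq G -> k) s := beta j (head gone s) * u s.
have w_supp j m u : supp m u -> supp m (w j u) by move=> um s ns; rewrite /w um ?mulr0.
have w_dinv j m u : supp m.+1 u -> dinv N u -> dinv N (w j u).
  move=> um uN g [|x s] Ng; rewrite /w; first by rewrite !um ?mulr0.
  by rewrite (uN _ (x :: s) Ng) /beta /= eN.
have w_lc j m u : supp m.+1 u -> loc_const u -> loc_const (w j u).
  move=> um [N1 [pN1 uN1]]; exists (fun x => N x /\ N1 x); split; first exact: pnormalI.
  move=> s s' ss'; rewrite /w (uN1 s s'); last by apply: F2_imp ss' => x y [].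
  by case: ss' => [|x y {}s {}s' [xy _] _] //=; rewrite /beta (eN' _ _ xy).
have w_diff j m u : (j < p)%N -> supp m.+1 u -> dinv M u ->
    forall s, iter j (tdiff t) (w j u) s = u s.
  move=> + um uM; elim: j => [|j IH] jp s; first by rewrite /= /w /beta bin0 mul1r.
  rewrite iterSr -[RHS](IH (ltnW jp)); congr (iter j _ _ s); apply: funext => {}s.
  case: s => [|x s]; rewrite /tdiff /w /=; first by rewrite !um ?mulr0 ?subrr.
  by rewrite (uM _ (x :: s) Mt) betat // mulrDl addrAC subrr add0r.
suff S j : (j <= p)%N -> forall m (f : seq G -> k), supp m.+1 f -> dinv N f ->
    loc_const (cobd f) -> (forall s, iter j (tdiff t) f s = 0) ->
    exists h, [/\ supp m h, dinv N h, loc_const (fun s => f s - cobd h s) &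
      forall s, iter j (tdiff t) h s = 0].
  move=> m f fm fN lf; have [|h [a b c _]] := S p (leqnn p) m f fm fN lf.
    exact: iter_tdiff_prime Ntp fN.
  by exists h.
elim: j => [|j IH] jp m f fm fN lf fj.
  exists (fun=> 0); split=> //; exists N; split=> // s s' _.
  by have f0 u : f u = 0 := fj u; rewrite !cobd0 !f0.
pose g := iter j (tdiff t) f.
have gN : dinv N g by apply: dinv_tdiff.
have gt s : g (map (gmul t) s) = g s by apply/eqP; rewrite -subr_eq0 -/(tdiff t g s) -[tdiff t g s]/(iter j.+1 _ f s) fj.
have gM : dinv M g.
  move=> x s Mx; have [i _ Ni] := cyc Mx.
  have -> : x = gpow t i ⋅ (ginv (gpow t i) ⋅ x) by rewrite gmulVK.
  rewrite map_mulM; set s1 := map _ s; rewrite -[RHS](gN _ s Ni) -/s1.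
  clearbody s1; elim: i {Ni} => [|i IHi]; first by rewrite map_mul1.
  by rewrite [gpow t i.+1]/= map_mulM gt IHi.
have gm : supp m.+1 g by apply: supp_tdiff.
have lg : loc_const (cobd g).
  have [N1 [pN1 N1f]] := lc_tdiff t j lf; exists N1; split=> // s s' ss'.
  by rewrite !iter_tdiff_cobd; apply: N1f.
(* In degree 0 the correction is a value on the empty list, which has no head to weigh it by. Its
   coboundary is locally constant, so it is moved into the remainder and replaced by zero. *)
have [h0 [h0m h0M lh0 h0n]] : exists h0, [/\ supp m h0, dinv M h0,
    loc_const (fun s => g s - cobd h0 s) & h0 [::] = 0].
  have [h0 [h0m h0M lh0]] := acM gm gM lg.
  case: m fm gm h0m lh0 => [|m] fm gm h0m lh0; last by exists h0; split=> //; rewrite h0m.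
  exists (fun=> 0); split=> //; have : loc_const (cobd h0).
    apply: loc_const_cobd; exists (fun=> True); split; first exact: pnormalT.
    by move=> s s' [] // *; rewrite !h0m.
  move=> /(loc_constD p_pr lh0)[N1 [pN1 N1g]].
  exists N1; split=> // s s' ss'; have := N1g s s' ss'.
  by rewrite !cobd0 !subr0 !subrK.
pose l s := g s - cobd h0 s.
have lm : supp m.+1 l by apply: suppB gm (supp_cobd h0m).
have lM : dinv M l by apply: dinvB gM (dinv_cobd h0M).
have h0N : dinv N h0 by apply: dinvS h0M.
have h0tm j' : (j' < p)%N -> forall s, iter j' (tdiff t) (w j' h0) s = h0 s.
  case: m h0m {fm gm lm} => [|m] h0m jp' s; last exact: (w_diff _ m).
  have h00 : h0 = fun=> 0 by apply: funext => -[|x u]; [apply: h0n | apply: h0m].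
  have -> : w j' h0 = fun=> 0 by apply: funext => u; rewrite /w h00 mulr0.
  by rewrite iter_tdiff0 h00.
have w0N : dinv N (w j h0).
  case: m h0m {fm gm lm} => [|m] h0m; last exact: w_dinv h0m h0N.
  by move=> x [|y s] Nx; rewrite /w //= (h0m (_ :: _)) // (h0m (_ :: _)) // !mulr0.
(* Removing the two lifts leaves a cochain killed by the [j]-th difference instead of the [j.+1]-st,
   to which the induction applies. *)
pose f1 s := f s - cobd (w j h0) s - w j l s.
have [] := IH (ltnW jp) m f1.
- by apply: suppB; [apply: suppB fm (supp_cobd (w_supp _ _ _ h0m)) | apply: w_supp].
- apply: dinvB; first by apply: dinvB fN (dinv_cobd w0N).
  by apply: w_dinv lm (dinvS NM lM).
- have [N1 [pN1 N1d]] := loc_constB p_pr lf (loc_const_cobd (w_lc j m l lm lh0)).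
  exists N1; split=> // s s' ss'; have := N1d s s' ss'.
  by rewrite /f1 !cobdB ![cobd (cobd _) _]cobdK !subr0.
- move=> s; rewrite /f1 iter_tdiffB iter_tdiffB -iter_tdiff_cobd.
  rewrite (w_diff _ m) // (eq_cobd (h0tm j jp)).
  by rewrite -/(g s) /l subrr.
move=> h2 [h2m h2N lh2 h2j].
exists (fun s => w j h0 s + h2 s); split.
- by apply: suppD => //; apply: w_supp.
- exact: dinvD.
- have [N1 [pN1 N1d]] := loc_constD p_pr lh2 (w_lc j m l lm lh0).
  exists N1; split=> // s s' ss'.
  have e1 u : f u - cobd (fun s => w j h0 s + h2 s) u = f1 u - cobd h2 u + w j l u.
    by rewrite cobdD /f1; ring.
  by rewrite !e1; apply: N1d.
- move=> s; rewrite iterS.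
  have e2 u : iter j (tdiff t) (fun s => w j h0 s + h2 s) u = h0 u.
    by rewrite iter_tdiffD h2j addr0 h0tm.
  by rewrite /tdiff !e2 (h0M _ _ Mt) subrr.
Qed.
End IndexStep.

(** The chain is taken in the finite p-group [G / N], each term being normal in the whole of it and
    not merely in the preceding term: the index step requires the preimages to be normal in [G]. *)
Lemma rel_acyclic_pnormal (G : group) (N : G -> Prop) : lc_acyclic p G -> pnormal p N ->
  rel_acyclic N.
Proof.
move=> acG pN; have [c [phi [H [phiM phi1 HP pH]]]] := p_power_quotient (pnormal_normal pN) p_pr (proj2 pN).
have phi_gone : phi gone = 1%g by apply/phi1/(sub1 (pnormal_sub pN)).
have phiV x : phi (ginv x) = ((phi x)^-1)%g.
  by apply/eqP; rewrite eq_sym eq_invg_mul -phiM gmulVr phi_gone.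
have phiX x n : phi (gpow x n) = (phi x ^+ n)%g.
  by elim: n => //= n IHn; rewrite phiM IHn expgS.
have Hphi x : phi x \in H by apply/HP; exists x.
pose n := logn p #|H|.
have cH : #|H| = (p ^ n)%N by apply: card_pgroup.
have sK (K : {group 'S_c}) : is_subgroup (fun x => phi x \in K).
  split=> [|x y|x]; rewrite ?phi_gone ?group1 // ?phiM ?phiV ?groupV //.
  exact: groupM.
suff chain r : (r <= n)%N -> exists K : {group 'S_c}, [/\ (K <| H)%g, #|K| = (p ^ (n - r))%N &
    rel_acyclic (fun x => phi x \in K)].
  have [K [_ cK acK]] := chain n (leqnn n).
  have K1 : K :=: 1%g by apply/eqP; rewrite trivg_card1 cK subnn.
  suff -> : N = fun x => phi x \in K by [].
  apply: funext => x; apply/propext; rewrite K1 inE.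
  by split=> [/phi1/eqP|/eqP/phi1].
elim: r => [|r IH] rn.
  exists H; split; rewrite ?normal_refl ?subn0 //.
  move=> m f fm fH lf; have [|h [hm hG lh]] := acG m f fm _ lf.
    by move=> g s _; apply: fH.
  by exists h; split=> //; apply: dinvS hG.
have [K [nK cK acK]] := IH (ltnW rn).
have pK : (p.-group K)%g by apply: pgroupS (normal_sub nK) pH.
have [|L [LK nL cL]] := normal_pgroup (r := (n - r.+1)) pH nK.
  by rewrite cK pfactorK // leq_sub2l.
exists L; split=> //.
have indL : #|K : L|%g = p.
  by rewrite -divgS // cK cL subnS -expnB ?prime_gt0 ?leq_pred // -subn1 subKn ?expn1 // subn_gt0.
have [s Ks nLs] : exists2 s, s \in K & s \notin L.
  have /subsetPn[s] : ~~ (K \subset L) by rewrite -indexg_eq1 indL gtn_eqF ?prime_gt1.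
  by exists s.
have [t ts] : exists t, phi t = s by apply/HP/(subsetP (normal_sub nK)).
have nLK : K \subset 'N(L)%g.
  by apply: subset_trans (normal_sub nK) _; case/andP: nL.
have nLs' x : x \in K -> x \in 'N(L)%g by apply: subsetP.
have cKL : #|(K / L)%g| = p by rewrite card_quotient.
have nt : coset L s != 1%g.
  by apply: contra nLs => /eqP/coset_idr; apply; apply: nLs'.
have os : #[coset L s]%g = p.
  by apply/prime_nt_dvdP; rewrite ?order_eq1 // -cKL order_dvdG // mem_quotient.
have cycL : <[coset L s]>%g = (K / L)%g.
  by apply/eqP; rewrite eqEcard cycle_subG mem_quotient //= cKL -os.
have cosetX i x : x \in K -> (((s ^+ i)^-1 * x)%g \in L) <-> coset L x = (coset L s ^+ i)%g.
  move=> Kx; have Ksi : (s ^+ i)%g \in K by apply: groupX.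
  have cE : coset L ((s ^+ i)^-1 * x)%g = ((coset L s ^+ i)^-1 * coset L x)%g.
    by rewrite morphM ?morphV ?morphX ?groupV ?nLs'.
  split=> [/coset_id|e]; first by rewrite cE => e; apply/eqP; rewrite eq_sym eq_mulVg1 e.
  by apply: coset_idr; rewrite ?nLs' ?groupM ?groupV // cE e mulVg.
apply: (rel_acyclic_step (M := fun x => phi x \in K) (t := t)) => //.
- apply: (pnormalS p_pr pN) => [|x /phi1 ->]; last exact: group1.
  split=> [|g x Lx]; first exact: sK.
  rewrite !phiM phiV -mulgA.
  by rewrite memJ_norm //; apply: (subsetP (normal_norm nL)).
- by move=> x /(subsetP LK).
- by rewrite ts.
- rewrite phiX ts; apply: coset_idr; first by apply: nLs'; apply: groupX.
  by rewrite morphX ?nLs' // -{1}os expg_order.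
- move=> x Kx; have /cyclePmin[i] : coset L (phi x) \in <[coset L s]>%g by rewrite cycL mem_quotient.
  by rewrite os => ip /cosetX Li; exists i => //; rewrite phiM phiV phiX ts Li.
- move=> i j ip jp; rewrite phiM phiV !phiX ts => /(cosetX _ _ (groupX _ Ks)).
  rewrite morphX ?nLs' // => /eqP; rewrite eq_expg_mod_order os !modn_small //.
  by move/eqP.
Qed.

(** The locally constant remainder is again a cocycle, and its cone at [gone] is invariant under the
    subgroup of its local constancy; so the remainder dies on that subgroup. *)
Theorem acyclic_effaceable (G : group) : lc_acyclic p G -> effaceable p (fun x : G => x = gone).
Proof.
move=> acG m N f pN _ fm _ fN df.
have [|h [hm hN [N1 [pN1 N1l]]]] := rel_acyclic_pnormal acG pN fm fN.
  by exists N; split=> // s s' _; rewrite !df.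
pose l s := f s - cobd h s.
have dl s : cobd l s = 0 by rewrite cobdB df cobdK subr0.
exists (fun x => N x /\ N1 x), (fun s => h s + l (gone :: s)); split.
- exact: pnormalI.
- by move=> x ->; split; apply: sub1; apply: (pnormal_sub (p := p)).
- by apply: suppD => //; apply/supp_cone/suppB => //; apply: supp_cobd.
- exact: cinv1.
split=> [|s]; last by rewrite cobdD (cobd_cone (f := l)) // /l addrC subrK.
apply: dinvD; first by apply: dinvS hN => x [].
apply: (dinvS (N := N1)) => [x []//|]; apply: cinv_dinv (pnormal_normal pN1) _.
by apply: cinv_cone => //; apply: pnormal_sub pN1.
Qed.
End Devissage.

(** * Degree one *)

Section DegreeOne.
Variable p : nat.
Hypothesis p_pr : prime p.
Notation k := 'Z_p.

(** The kernel of [chi] on [N] need not be normal in [G], so [M] is the intersection of its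
    conjugates. Only finitely many conjugates differ, because [chi] is invariant under conjugation
    by [N]; central elements of the kernel survive, being their own conjugates. *)
Lemma pnormal_kernel (G : group) (N : G -> Prop) (chi : G -> k) : pnormal p N ->
  (forall x y, N x -> N y -> chi (x ⋅ y) = chi x + chi y) ->
  exists M, [/\ pnormal p M, forall x, M x -> N x /\ chi x = 0 &
    forall x, (forall g, x ⋅ g = g ⋅ x) -> N x -> chi x = 0 -> M x].
Proof.
move=> pN chiM; have nN := pnormal_normal pN; have sN := pnormal_sub pN.
have chi1 : chi gone = 0.
  have := chiM gone gone (sub1 sN) (sub1 sN); rewrite gmul1 => /eqP.
  by rewrite -subr_eq subrr eq_sym => /eqP.
have chiV x : N x -> chi (ginv x) = - chi x.
  by move=> Nx; apply/eqP; rewrite -addr_eq0 -chiM ?gmulV ?chi1 //; apply: subV.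
have chiX x n : N x -> chi (gpow x n) = chi x *+ n.
  move=> Nx; elim: n => //= n IH; rewrite chiM ?IH ?mulrS //.
  exact: sub_gpow.
have conjM (g x y : G) : ginv g ⋅ (x ⋅ y) ⋅ g = (ginv g ⋅ x ⋅ g) ⋅ (ginv g ⋅ y ⋅ g).
  by rewrite !grpE.
have conjV (g x : G) : ginv g ⋅ ginv x ⋅ g = ginv (ginv g ⋅ x ⋅ g) by rewrite !grpE.
have conjN g x : N x -> N (ginv g ⋅ x ⋅ g) by apply: (proj2 nN).
pose M x := N x /\ forall g, chi (ginv g ⋅ x ⋅ g) = 0.
have conjX (g x : G) n : ginv g ⋅ gpow x n ⋅ g = gpow (ginv g ⋅ x ⋅ g) n.
  by elim: n => [|n IH] /=; rewrite ?conjM ?IH // gmulr1 gmulV.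
exists M; split.
- apply/pnormalP => //; split.
  + split; last first.
      move=> g x [Nx cx]; split=> [|h]; first exact: conjN.
      by have := cx (g ⋅ h); rewrite ginvM !gmulA.
    split; first by split=> [|g]; rewrite ?gmulr1 ?gmulV //; apply: sub1.
      move=> x y [Nx cx] [Ny cy]; split=> [|g]; first exact: subM.
      by rewrite conjM chiM ?cx ?cy ?addr0 //; apply: conjN.
    move=> x [Nx cx]; split=> [|g]; first exact: subV.
    by rewrite conjV chiV ?cx ?oppr0 //; apply: conjN.
  + have [I [r [c [rc cE]]]] := pnormal_cosets pN.
    pose n x := ginv (r (c x)) ⋅ x.
    have Nn x : N (n x) by apply: rc.
    exists (I * {ffun I -> k})%type, (fun x => (c x, [ffun i => chi (ginv (r i) ⋅ n x ⋅ r i)])).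
    move=> x y [cxy /ffunP ixy]; rewrite /cong; have -> : ginv x ⋅ y = ginv (n x) ⋅ n y.
      by rewrite /n cxy !grpE.
    have Nxy : N (ginv (n x) ⋅ n y) by apply: subM => //; apply: subV.
    split=> // g; have gE : g = r (c g) ⋅ n g by rewrite /n gmulVK.
    have -> : ginv g ⋅ (ginv (n x) ⋅ n y) ⋅ g =
       ginv (n g) ⋅ (ginv (r (c g)) ⋅ (ginv (n x) ⋅ n y) ⋅ r (c g)) ⋅ n g.
      by rewrite {1 2}gE !grpE.
    have NX (z : G) : N (ginv (r (c g)) ⋅ n z ⋅ r (c g)) by apply: conjN.
    set v := ginv (r (c g)) ⋅ _ ⋅ _.
    have Nv : N v by apply: conjN.
    have Nng := subV sN (Nn g).
    rewrite (chiM _ (n g)) ?(chiM _ v) ?chiV //; last exact: subM.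
    rewrite addrAC addNr add0r /v conjM conjV chiM ?chiV //; last exact: subV.
    by have := ixy (c g); rewrite !ffunE => ->; rewrite addNr.
  (* The power [p ^ j] reaches [N], and one more factor [p] annihilates the value of [chi] at every
     conjugate. *)
  + move=> g; have [_ _ /(_ g)[j Nj]] := (pnormalP p_pr N).1 pN.
    exists j.+1; rewrite expnSr gpowM; split=> [|h]; first exact: sub_gpow.
    by rewrite conjX chiX; [rewrite -mulr_natr Zp_char0 // mulr0 | apply: conjN].
- by move=> x [Nx cx]; split=> //; have := cx gone; rewrite ginv1 gmul1 gmulr1.
- by move=> x xC Nx cx; split=> // g; rewrite -gmulA xC gmulA gmulV gmul1.
Qed.

(** On [N] a class of degree one is a homomorphism to Z/p, and it dies on the core of its kernel.
    That core contains [A], since [A] is central and constancy on its cosets forces the homomorphism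
    to vanish there. *)
Lemma effaceable_degree1 (G : group) (A N : G -> Prop) (f : seq G -> k) :
  (forall a x, A a -> a ⋅ x = x ⋅ a) -> pnormal p N -> (forall x, A x -> N x) ->
  supp 2 f -> cinv A f -> dinv N f -> (forall s, cobd f s = 0) -> is_subgroup A ->
  exists M h, [/\ pnormal p M, forall x, A x -> M x, supp 1 h, cinv A h &
    dinv M h /\ forall s, cobd h s = f s].
Proof.
move=> cA pN AN fm fA fN df sA; have sN := pnormal_sub pN.
have coc x y : f [:: gone; x ⋅ y] = f [:: gone; x] + f [:: x; x ⋅ y].
  by have /= /eqP := df [:: gone; x; x ⋅ y]; rewrite subr0 subr_eq0 => /eqP ->; rewrite addrC subrK.
have tr x y : N x -> f [:: x; x ⋅ y] = f [:: gone; y].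
  by move=> Nx; rewrite -(fN x [:: gone; y] Nx) /= gmulr1.
pose chi x := f [:: gone; x].
have [M [pM MN Mc]] := pnormal_kernel pN (chi := chi) (fun x y Nx _ => etrans (coc x y) (congr1 _ (tr x y Nx))).
have f11 : f [:: gone; gone] = 0.
  have := coc gone gone; rewrite gmul1 => /eqP.
  by rewrite -subr_eq subrr eq_sym => /eqP.
exists M, (fun s => f (gone :: s)); split=> //.
- move=> x Ax; apply: Mc => [g||]; [exact: cA | exact: AN |].
  rewrite /chi -f11; apply/esym/fA; constructor; first exact: cong_refl.
  by constructor=> //; rewrite /cong ginv1 gmul1.
- exact: supp_cone.
- exact: cinv_cone.
split=> [x [|y [|z s]] Mx|s]; last exact: cobd_cone.
- by [].
- have [Nx cx] := MN x Mx; rewrite /= coc tr //.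
  by rewrite -/(chi x) cx add0r.
- by rewrite !fm.
Qed.
End DegreeOne.

(** * Integer powers *)

Definition gzpow (G : group) (x : G) (e : int) : G :=
  match e with Posz n => gpow x n | Negz n => ginv (gpow x n.+1) end.

Section IntegerPowers.
Variable G : group.
Implicit Types x y : G.

Lemma gzpowS x e : gzpow x (e + 1) = x ⋅ gzpow x e.
Proof.
case: e => [n|[|n]]; rewrite /gzpow.
- by rewrite addrC.
- by rewrite /= gmulr1 gmulVr.
- rewrite (_ : Negz n.+1 + 1 = Negz n); last by rewrite !NegzE -addn1 PoszD opprD subrK.
  by rewrite [in RHS]gpowSr ginvM gmulVK.
Qed.

Lemma gzpowP x e : gzpow x (e - 1) = ginv x ⋅ gzpow x e.
Proof. by rewrite -{2}(subrK 1 e) gzpowS gmulKV. Qed.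

Lemma gzpowD x a b : gzpow x (a + b) = gzpow x a ⋅ gzpow x b.
Proof.
elim/int_ind: a => [|n IH|n IH]; first by rewrite add0r gmul1.
  by rewrite -addn1 PoszD addrAC !gzpowS IH gmulA.
by rewrite -addn1 PoszD opprD addrAC !gzpowP IH gmulA.
Qed.

Lemma gzpowN x a : gzpow x (- a) = ginv (gzpow x a).
Proof. by apply: ginv_uniq; rewrite -gzpowD subrr. Qed.

Lemma gzpowM x a b : gzpow x (a * b) = gzpow (gzpow x a) b.
Proof.
elim/int_ind: b => [|n IH|n IH]; first by rewrite mulr0.
  by rewrite -addn1 PoszD mulrDr mulr1 gzpowS -IH -gzpowD addrC.
by rewrite -addn1 PoszD opprD mulrBr mulr1 gzpowP -IH -gzpowN -gzpowD addrC.
Qed.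

Lemma sub_zpow (A : G -> Prop) x e : is_subgroup A -> A x -> A (gzpow x e).
Proof.
by move=> sA Ax; case: e => n; [|apply: subV => //]; apply: sub_gpow.
Qed.

Definition central x := forall g, x ⋅ g = g ⋅ x.

Lemma centralV x : central x -> central (ginv x).
Proof. by move=> cx g; apply: (@gmulI _ x); rewrite gmulVK gmulA cx !grpE. Qed.

Lemma centralM x y : central x -> central y -> central (x ⋅ y).
Proof. by move=> cx cy g; rewrite -gmulA cy gmulA cx gmulA. Qed.

Lemma central_zpow x e : central x -> central (gzpow x e).
Proof.
move=> cx; have cn n : central (gpow x n).
  by elim: n => [|n IH] /=; [move=> g; rewrite gmul1 gmulr1 | apply: centralM].
by case: e => n; [apply: cn | apply/centralV/cn].
Qed.

Definition adjoin (A : G -> Prop) y x := exists e, A (ginv (gzpow y e) ⋅ x).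

Section Adjoin.
Variables (A : G -> Prop) (y : G).
Hypotheses (sA : is_subgroup A) (cA : forall a, A a -> central a) (cy : central y).

Lemma adjoin_central x : adjoin A y x -> central x.
Proof.
case=> e /cA cx; rewrite -(gmulVK (gzpow y e) x).
by apply: centralM => //; apply: central_zpow.
Qed.

Lemma adjoin_sub : is_subgroup (adjoin A y).
Proof.
split; first by exists 0; rewrite gmulr1 ginv1; apply: sub1.
  move=> u v [a Au] [b Av]; exists (a + b).
  have := subM sA Au Av; congr A; rewrite gzpowD ginvM.
  by rewrite [LHS]gmulA -(centralV (central_zpow b cy)) !gmulA.
move=> u [a Au]; exists (- a); have := subV sA Au.
by rewrite ginvM gzpowN (centralV (centralV (central_zpow a cy))).
Qed.

Lemma adjoinl x : A x -> adjoin A y x.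
Proof. by exists 0; rewrite ginv1 gmul1. Qed.

Lemma adjoinr e : adjoin A y (gzpow y e).
Proof. by exists e; rewrite gmulV; apply: sub1. Qed.
End Adjoin.
End IntegerPowers.

(** * Separating a central cyclic subgroup *)

Section Separation.
Variable p : nat.
Hypothesis p_pr : prime p.
Notation k := 'Z_p.

Lemma intr_Zp_eq0 (e : int) : e%:~R = 0 :> k -> exists q : int, e = p%:Z * q.
Proof.
have pch : p \in [pchar k] by rewrite inE p_pr Zp_char0 ?eqxx.
have natP n : n%:R = 0 :> k -> exists q : int, n%:Z = p%:Z * q.
  by move/eqP; rewrite -(dvdn_pcharf pch) => /dvdnP[q ->]; exists q%:Z; rewrite mulnC PoszM.
case: e => n; first exact: natP.
rewrite NegzE rmorphN /= => /eqP; rewrite oppr_eq0 => /eqP/natP[q e].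
by exists (- q); rewrite e mulrN.
Qed.

Lemma intr_Zp_neq0 (e : int) : e%:~R != 0 :> k -> exists u v : int, u * e + v * p%:Z = 1.
Proof.
move=> e0; have : coprimez e p.
  rewrite coprimezE absz_nat coprime_sym prime_coprime //; apply: contra e0 => /dvdnP[q qE].
  have : `|e|%:Z%:~R = 0 :> k by rewrite qE -pmulrn natrM Zp_char0 // mulr0.
  by case: {qE} e => n h; [rewrite -h | rewrite NegzE rmorphN /= h oppr0].
by case/coprimezP=> -[u v] /= uv; exists u, v.
Qed.

Definition mulp (G : group) (N B : G -> Prop) x := exists n b, [/\ N n, B b & x = n ⋅ b].

Lemma pnormal_mul (G : group) (N B : G -> Prop) : pnormal p N -> is_subgroup B ->
  (forall b, B b -> central b) ->
  pnormal p (mulp N B) /\ (forall x, N x -> mulp N B x) /\ (forall x, B x -> mulp N B x).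
Proof.
move=> pN sB cB; have sN := pnormal_sub pN; have nN := pnormal_normal pN.
have NNB x : N x -> mulp N B x.
  by move=> Nx; exists x, gone; rewrite gmulr1; split=> //; apply: sub1.
split; last by split=> // x Bx; exists gone, x; rewrite gmul1; split=> //; apply: sub1.
apply: (pnormalS p_pr pN) => //; split; [split|].
- by apply/NNB/(sub1 sN).
- move=> _ _ [n [b [Nn Bb ->]]] [n' [b' [Nn' Bb' ->]]]; exists (n ⋅ n'), (b ⋅ b').
  split; [exact: subM | exact: subM |].
  by rewrite -!gmulA (gmulA b) (cB _ Bb n') !gmulA.
- move=> _ [n [b [Nn Bb ->]]]; exists (ginv n), (ginv b).
  by split; [exact: subV | exact: subV | rewrite ginvM (centralV (cB _ Bb))].
- move=> g _ [n [b [Nn Bb ->]]]; exists (ginv g ⋅ n ⋅ g), b; split=> //.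
    exact: (proj2 nN).
  by rewrite -!gmulA (cB _ Bb).
Qed.

Section Shrink.
Variables (G : group) (A B : G -> Prop) (y : G).
Hypotheses (sA : is_subgroup A) (sB : is_subgroup B) (AB : forall x, A x -> B x).
Hypotheses (cB : forall b, B b -> central b) (cy : central y).
Hypothesis effB : effaceable p B.
Let cA a (Aa : A a) : central a := cB (AB Aa).
Let C := adjoin A y.
Let sC := adjoin_sub sA cy.

(** The hypothesis makes the exponent of [y] modulo [p] well defined on [C], where [A] contributes
    exponent zero. *)
Lemma exponent_mod : (forall e, A (gzpow y e) -> e%:~R = 0 :> k) ->
  exists w : G -> k, [/\ forall b c, C b -> C c -> w (b ⋅ c) = w b + w c,
    forall a, A a -> w a = 0 & forall b, C b -> w b = 0 -> adjoin A (gpow y p) b].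
Proof.
move=> hA; have /choice[e eP] b : exists e, C b -> A (ginv (gzpow y e) ⋅ b).
  by have [[e h]|h] := pselect (C b); [exists e | exists 0].
have eU b f : C b -> A (ginv (gzpow y f) ⋅ b) -> (e b)%:~R = f%:~R :> k.
  move=> Cb Af; apply/eqP; rewrite -subr_eq0 -rmorphB; apply/eqP/hA.
  have := subM sA Af (subV sA (eP b Cb)); congr A.
  by rewrite gzpowD gzpowN !grpE (centralV (central_zpow f cy)).
exists (fun b => (e b)%:~R); split.
- move=> b c Cb Cc; rewrite -rmorphD; apply: eU; first exact: subM.
  have := subM sA (eP b Cb) (eP c Cc); congr A; rewrite gzpowD ginvM.
  by rewrite [LHS]gmulA -(centralV (central_zpow (e c) cy)) !gmulA.
- by move=> a Aa; apply: (eU a 0); [exists 0 |]; rewrite ginv1 gmul1.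
- move=> b Cb /intr_Zp_eq0[q eq]; exists q.
  by have := eP b Cb; rewrite eq gzpowM.
Qed.

(** The exponent of [y] modulo [p] is a homomorphism on [C]. Extending it to a subgroup of p-power
    index meets an obstruction in degree two of [G / B], which effaceability removes after
    shrinking; the core of the kernel of the extension then meets [B] only in exponents divisible by
    [p]. *)
Lemma shrink_step (N : G -> Prop) : pnormal p N -> (forall x, A x -> N x) ->
  (forall x, N x -> B x -> C x) ->
  exists M, [/\ pnormal p M, forall x, A x -> M x, forall x, M x -> N x &
    forall x, M x -> B x -> adjoin A (gpow y p) x].
Proof.
move=> pN AN NBC; have sN := pnormal_sub pN; have nN := pnormal_normal pN.
(* If instead some [gzpow y e] with [e] prime to [p] lies in [A], a Bezout relation puts [y] itself
   in [adjoin A (gpow y p)], and [N] needs no shrinking. *)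
have [/exponent_mod[w [wM wA w0]]|] := pselect (forall e, A (gzpow y e) -> e%:~R = 0 :> k); last first.
  move/existsNP=> [e /not_implyP[Ae /eqP/intr_Zp_neq0[u [v uv]]]].
  exists N; split=> // x Nx Bx; have [f Af] := NBC x Nx Bx.
  exists (v * f); have := subM sA (subV sA (subV sA (sub_zpow (u * f) sA Ae))) Af.
  congr A; rewrite ginvK -gzpowM -[gpow y p]/(gzpow y p%:Z) -gzpowM gmulA; congr (_ ⋅ x).
  rewrite -!gzpowN -gzpowD; congr gzpow.
  by rewrite -[X in - X]mul1r -uv; ring.
have cC x : C x -> central x by apply: adjoin_central.
have [phi phiM] : exists phi : G -> k, forall x b, C b -> phi (x ⋅ b) = phi x + w b.
  pose rep x := pick_one gone (cong C ^~ x).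
  have repP x : cong C (rep x) x by apply: (@pick_oneP _ gone (cong C ^~ x)); exists x; apply: cong_refl.
  exists (fun x => w (ginv (rep x) ⋅ x)) => x b Cb.
  have -> : rep (x ⋅ b) = rep x.
    apply: eq_pick_one => u; rewrite /cong gmulA; exact: subMr.
  by rewrite gmulA wM //; apply: repP.
(* [r] maps [G] onto [N], is the identity on [N] modulo [N ∩ B], is constant on
   cosets of [B] and is [N]-equivariant modulo [N ∩ B]. *)
pose orb x u := exists n b, [/\ N n, B b & x = n ⋅ b ⋅ u].
(* The second clause normalizes the representative of the orbit of [gone]; this is what makes [r]
   the identity on [N] up to [C]. *)
pose rep x := pick_one gone (fun u => orb x u /\ (orb x gone -> u = gone)).
have repP x : orb x (rep x) /\ (orb x gone -> rep x = gone).
  apply: (@pick_oneP _ gone (fun u => orb x u /\ (orb x gone -> u = gone))).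
  have [h|h] := pselect (orb x gone); first by exists gone.
  by exists x; split=> //; exists gone, gone; rewrite !gmul1; split=> //; apply: sub1.
have repE x x' : (forall u, orb x u <-> orb x' u) -> rep x = rep x'.
  by move=> e; apply: eq_pick_one => u; rewrite !e.
have repN x n : N n -> rep (n ⋅ x) = rep x.
  move=> Nn; apply: repE => u; split=> -[m [b [Nm Bb e]]].
    exists (ginv n ⋅ m), b; split=> //; first by apply: subM => //; apply: subV.
    by apply: (@gmulI _ n); rewrite e !gmulA gmulVr gmul1.
  by exists (n ⋅ m), b; split=> //; [apply: subM | rewrite e !gmulA].
have repB x b : B b -> rep (b ⋅ x) = rep x.
  move=> Bb; apply: repE => u; split=> -[m [c [Nm Bc e]]].
    exists m, (ginv b ⋅ c); split=> //; first by apply: subM => //; apply: subV.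
    apply: (@gmulI _ b); rewrite e !gmulA; congr (_ ⋅ _).
    by rewrite (cB Bb) gmulK.
  exists m, (b ⋅ c); split=> //; first exact: subM.
  by rewrite e !gmulA (cB Bb).
pose r x := pick_one gone (fun n => N n /\ exists b, B b /\ x = n ⋅ b ⋅ rep x).
have rP x : N (r x) /\ exists b, B b /\ x = r x ⋅ b ⋅ rep x.
  apply: (@pick_oneP _ gone (fun n => N n /\ exists b, B b /\ x = n ⋅ b ⋅ rep x)).
  by have [[n [b [Nn Bb e]]] _] := repP x; exists n; split=> //; exists b.
have rB x x' : cong B x x' -> r x = r x'.
  move=> Bxx'; have [d [Bd ->]] : exists d, B d /\ x' = d ⋅ x.
    by exists (ginv x ⋅ x'); split=> //; rewrite (cB Bxx') gmulVK.
  apply: eq_pick_one => n; rewrite repB //; split=> -[Nn [b [Bb e]]]; split=> //.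
    exists (d ⋅ b); split; first exact: subM.
    by rewrite {1}e !gmulA (cB Bd).
  exists (ginv d ⋅ b); split; first by apply: subM => //; apply: subV.
  by apply: (@gmulI _ d); rewrite e !gmulA (cB Bd n) gmulK.
have rN n x : N n -> C (ginv (n ⋅ r x) ⋅ r (n ⋅ x)).
  move=> Nn; have [Nr [b [Bb e]]] := rP x; have [Nr' [b' [Bb' e']]] := rP (n ⋅ x).
  apply: NBC; first by apply: subM => //; apply: subV => //; apply: subM.
  have : n ⋅ r x ⋅ b = r (n ⋅ x) ⋅ b'.
    have := e'; rewrite repN // {1}e !gmulA => h.
    by rewrite -[LHS](gmulK _ (rep x)) h gmulK.
  move=> h; rewrite (_ : _ ⋅ _ = b ⋅ ginv b').
    by apply: subM => //; apply: subV.
  by apply: (@gmulI _ (n ⋅ r x)); rewrite gmulVK gmulA h gmulK.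
have rid x : N x -> C (ginv (r x) ⋅ x).
  move=> Nx; have [Nr [b [Bb e]]] := rP x; apply: NBC; first by apply: subM => //; apply: subV.
  have r1 : rep x = gone by apply: (repP x).2; exists x, gone; rewrite !gmulr1; split=> //; apply: sub1.
  by rewrite {2}e r1 gmulr1 gmulKV.
pose E (s : seq G) := if s is [:: x0; x1] then phi (ginv x0 ⋅ x1) else 0.
pose F (s : seq G) := E (map r s).
have EC x0 x1 b0 b1 : C b0 -> C b1 ->
    E [:: x0 ⋅ b0; x1 ⋅ b1] = E [:: x0; x1] + (w b1 - w b0).
  move=> C0 C1; rewrite /E ginvM -(gmulA (ginv b0)) (centralV (cC _ C0)) -!gmulA.
  have wV : w (ginv b0) = - w b0.
    by apply/eqP; rewrite -addr_eq0 -wM ?gmulV ?wA //; [apply: sub1 sA | apply: subV].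
  have Cb : C (b1 ⋅ ginv b0) by apply: subM => //; apply: subV.
  by rewrite gmulA phiM // wM ?wV //; apply: subV.
have fdiff (u v : seq G -> k) (g : G -> k) : supp 2 u -> supp 2 v ->
    (forall x0 x1, u [:: x0; x1] = v [:: x0; x1] + (g x1 - g x0)) ->
    forall s, cobd u s = cobd v s.
  move=> um vm uv s; pose g1 (s : seq G) := if s is [:: x] then g x else 0.
  have -> : u = fun s => v s + cobd g1 s.
    apply: funext => -[|x0 [|x1 [|x2 {}s]]].
    - by rewrite um ?vm //= addr0.
    - by rewrite um ?vm //= subr0 addr0.
    - by rewrite uv /= subr0.
    - rewrite um // vm // add0r; apply/esym.
      have gm : supp 1 g1 by case=> [|a [|b t]].
      exact: (supp_cobd gm).
  by rewrite cobdD cobdK addr0.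
have Fm : supp 2 F by case=> [|x0 [|x1 [|x2 s]]].
have FB : cinv B F.
  move=> s s' ss'; rewrite /F; congr E; elim: ss' => //= x x' {}s {}s' xx' _ ->.
  by rewrite (rB _ _ xx').
have cN : dinv N (cobd F).
  move=> n s Nn; rewrite cobd_map.
  apply: (fdiff _ _ (fun x => w (ginv (n ⋅ r x) ⋅ r (n ⋅ x)))) => // [|x0 x1].
    by case=> [|x0 [|x1 [|x2 t]]].
  pose be x := ginv (n ⋅ r x) ⋅ r (n ⋅ x).
  transitivity (E [:: n ⋅ r x0 ⋅ be x0; n ⋅ r x1 ⋅ be x1]); first by rewrite /be !gmulVK.
  rewrite EC; try exact: rN.
  by congr (phi _ + _); rewrite !grpE.
have [pNB [NNB BNB]] := pnormal_mul pN sB cB.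
set NB := mulp N B in pNB NNB BNB.
have cNB : dinv NB (cobd F).
  move=> _ s [n [b [Nn Bb ->]]]; rewrite map_mulM cN //.
  exact: (cinv_central sB (fun a x Ba => cB Ba x) (cinv_cobd FB)).
(* Already [F] is a primitive of this cocycle, but not an invariant one. Effaceability supplies an
   [M1]-invariant primitive [h], constant on cosets of [B], and the defect between the two is the
   wanted homomorphism. *)
have [M1 [h [pM1 BM1 hm hB [hM1 dh]]]] := effB pNB BNB (supp_cobd Fm) (cinv_cobd FB) cNB (cobdK F).
pose N2 x := N x /\ M1 x; have pN2 : pnormal p N2 by apply: pnormalI.
(* On [N] the cochains [E] and [F] differ by a coboundary, so [H] is a cocycle on [N2]; it is
   translation invariant there, hence [H gone] is a homomorphism, and it restricts to [w] on [B]. *)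
pose H (u v : G) := phi (ginv u ⋅ v) - h [:: u; v].
have Hcoc x v z : N2 x -> N2 v -> N2 z -> H x z = H x v + H v z.
  move=> [Nx _] [Nv _] [Nz _].
  pose E2 s := E s - h s; have E2m : supp 2 E by case=> [|a [|b [|c s]]].
  pose be u := ginv u ⋅ r u.
  have Cbe u : N u -> C (be u).
    by move=> Nu; have := subV sC (rid _ Nu); rewrite ginvM ginvK.
  have FE u u' : N u -> N u' -> F [:: u; u'] = E [:: u; u'] + (w (be u') - w (be u)).
    by move=> Nu Nu'; rewrite -EC; [rewrite /be !gmulVK | apply: Cbe | apply: Cbe].
  have := dh [:: x; v; z]; rewrite /= !subr0 !FE // /E /H => e.
  by apply/eqP; rewrite -subr_eq0; apply/eqP; move: e => /eqP; rewrite -subr_eq0 => /eqP <-; ring.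
have H1 x v z : N2 x -> H (x ⋅ v) (x ⋅ z) = H v z.
  by move=> [_ Mx]; rewrite /H -[h [:: v; z]](hM1 x _ Mx); congr (phi _ - _); rewrite !grpE.
have sN2 := pnormal_sub pN2.
have chiM x z : N2 x -> N2 z -> H gone (x ⋅ z) = H gone x + H gone z.
  move=> Nx Nz; rewrite (Hcoc _ x) //; [|exact: sub1 | exact: subM].
  by rewrite -{2}(gmulr1 x) H1.
have [M [pM MN2 cM]] := pnormal_kernel p_pr pN2 chiM.
have H11 : H gone gone = 0.
  have := chiM gone gone (sub1 sN2) (sub1 sN2); rewrite gmul1 => /eqP.
  by rewrite -subr_eq subrr eq_sym => /eqP.
have HB b : N2 b -> B b -> H gone b = w b.
  move=> [Nb _] Bb; rewrite /H; have -> : h [:: gone; b] = h [:: gone; gone].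
    apply: hB; constructor; first exact: cong_refl.
    by constructor=> //; rewrite /cong gmulr1; apply: subV.
  have -> : ginv gone ⋅ b = ginv gone ⋅ gone ⋅ b by rewrite gmulr1.
  by rewrite phiM; [rewrite addrAC -/(H gone gone) H11 add0r | apply: NBC].
exists M; split=> //.
- move=> a Aa; have Na : N2 a by split; [apply: AN | apply/BM1/AB].
  by apply: cM => //; [apply: cA | rewrite HB ?wA //; apply: AB].
- by move=> x /MN2[[]].
- move=> x /MN2[Nx cx] Bx; apply: w0; first by apply: NBC => //; case: Nx.
  by rewrite -HB.
Qed.
End Shrink.

Lemma shrink (G : group) (A B : G -> Prop) (y : G) :
  is_subgroup A -> is_subgroup B -> (forall x, A x -> B x) ->
  (forall b, B b -> central b) -> central y -> effaceable p B ->
  forall N : G -> Prop, pnormal p N -> (forall x, A x -> N x) ->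
    (forall x, N x -> B x -> adjoin A y x) ->
  forall j, exists M, [/\ pnormal p M, forall x, A x -> M x, forall x, M x -> N x &
    forall x, M x -> B x -> adjoin A (gpow y (p ^ j)) x].
Proof.
move=> sA sB AB cB cy effB N pN AN NBC; elim=> [|j [M [pM AM MN MBC]]].
  by exists N; split=> //; rewrite expn0 /= gmulr1.
have cyj : central (gpow y (p ^ j)) by apply: (central_zpow (p ^ j)%:Z).
have [M' [pM' AM' MM' M'B]] := shrink_step sA sB AB cB cyj effB pM AM MBC.
by exists M'; split=> //; [move=> x /MM'/MN | rewrite expnSr gpowM].
Qed.
End Separation.

(** * Central extensions by a cyclic group *)

Section CyclicCohomology.
Variable p : nat.
Hypothesis p_pr : prime p.
Notation k := 'Z_p.
Variables (G : group) (A : G -> Prop) (y : G).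
Hypotheses (sA : is_subgroup A) (cA : forall a, A a -> central a) (cy : central y).

Lemma F2_mul (N : G -> Prop) g s t : Forall2 (cong N) s t ->
  Forall2 (cong N) (map (gmul g) s) (map (gmul g) t).
Proof. by apply: F2_map => u v; apply: (congM2l N g u v).2. Qed.

(** The antidifference on the integers that vanishes at 0, an oriented sum for negative bounds. *)
Definition int_sum (u : int -> k) (e : int) : k :=
  match e with Posz n => \sum_(j < n) u j | Negz n => - \sum_(j < n.+1) u (Negz j) end.

Lemma int_sumS u e : int_sum u (e + 1) = int_sum u e + u e.
Proof.
case: e => [n|[|n]].
- by rewrite -[n%:Z + 1]/(Posz (n + 1)%N) addn1 /= big_ord_recr.
- by rewrite /= big_ord0 big_ord1 addNr.
- rewrite (_ : Negz n.+1 + 1 = Negz n); last by rewrite !NegzE -addn1 PoszD opprD subrK.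
  by rewrite /= [in RHS]big_ord_recr /= opprD subrK.
Qed.

Lemma int_sum0 u e : (forall e, u e = 0) -> int_sum u e = 0.
Proof. by case: e => n u0; rewrite /= big1 ?oppr0. Qed.

Lemma exponent_int : (forall m, A (gpow y m.+1) -> False) ->
  exists e : G -> int, (forall x, e (y ⋅ x) = e x + 1) /\ forall x x', cong A x x' -> e x = e x'.
Proof.
move=> hA; have sC := adjoin_sub sA cy.
have hA' (a : int) : A (gzpow y a) -> a = 0.
  case: a => [[|n]|n] //; first by move/hA.
  by move/(subV sA); rewrite ginvK => /hA.
pose rep x := pick_one gone (cong (adjoin A y) ^~ x).
have repP x : cong (adjoin A y) (rep x) x.
  by apply: (@pick_oneP _ gone (cong (adjoin A y) ^~ x)); exists x; apply: cong_refl.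
have repE x x' : cong (adjoin A y) x x' -> rep x = rep x'.
  move=> xx'; apply: eq_pick_one => u; split=> a; apply: (cong_trans sC a) => //.
  exact: cong_sym.
have /choice[e eP] x : exists e, A (ginv (gzpow y e) ⋅ (ginv (rep x) ⋅ x)) by apply: repP.
have eU x f : A (ginv (gzpow y f) ⋅ (ginv (rep x) ⋅ x)) -> e x = f.
  move=> Af; apply/eqP; rewrite -subr_eq0; apply/eqP/hA'.
  have := subM sA Af (subV sA (eP x)); congr A.
  by rewrite gzpowD gzpowN !grpE (centralV (central_zpow f cy)).
exists e; split=> [x|x x' xx']; apply: eU.
  rewrite (_ : rep (y ⋅ x) = rep x); last first.
    apply: repE; apply: (cong_sym sC); rewrite /cong (cy x) gmulKV.
    by exists 1; rewrite /= gmulr1 gmulV; apply: sub1.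
  have := eP x; congr A; rewrite gzpowS ginvM -gmulA; congr (_ ⋅ _).
  by rewrite (gmulA (ginv (rep x))) -(cy (ginv (rep x))) -gmulA gmulKV.
rewrite (repE _ x'); last by apply: adjoinl.
have := subM sA (eP x') (subV sA xx'); congr A.
by rewrite !grpE.
Qed.

(** The exponent [j] is uniform in the cocycle. If some power of [y] lies in [A], then [p ^ j] is
    the p-part of its exponent, and one averages over the part prime to [p]. Otherwise [y] has
    infinite order modulo [A]: classes of degree one die on p-th powers and higher cohomology
    vanishes. *)
Lemma cyclic_cohomology : exists j, forall i (f : seq G -> k),
  supp i.+2 f -> cinv A f -> (forall s, f (map (gmul y) s) = f s) ->
  (forall s, cobd f s = 0) ->
  exists h, [/\ supp i.+1 h, cinv A h, forall s, h (map (gmul (gpow y (p ^ j))) s) = h s &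
    forall s, cobd h s = f s].
Proof.
have cone_inv (f : seq G -> k) : cinv A f -> cinv A (fun s => f (gone :: s)).
  exact: cinv_cone.
have [[m Am]|hA] := pselect (exists m, A (gpow y m.+1)).
  have [m' m'p mE] := pfactor_coprime p_pr (ltn0Sn m).
  pose j := logn p m.+1; exists j => i f fm fA fy df.
  pose z := gpow y (p ^ j).
  have fz n s : f (map (gmul (gpow z n)) s) = f s.
    rewrite /z -gpowM; elim: (p ^ j * n)%N => [|l IH] /=; first by rewrite map_mul1.
    by rewrite map_mulM fy.
  have Az : A (gpow z m') by rewrite /z -gpowM mulnC -mE.
  have um' : (m'%:R : k) \is a GRing.unit by rewrite unitZpE ?prime_gt1.
  pose f0 s := f (gone :: s).
  have f0A : cinv A f0 by apply: cone_inv.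
  exists (fun s => m'%:R^-1 * \sum_(l < m') f0 (map (gmul (gpow z l)) s)); split.
  - by move=> s ns; rewrite big1 ?mulr0 // => l _; rewrite /f0 fm //= size_map.
  - move=> s s' ss'; congr (_ * _); apply: eq_bigr => l _; apply: f0A; exact: F2_mul.
  - move=> s; congr (_ * _); rewrite -/z.
    case: m' {mE m'p um'} Az => [|m'] Az; first by rewrite !big_ord0.
    rewrite big_ord_recr big_ord_recl /= addrC map_mul1; congr (_ + _).
      rewrite -map_mulM -gpowSr; apply: (cinv_central sA) Az => // a x Aa.
      exact: cA.
    by apply: eq_bigr => l _; rewrite -map_mulM -gpowSr.
  - move=> s; rewrite cobdZ cobd_sum.
    under eq_bigr => l _ do rewrite -(cobd_map (gmul (gpow z l)) f0) (cobd_cone (f := f)) // fz.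
    by rewrite sumr_const card_ord -[f s *+ _]mulr_natl mulKr.
have {}hA m : A (gpow y m.+1) -> False by move=> Am; apply: hA; exists m.
exists 1%N => i f fm fA fy df; rewrite expn1.
pose f0 s := f (gone :: s).
have f0A : cinv A f0 by apply: cone_inv.
have f0m : supp i.+1 f0 by apply: supp_cone.
have df0 s : cobd f0 s = f s by apply: cobd_cone.
pose c s := f0 (map (gmul y) s) - f0 s.
have dc s : cobd c s = 0 by rewrite cobdB -(cobd_map _ f0) !df0 fy subrr.
case: i => [|i] in fm f0m *.
  (* Translation by [y] adds the constant [c [:: gone]] to the primitive, so [p] translations add
     zero. *)
  exists f0; split=> // s.
  have cc x : f0 [:: y ⋅ x] = f0 [:: x] + c [:: gone].
    have := dc [:: gone; x]; rewrite /= subr0 => /eqP; rewrite subr_eq0 => /eqP <-.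
    by rewrite addrC subrK.
  case: s => [|x [|x' s]]; [by [] | | by rewrite !f0m].
  suff h n : f0 [:: gpow y n ⋅ x] = f0 [:: x] + c [:: gone] *+ n.
    by rewrite /= h -mulr_natr Zp_char0 // mulr0 addr0.
  elim: n => [|n IH] /=; first by rewrite gmul1 addr0.
  by rewrite -gmulA cc IH -addrA -mulrSr.
have cm : supp i.+2 c by apply: suppB => // s ns; apply: f0m; rewrite size_map.
have cinvA : cinv A c.
  by apply: cinvB => // s s' ss'; apply: f0A; apply: F2_mul.
pose l s := c (gone :: s).
have lm : supp i.+1 l by apply: supp_cone.
have lA : cinv A l by apply: cone_inv.
have dl s : cobd l s = c s by apply: cobd_cone.
have [e [ey eA]] := exponent_int hA.
(* The sum runs along the [y]-orbit from the translate whose head has exponent 0, so that the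
   difference of [m] along [y] is [l]; then [cobd m] corrects the failure [c] of [f0] to be
   [y]-invariant. *)
pose m s := if s is x :: _ then
  int_sum (fun j => l (map (gmul (gzpow y (j - e x))) s)) (e x) else 0.
have mm : supp i.+1 m.
  by move=> [|x s] ns; [by [] | rewrite /m]; apply: int_sum0 => j; apply: lm; rewrite size_map.
have mA : cinv A m.
  move=> s s' ss'; case: ss' (ss') => // x x' {}s {}s' xx' _ ss'; rewrite /m (eA _ _ xx').
  by congr int_sum; apply: funext => j; apply: lA; apply: F2_mul.
have my s : m (map (gmul y) s) = m s + l s.
  case: s => [|x s]; first by rewrite lm //= addr0.
  rewrite /m map_cons -(map_cons (gmul y)) ey.
  rewrite (_ : (fun j => _) = fun j => l (map (gmul (gzpow y (j - e x))) (x :: s))); last first.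
    apply: funext => j; congr l; rewrite -map_mulM; congr map; apply: funext => g.
    by rewrite opprD addrA gzpowP (centralV cy) gmulKr.
  by rewrite int_sumS subrr map_mul1.
exists (fun s => f0 s - cobd m s); split.
- by apply: suppB => //; apply: supp_cobd.
- by apply: cinvB => //; apply: cinv_cobd.
- have step s : f0 (map (gmul y) s) - cobd m (map (gmul y) s) = f0 s - cobd m s.
    rewrite cobd_map (eq_cobd my) cobdD dl /c; ring.
  suff h n s : f0 (map (gmul (gpow y n)) s) - cobd m (map (gmul (gpow y n)) s) = f0 s - cobd m s.
    by move=> s; apply: h.
  elim: n => [|n IH]; first by rewrite map_mul1.
  by rewrite /= map_mulM step IH.
- by move=> s; rewrite cobdB cobdK subr0.
Qed.
End CyclicCohomology.

(** * The double complex of a central cyclic extension *)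

Section CyclicExtension.
Variable p : nat.
Hypothesis p_pr : prime p.
Notation k := 'Z_p.
Variables (G : group) (A : G -> Prop) (z : G).
Hypotheses (sA : is_subgroup A) (cA : forall a, A a -> central a) (cz : central z).
Let B := adjoin A z.
Hypothesis effB : effaceable p B.
Let sB : is_subgroup B := adjoin_sub sA cz.
Let cB b (Bb : B b) : central b := adjoin_central cA cz Bb.
Let AB x (Ax : A x) : B x := adjoinl z Ax.

Lemma F2_cong_sym (N : G -> Prop) s t : is_subgroup N ->
  Forall2 (cong N) s t -> Forall2 (cong N) t s.
Proof. by move=> sN; elim=> [|x y {}s {}t xy _ IH]; constructor=> //; apply: cong_sym. Qed.

Lemma F2_cong_trans (N : G -> Prop) t s u : is_subgroup N ->
  Forall2 (cong N) s t -> Forall2 (cong N) t u -> Forall2 (cong N) s u.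
Proof.
move=> sN st; elim: st u => [|x y {}s {}t xy _ IH] u tu; first by inversion tu.
inversion tu; subst; constructor; last exact: IH.
exact: cong_trans xy _.
Qed.

Lemma adjoin_inv (h : seq G -> k) w : central w -> cinv A h ->
  (forall s, h (map (gmul w) s) = h s) ->
  forall x s, adjoin A w x -> h (map (gmul x) s) = h s.
Proof.
move=> cw hA hw x s [e Ae].
have hn n u : h (map (gmul (gpow w n)) u) = h u.
  by elim: n => [|n IH]; rewrite ?map_mul1 //= map_mulM hw.
have he u : h (map (gmul (gzpow w e)) u) = h u.
  by case: e {Ae} => n; [apply: hn | rewrite -[LHS](hn n.+1); apply: (congr1 h (map_mulVK _ u))].
rewrite -(gmulVK (gzpow w e) x) map_mulM he.
by apply: (cinv_central sA _ hA) => // a y /cA.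
Qed.

(** A double complex of Hochschild-Serre type: cochains of [G / A] on the left, of [G / B] on the
    right, with a subgroup of p-power index acting diagonally. *)
Definition mixed_cochain i j (phi : seq G -> seq G -> k) := [/\ supp2 i j phi,
  forall t, cinv A (phi^~ t), forall s, cinv B (phi s) &
  exists N, [/\ pnormal p N, forall x, A x -> N x &
    forall g s t, N g -> phi (map (gmul g) s) (map (gmul g) t) = phi s t]].

(** For fixed [t] this is a cocycle for the cyclic fibre, which dies on the powers of some [w]. The
    primitives fit together equivariantly once the acting subgroup [M] meets [B] inside
    [adjoin A w], and [shrink] provides such an [M]. *)
Lemma mixed_exact_l i j phi : mixed_cochain i.+1 j.+1 phi -> (forall s t, cobdl phi s t = 0) ->
  exists psi, mixed_cochain i j.+1 psi /\ forall s t, cobdl psi s t = phi s t.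
Proof.
case: i => [|i] [sphi Aphi Bphi [N [pN AN Nphi]]] dphi.
  have cst x y t : phi [:: x] t = phi [:: y] t.
    have /eqP := dphi [:: x; y] t; rewrite /cobdl /= subr0 subr_eq0.
    by move/eqP.
  exists (fun s t => if s is [::] then phi [:: gone] t else 0); split.
    split.
    - by move=> [|x s] t //= nt; apply: sphi; rewrite nt orbT.
    - by move=> t s s' [].
    - by move=> [|x s].
    - exists N; split=> // g [|x s] t Ng //=.
      by rewrite -(Nphi g [:: gone] t Ng) /=; apply: cst.
  move=> [|x [|y s]] t; rewrite /cobdl /=; first by rewrite sphi.
    by rewrite subr0; apply: cst.
  by rewrite sphi // sub0r cobd0 subr0 oppr0.
(* Only powers of [z] lying in [N] are known to preserve [phi^~ t], their effect on [t] being
   invisible modulo [B]. *)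
have [_ _ /(_ z)[a Nza]] := (pnormalP p_pr N).1 pN.
pose y := gpow z (p ^ a).
have cy : central y by apply: (central_zpow (p ^ a)%:Z).
have By : B y by apply: (adjoinr z sA (p ^ a)%:Z).
have [b hb] := cyclic_cohomology p_pr sA cA cy.
pose w := gpow y (p ^ b).
have cw : central w by apply: (central_zpow (p ^ b)%:Z).
have [M [pM AM MN MB]] : exists M, [/\ pnormal p M, forall x, A x -> M x, forall x, M x -> N x &
    forall x, M x -> B x -> adjoin A w x].
  have [//|M [pM AM MN MB]] := shrink p_pr sA sB AB cB cz effB pN AN _ (a + b).
  by exists M; split=> // x Mx Bx; have := MB x Mx Bx; rewrite expnD gpowM.
have /choice[h hP] t : exists h, [/\ supp i.+1 h, cinv A h,
    forall s, h (map (gmul w) s) = h s & forall s, cobd h s = phi s t].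
  apply: hb => [||s|s]; [exact: (supp2l t sphi) | exact: Aphi | | exact: (dphi s t)].
  rewrite -[RHS](Nphi y) //; apply: Bphi; apply: F2_mapr => x.
  by rewrite /cong (cB By) gmulKV.
(* Primitives are transported from representatives of the [M]-orbits of lists modulo [B]. The
   ambiguity in the transporting element lies in both [M] and [B], hence in [adjoin A w], under
   which the primitives are invariant. *)
pose rel t t' n := M n /\ Forall2 (cong B) t (map (gmul n) t').
pose rep t := pick_one [::] (fun t' => exists n, rel t t' n).
have sM := pnormal_sub pM.
pose nu t := pick_one gone (rel t (rep t)).
have nuP t : rel t (rep t) (nu t).
  apply: (@pick_oneP _ gone (rel t (rep t))).
  apply: (@pick_oneP _ [::] (fun t' => exists n, rel t t' n)); exists t, gone.
  split; first exact: sub1.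
  by rewrite map_mul1; apply: F2_diag => x; apply: cong_refl.
have repB t t' : Forall2 (cong B) t t' -> rep t = rep t' /\ nu t = nu t'.
  move=> tt'; have relE u n : rel t u n <-> rel t' u n.
    split=> -[Mn tu]; split=> //; apply: (F2_cong_trans sB _ tu) => //.
    exact: F2_cong_sym.
  have e : rep t = rep t' by apply: eq_pick_one => u; split=> -[n /relE hn]; exists n.
  by split=> //; rewrite /nu e; apply: eq_pick_one => n.
have repM t m : M m -> rep (map (gmul m) t) = rep t.
  move=> Mm; apply: eq_pick_one => u; split=> -[n [Mn tu]].
    exists (ginv m ⋅ n); split; first by apply: subM => //; apply: subV.
    by rewrite map_mulM -[t](map_mulKV m); apply: F2_mul.
  by exists (m ⋅ n); split; [apply: subM | rewrite map_mulM; apply: F2_mul].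
pose psi s t := if size t == j.+1 then h (rep t) (map (gmul (ginv (nu t))) s) else 0.
exists psi; split; last first.
  move=> s t; rewrite /cobdl /psi; case: eqP => [st|/eqP nt].
    rewrite -(cobd_map _ (h (rep t))); have [_ _ _ ->] := hP (rep t).
    have [Mn tn] := nuP t; rewrite (Bphi s _ _ tn) -[RHS](Nphi (ginv (nu t))).
      by rewrite map_mulKV.
    by apply: subV; [apply: (pnormal_sub pN) | apply: MN].
  by rewrite cobd0 sphi // nt orbT.
split.
- move=> s t ns; rewrite /psi; case: eqP => // st; move: ns; rewrite st eqxx orbF => ns.
  by have [hm _ _ _] := hP (rep t); rewrite hm // size_map.
- move=> t s s' ss'; rewrite /psi; case: eqP => // _.
  by have [_ hA _ _] := hP (rep t); apply: hA; apply: F2_mul.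
- move=> s t t' tt'; rewrite /psi (F2_size tt').
  by have [-> ->] := repB _ _ tt'.
exists M; split=> // g s t Mg; rewrite /psi size_map; case: eqP => // st.
rewrite repM //; have [_ hA hw _] := hP (rep t).
have [Mn tn] := nuP t; have [Mn' tn'] := nuP (map (gmul g) t); rewrite repM // in tn'.
pose d := ginv (nu (map (gmul g) t)) ⋅ g ⋅ nu t.
have Md : M d by apply: subM => //; apply: subM => //; apply: subV.
have Bd : B d.
  have tt : Forall2 (cong B) (map (gmul d) (rep t)) (rep t).
    have := F2_mul (ginv (nu (map (gmul g) t))) (F2_cong_trans sB (F2_cong_sym sB (F2_mul g tn)) tn').
    by rewrite map_mulKV -!map_mulM ?gmulA.
  have: size (rep t) = j.+1 by rewrite -st (F2_size tn) size_map.
  case: (rep t) tt => // x u; inversion_clear 1 => _.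
  have : cong B x (d ⋅ x) by apply: cong_sym.
  rewrite /cong => Bb; have cb := cB Bb.
  by rewrite -(gmulK d x) -(gmulVK x (d ⋅ x)) -cb gmulK.
have -> : ginv (nu (map (gmul g) t)) = d ⋅ ginv (nu t) ⋅ ginv g by rewrite /d !grpE.
rewrite -map_mulM gmulKr map_mulM; apply: (adjoin_inv cw hA hw).
exact: MB.
Qed.

Lemma mixed_exact_r i j phi : mixed_cochain i.+1 j.+1 phi -> (forall s t, cobdr phi s t = 0) ->
  exists psi, mixed_cochain i.+1 j psi /\ forall s t, cobdr psi s t = phi s t.
Proof.
move=> [sphi Aphi Bphi [N [pN AN Nphi]]] dphi.
exists (fun s t => if s is x :: _ then phi s (x :: t) else 0); split.
  split.
  - by move=> [|x s] t //= ne; apply: sphi; rewrite /= eqSS.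
  - move=> t s s' ss'; case: ss' (ss') => // x x' {}s {}s' xx' _ ss'.
    rewrite (Aphi _ _ _ ss'); apply: Bphi; constructor; first exact: AB.
    by apply: F2_diag => u; apply: cong_refl.
  - move=> [|x s] // t t' tt'; apply: Bphi; constructor=> //.
    exact: cong_refl.
  - by exists N; split=> // g [|x s] t //; apply: (Nphi g (x :: s) (x :: t)).
move=> [|x s] t; first by rewrite [LHS]cobd0 sphi.
by apply: (cobd_cone (f := phi (x :: s))) => u; apply: dphi.
Qed.

(** The zigzag with zero inner complex: [mixed_exact_l] removes the classes of the fibre, and the
    hypothesis on [B] removes those of the base at the edge [i = 0]. *)
Theorem effaceable_adjoin : effaceable p A.
Proof.
move=> m N f pN AN fm fA fN df.
pose phi (s t : seq G) := if t is [::] then f s else 0.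
pose L (i j : nat) (phi : seq G -> seq G -> k) := forall s t, phi s t = 0.
have K0 i j : mixed_cochain i j (fun _ _ => 0).
  by split=> //; exists N.
have L0 i j : L i j (fun _ _ => 0) by [].
have Kphi : mixed_cochain m.+2 0 phi.
  split.
  - by move=> s [|y t] //=; rewrite orbF; apply: fm.
  - by move=> [|y t] s s' ss' //; apply: fA.
  - by move=> s t t' [].
  - by exists N; split=> // g s [|y t] Ng //; apply: fN.
have Lphi : L m.+3 1 (cobdl (cobdr phi)).
  move=> s t; rewrite /cobdl /cobdr; case: t => [|y [|y' t]]; rewrite /= /phi ?cobd0 //.
    by rewrite -[RHS](df s); apply: eq_cobd => u; rewrite subr0.
  rewrite -[RHS](cobd0 _ s); apply: eq_cobd => u.
  by rewrite !subr0.
have [|||||||||||a [b [la [[sa Aa _ [M [pM AM Ma]]] _ la0 phiE' [_ b0]]]]] := @zigzag _ _ _ mixed_cochain L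
  K0 _ _ _ _ _ _ _ mixed_exact_l mixed_exact_r _ _ _ m.+2 _ m.+2 0 phi (addn0 _) Kphi Lphi.
- move=> i j u v [su Au Bu [M [pM AM Mu]]] [sv Av Bv [M' [pM' AM' Mv]]]; split.
  + exact: supp2B.
  + by move=> t; apply: cinvB.
  + by move=> s; apply: cinvB.
  + exists (fun x => M x /\ M' x); split; first exact: pnormalI.
      by move=> x Ax; split; [apply: AM | apply: AM'].
    by move=> g s t [Mg Mg']; rewrite Mu ?Mv.
- move=> i j u [su Au Bu [M [pM AM Mu]]]; split.
  + exact: supp2_cobdl.
  + by move=> t; apply: cinv_cobd.
  + by move=> s t t' tt'; apply: eq_cobd => s'; apply: Bu.
  + exists M; split=> // g s t Mg; rewrite /cobdl cobd_map; apply: eq_cobd => s'.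
    exact: Mu.
- move=> i j u [su Au Bu [M [pM AM Mu]]]; split.
  + exact: supp2_cobdr.
  + by move=> t s s' ss'; apply: eq_cobd => t'; apply: Au ss'.
  + by move=> s; apply: cinv_cobd.
  + exists M; split=> // g s t Mg; rewrite /cobdr cobd_map; apply: eq_cobd => t'.
    exact: Mu.
- move=> i j u u0; have -> // : u = fun _ _ => 0.
  by apply: funext => s; apply: funext => t; apply: u0.
- by move=> i j u v u0 v0 s t; rewrite u0 v0 subrr.
- by move=> i j u u0 s t; rewrite -[RHS](cobd0 _ s); apply: eq_cobd.
- by move=> i j u u0 s t; rewrite -[RHS](cobd0 _ t); apply: eq_cobd.
- move=> i u [su _ _ _] du s [|y t]; last by apply: su; rewrite orbT.
  by have := du s [:: gone]; rewrite /cobdr /= subr0.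
- move=> i j u u0 _; exists (fun _ _ => 0); split=> // s t.
  by rewrite u0 [LHS]cobd0.
- move=> i j u u0 _; exists (fun _ _ => 0); split=> // s t.
  by rewrite u0 [LHS]cobd0.
(* Here [u [::]] is a cocycle of [G / B]. Being [M]-invariant and constant on cosets of [B], it is
   invariant under the product of [M] and [B], which contains [B] as effaceability demands. *)
- move=> u [su Au Bu [M [pM AM Mu]]] du.
  have du0 t : cobd (u [::]) t = 0.
    by have := du [:: gone] t; rewrite /cobdl /= subr0.
  have [pMB [MMB BMB]] := pnormal_mul p_pr pM sB cB.
  have uMB : dinv (mulp M B) (u [::]).
    move=> _ t [n [b [Mn Bb ->]]]; rewrite map_mulM (Mu n [::] _ Mn).
    exact: (cinv_central sB (fun a x Ba => cB Ba x) (Bu [::])).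
  have [M1 [h [pM1 BM1 hm hB [hM1 dh]]]] := effB pMB BMB (supp2r [::] su) (Bu [::]) uMB du0.
  exists (fun _ _ => 0), (fun s t => if s is [::] then h t else 0), (fun _ _ => 0).
  split=> //; first split.
  + by move=> [|x s] t //= nt; apply: hm.
  + by move=> t s s' [].
  + by move=> [|x s].
  + exists M1; split=> // [x /AB/BM1 //|g [|x s] t Mg //=]; exact: hM1.
  + move=> s t; rewrite addr0 [X in X + _](cobd0 _ s) add0r /cobdr; case: s => [|x s].
      by rewrite dh.
    by rewrite cobd0 su.
exists M, (a^~ [::]); split=> //.
- exact: supp2l sa.
- split=> [g s Mg|s]; first exact: (Ma g s [::]).
  by rewrite -[f s]/(phi s [::]) phiE' b0 // la0 addr0 /cobdr /= addr0.
Qed.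
End CyclicExtension.

Lemma effaceable_fin_gen p (G : group) (S : seq G) : prime p ->
  (forall x, List.In x S -> central x) -> effaceable p (gen_by S) ->
  effaceable p (fun x : G => x = gone).
Proof.
move=> p_pr; elim: S => [|z S IH] cS effS.
  rewrite (_ : (fun x => _) = gen_by [::]) //; apply: funext => x; apply/propext.
  split=> [->|]; first exact: gen_one.
  by elim=> // [u v _ -> _ ->|u _ ->]; rewrite ?gmul1 ?ginv1.
have genC (T : seq G) : (forall x, List.In x T -> central x) -> forall x, gen_by T x -> central x.
  move=> cT x; elim=> [g|u /cT //|u v _ cu _ cv|u _ cu].
  - by rewrite gmul1 gmulr1.
  - exact: centralM.
  - exact: centralV.
have sgen (T : seq G) : is_subgroup (gen_by T).
  by split; [exact: gen_one | exact: gen_mul | exact: gen_inv].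
have cS' x : List.In x S -> central x by move=> Sx; apply: cS; right.
have cz : central z by apply: cS; left.
apply: IH => //; apply: (effaceable_adjoin p_pr (sgen S) (genC _ cS') cz).
rewrite (_ : adjoin _ _ = gen_by (z :: S)) //; apply: funext => x; apply/propext.
have sub u : gen_by S u -> gen_by (z :: S) u.
  elim=> [|v Sv|v w _ ? _ ?|v _ ?]; [exact: gen_one | by apply: gen_in; right | exact: gen_mul | exact: gen_inv].
have zgen : gen_by (z :: S) z by apply: gen_in; left.
split=> [[e /sub h]|].
  rewrite -(gmulVK (gzpow z e) x); apply: gen_mul h.
  exact: sub_zpow.
have sA := adjoin_sub (sgen S) cz.
elim=> [|u [<-|Su]|u v _ hu _ hv|u _ hu].
- exact: sub1.
- by have := adjoinr z (sgen S) 1; rewrite /= gmulr1.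
- by apply: adjoinl; apply: gen_in.
- exact: subM.
- exact: subV.
Qed.

(** * Amalgamated products *)

Lemma pnormal_image p (H Q : group) (q : H -> Q) (N : H -> Prop) : prime p -> is_hom q ->
  (forall u, exists x, q x = u) -> pnormal p N ->
  pnormal p (fun u => exists x, q x = u /\ N x).
Proof.
move=> p_pr qM /choice[sg sgP] pN; have sN := pnormal_sub pN.
have [[_ nN] [T [c cN]] Np] := (pnormalP p_pr N).1 pN.
apply/pnormalP => //; split.
- split; first split.
  + by exists gone; split; [apply: hom1 | apply: sub1].
  + move=> _ _ [x [<- Nx]] [y [<- Ny]]; exists (x ⋅ y); split; first exact: qM.
    exact: subM.
  + by move=> _ [x [<- Nx]]; exists (ginv x); split; [apply: homV | apply: subV].
  + move=> u _ [x [<- Nx]]; exists (ginv (sg u) ⋅ x ⋅ sg u); split; last exact: nN.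
    by rewrite !qM (homV qM) sgP.
- exists T, (fun u => c (sg u)) => u v /cN Nuv; exists (ginv (sg u) ⋅ sg v); split=> //.
  by rewrite qM (homV qM) !sgP.
- move=> u; have [j Nj] := Np (sg u); exists j, (gpow (sg u) (p ^ j)); split=> //.
  by rewrite (hom_gpow qM) sgP.
Qed.

(** * Primitives equivariant under one factor *)

Section LocalSolution.
Variable p : nat.
Hypothesis p_pr : prime p.
Notation k := 'Z_p.
Variables (P Q H : group) (A : P -> Prop) (i : H -> P) (q : H -> Q) (pi : P -> Q).
Hypotheses (iM : is_hom i) (qM : is_hom q) (piM : is_hom pi).
Hypotheses (q_surj : forall u, exists x, q x = u) (piE : forall x, pi (i x) = q x).
Hypotheses (sA : is_subgroup A) (cA : forall a, A a -> central a).
Hypotheses (kerq : forall x, q x = gone -> A (i x)) (piA : forall a, A a -> pi a = gone).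
Hypothesis effQ : effaceable p (fun u : Q => u = gone).

(** A set-theoretic section through [H] is multiplicative only modulo [A], which is enough for
    cochains constant on cosets of [A]. *)
Lemma section_exists : exists iota : Q -> P, [/\ forall u, pi (iota u) = u,
  forall x, cong A (i x) (iota (q x)), forall x u, cong A (i x ⋅ iota u) (iota (q x ⋅ u)) &
  forall u v, cong A (iota u ⋅ iota v) (iota (u ⋅ v))].
Proof.
have /choice[sg sgP] := q_surj.
have key x u : cong A (i x ⋅ i (sg u)) (i (sg (q x ⋅ u))).
  rewrite /cong -!iM -(homV iM) -iM; apply: kerq.
  by rewrite qM (homV qM) qM !sgP gmulV.
exists (fun u => i (sg u)); split=> // [u|x|u v]; first by rewrite piE.
  by rewrite /cong -(homV iM) -iM; apply: kerq; rewrite qM (homV qM) sgP gmulV.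
by have := key (sg u) v; rewrite sgP.
Qed.

Lemma normal_central : is_normal A.
Proof. by split=> // g x Ax; rewrite -gmulA (cA Ax) gmulA gmulV gmul1. Qed.

Lemma cong_pi x y : cong A x y -> pi x = pi y.
Proof.
move=> /piA; rewrite piM (homV piM) => h.
by rewrite -[RHS](gmulVK (pi x)) h gmulr1.
Qed.

(** The parameter [y] carries the coefficients: [f] translated by [ginv y] is invariant under all of
    [P] acting on [y] and [s] together, and the right [M]-invariance in [y] will replace diagonal
    invariance in [s]. The primitive is found on [Q], pulled back along [pi], and corrected by the
    prism homotopy between [rho] and the identity. *)
Lemma local_solution m N (f : seq P -> k) : pnormal p N -> (forall x, A x -> N x) ->
  supp m.+2 f -> cinv A f -> dinv N f -> (forall s, cobd f s = 0) ->
  exists M (h : P -> seq P -> k), [/\ pnormal p M, forall x, A x -> M x & forall y, [/\ supp m.+1 (h y),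
    cinv A (h y), forall n s, M n -> h (y ⋅ n) s = h y s,
    forall x s, h (i x ⋅ y) (map (gmul (i x)) s) = h y s &
    forall s, cobd (h y) s = f (map (gmul (ginv y)) s)]].
Proof.
move=> pN AN fm fA fN df.
have [iota [pi_iota iotaq iota_i iotaM]] := section_exists.
have nN := pnormal_normal pN; have sN := pnormal_sub pN.
have nA := normal_central.
have ANc x y : cong A x y -> cong N x y by apply: AN.
pose N1 u := exists x, q x = u /\ N (i x).
have pN1 : pnormal p N1 by apply: pnormal_image => //; apply: (pnormal_preim p_pr iM).
have N1P u : N1 u -> N (iota u).
  by move=> [x [<- Nx]]; rewrite -(gmulVK (i x) (iota _)); apply: subM => //; apply/ANc/iotaq.
have [I [r [c [rc cE]]]] := pnormal_cosets pN.
pose F a (s : seq Q) := f (map (gmul (ginv (r a))) (map iota s)).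
have [//|a|M1 [h [pM1 _ M1N1 hP]]] := effaceable_family p_pr effQ (m := m) (f := F) pN1.
- by move=> u ->; apply: sub1 (pnormal_sub pN1).
- split.
  + by move=> s ns; rewrite /F fm // !size_map.
  + exact: cinv1.
  + move=> u s /N1P Nu; rewrite /F.
    rewrite (fA _ (map (gmul (ginv (r a))) (map (gmul (iota u)) (map iota s)))); last first.
      apply: F2_mul; rewrite -!map_comp; apply: F2_maps => x /=.
      exact/(cong_sym sA)/iotaM.
    have -> t : map (gmul (ginv (r a))) (map (gmul (iota u)) t) =
        map (gmul (ginv (r a) ⋅ iota u ⋅ r a)) (map (gmul (ginv (r a))) t).
      by rewrite -!map_mulM gmulK.
    by apply: fN; apply: (proj2 nN).
  + by move=> s; rewrite /F -(cobd_map iota (fun t => f (map (gmul (ginv (r a))) t))) -(cobd_map (gmul _)) df.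
pose rho x := iota (pi x).
pose u y (s : seq P) := f (map (gmul (ginv y)) s).
have um y : supp m.+2 (u y) by move=> s ns; rewrite /u fm ?size_map.
have uA y : cinv A (u y) by move=> s s' ss'; apply: fA; apply: F2_mul.
have du y s : cobd (u y) s = 0 by rewrite -(cobd_map (gmul _)) df.
pose tau y := ginv (rho y) ⋅ y.
pose hh y s := h (c (tau y)) (map (gmul (ginv (pi y))) (map pi s)).
exists (fun x => N x /\ M1 (pi x)), (fun y s => hh y s - prism rho (u y) s); split.
- by apply: pnormalI => //; apply: pnormal_preim.
- by move=> x Ax; split; [apply: AN | rewrite piA //; apply: sub1 (pnormal_sub pM1)].
move=> y; have [hm _ hM1 dh] := hP (c (tau y)); split.
- by apply: suppB; [move=> s ns; rewrite /hh hm ?size_map | apply: supp_prism].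
- apply: cinvB => s s' ss'; rewrite /hh.
    congr (h _ (map _ _)); elim: ss' => //= x x' {}s {}s' xx' _ ->.
    by rewrite (cong_pi xx').
  apply: prism_rel ss' => [x x' xx'|t t' tt']; last exact: uA tt'.
  by rewrite /rho (cong_pi xx'); apply: cong_refl.
- move=> n s [Nn Mn]; congr (_ - _); last first.
    congr (prism rho _ s); apply: funext => t.
    by rewrite /u ginvM map_mulM fN //; apply: subV.
  rewrite /hh (_ : c (tau (y ⋅ n)) = c (tau y)).
    rewrite piM ginvM map_mulM hM1 //.
    exact: (subV (pnormal_sub pM1)).
  apply: cE; apply: congM => //; last first.
    by rewrite /cong ginvM -gmulA gmulV gmulr1; apply: subV.
  apply: congV => //; apply: (cong_sym sN).
  rewrite /rho piM; apply: (cong_trans sN) (ANc _ _ (iotaM _ _)).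
  by rewrite /cong gmulA gmulV gmul1; apply/N1P/M1N1.
- move=> x s; congr (_ - _).
    rewrite /hh (_ : c (tau (i x ⋅ y)) = c (tau y)).
      congr (h _); rewrite -!map_comp; apply: eq_map => g /=.
      by rewrite !piM !grpE.
    apply: cE; apply: ANc; rewrite /tau /rho piM piE.
    have e : ginv (i x ⋅ iota (pi y)) ⋅ (i x ⋅ y) = ginv (iota (pi y)) ⋅ y by rewrite !grpE.
    rewrite -e; apply: congM2r => //; apply: congV => //.
    exact: (cong_sym sA).
  apply/esym/(@prism_rel _ _ _ _ _ (fun a b => cong A (i x ⋅ a) b)).
  + move=> a b ab; rewrite /rho -(cong_pi ab) piM piE; exact: iota_i.
  + move=> t t' tt'; rewrite /u ginvM map_mulM; apply: fA; apply: F2_mul.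
    elim: tt' => [|a b {}t {}t' ab _ IH] /=; constructor=> //.
    by apply/(congM2l A (i x)); rewrite gmulVK.
  + by apply: F2_mapr => a; apply: cong_refl.
- move=> s; rewrite cobdB.
  have e : cobd (prism rho (u y)) s = u y (map rho s) - u y s.
    by have := prismP rho (u y) s; rewrite (_ : prism _ (cobd _) _ = 0) ?addr0 // (_ : cobd (u y) = fun=> 0) ?prism0 //; apply: funext.
  rewrite e /hh -(cobd_map pi (fun t => h (c (tau y)) (map (gmul (ginv (pi y))) t))).
  rewrite -(cobd_map (gmul _) (h _)) dh /F.
  suff -> : f (map (gmul (ginv (r (c (tau y))))) (map iota (map (gmul (ginv (pi y))) (map pi s)))) = u y (map rho s).
    by rewrite opprB addrC subrK.
  rewrite -[X in map (gmul X)](gmulK _ (tau y)) map_mulM fN; last exact: rc.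
  rewrite /u /tau ginvM ginvK map_mulM; apply: fA; apply: F2_mul.
  rewrite -!map_comp; apply: F2_maps => a /=.
  have := iotaM (pi y) (ginv (pi y) ⋅ pi a).
  by rewrite gmulVK.
Qed.
End LocalSolution.

(** * Consequences of the universal property of the amalgam *)

Section SubgroupType.
Variables (G : group) (S : G -> Prop).
Hypothesis sS : is_subgroup S.

Lemma sval_inj (T : Type) (R : T -> Prop) (x y : {t | R t}) : sval x = sval y -> x = y.
Proof.
by case: x y => [x Rx] [y Ry] /= e; subst y; rewrite (Prop_irrelevance Rx Ry).
Qed.

Definition subgroup_type : group.
Proof.
refine (@Group {x : G | S x}
  (fun x y => exist _ (sval x ⋅ sval y) (subM sS (svalP x) (svalP y)))
  (exist _ gone (sub1 sS)) (fun x => exist _ (ginv (sval x)) (subV sS (svalP x))) _ _ _).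
- by move=> x y z; apply: sval_inj => /=; rewrite gmulA.
- by move=> x; apply: sval_inj => /=; rewrite gmul1.
- by move=> x; apply: sval_inj => /=; rewrite gmulV.
Defined.
End SubgroupType.

Section SemidirectProduct.
Variables (k : comPzRingType) (P : group) (X : Type) (act : P -> X -> X).
Hypothesis act1 : forall v, act gone v = v.
Hypothesis actM : forall g h v, act (g ⋅ h) v = act g (act h v).

Definition semidirect_type : group.
Proof.
refine (@Group (P * (X -> k))%type
  (fun a b => (a.1 ⋅ b.1, fun v => a.2 v + b.2 (act (ginv a.1) v)))
  (gone, fun=> 0) (fun a => (ginv a.1, fun v => - a.2 (act a.1 v))) _ _ _).
- move=> [a u] [b v] [c w] /=; rewrite gmulA; congr pair; apply: funext => x.
  by rewrite ginvM actM addrA.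
- by move=> [a u] /=; rewrite gmul1; congr pair; apply: funext => x; rewrite ginv1 act1 add0r.
- by move=> [a u] /=; rewrite gmulV; congr pair; apply: funext => x; rewrite ginvK addNr.
Defined.
End SemidirectProduct.

Section Amalgam.
Variables (A G1 G2 P : group) (j1 : A -> G1) (j2 : A -> G2) (i1 : G1 -> P) (i2 : G2 -> P).
Hypothesis am : is_amalgam j1 j2 i1 i2.

Lemma amalgam_hom_eq (H : group) (phi psi : P -> H) : is_hom phi -> is_hom psi ->
  (forall x, phi (i1 x) = psi (i1 x)) -> (forall x, phi (i2 x) = psi (i2 x)) ->
  forall z, phi z = psi z.
Proof.
case: am => i1M i2M ij up phiM psiM e1 e2 z.
have [||a|chi [_ _ _ chiU]] := up H (fun x => psi (i1 x)) (fun x => psi (i2 x)).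
- by move=> x y; rewrite i1M psiM.
- by move=> x y; rewrite i2M psiM.
- by rewrite ij.
by rewrite (chiU phi) // (chiU psi).
Qed.

(** The universal property gives a homomorphism from [P] to the subgroup [S]; followed by the
    inclusion it is the identity, by uniqueness. *)
Lemma amalgam_gen (S : P -> Prop) : is_subgroup S -> (forall x, S (i1 x)) ->
  (forall x, S (i2 x)) -> forall z, S z.
Proof.
move=> sS S1 S2 z; have [i1M i2M ij up] := am.
have [||a|phi [phiM p1 p2 _]] := up (subgroup_type sS) (fun x => exist _ (i1 x) (S1 x))
    (fun x => exist _ (i2 x) (S2 x)).
- by move=> x y; apply: sval_inj => /=.
- by move=> x y; apply: sval_inj => /=.
- by apply: sval_inj => /=.
have -> : z = sval (phi z); last exact: svalP.
apply: (amalgam_hom_eq (phi := id) (psi := fun z => sval (phi z))) => //.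
- by move=> x y; rewrite phiM.
- by move=> x; rewrite p1.
- by move=> x; rewrite p2.
Qed.

Lemma amalgam_central : (forall a g, gmul (j1 a) g = gmul g (j1 a)) ->
  (forall a g, gmul (j2 a) g = gmul g (j2 a)) -> forall a, central (i1 (j1 a)).
Proof.
move=> c1 c2 a; have [i1M i2M ij _] := am.
apply: amalgam_gen => [|x|x]; last 2 first.
- by rewrite -!i1M c1.
- by rewrite ij -!i2M c2.
set c := i1 _; split=> [|x y cx cy|x cx]; first by rewrite gmul1 gmulr1.
  by rewrite gmulA cx -gmulA cy gmulA.
by apply: (@gmulI _ x); rewrite gmulVK gmulA -cx gmulK.
Qed.

(* The universal property applied to the semidirect product of [P] with a module
   of functions: derivations may be prescribed on both factors. *)
Lemma derivation_exists (k : comPzRingType) (X : Type) (act : P -> X -> X) (l : X -> k) :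
  (forall v, act gone v = v) -> (forall g h v, act (g ⋅ h) v = act g (act h v)) ->
  (forall a v, l (act (i1 (j1 a)) v) = l v) ->
  exists w : P -> X -> k, [/\ forall g h v, w (g ⋅ h) v = w g v + w h (act (ginv g) v),
    forall x v, w (i1 x) v = l (act (ginv (i1 x)) v) - l v & forall x v, w (i2 x) v = 0].
Proof.
move=> act1 actM lA; have [i1M i2M ij up] := am.
have [||a|phi [phiM p1 p2 _]] := up (semidirect_type k act1 actM)
    (fun x => (i1 x, fun v => l (act (ginv (i1 x)) v) - l v)) (fun x => (i2 x, fun=> 0)).
- move=> x y; congr pair; first exact: i1M.
  by apply: funext => v /=; rewrite i1M ginvM actM; ring.
- move=> x y; congr pair; first exact: i2M.
  by apply: funext => v /=; rewrite addr0.
- rewrite ij; congr pair; apply: funext => v.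
  rewrite -(lA a) -actM; apply/eqP; rewrite subr_eq0 ij gmulVr act1.
  by rewrite -(lA a) ij.
have fstE z : (phi z).1 = z.
  apply: (amalgam_hom_eq (phi := fun z => (phi z).1) (psi := id)) => //.
  - by move=> x y; rewrite phiM.
  - by move=> x; rewrite p1.
  - by move=> x; rewrite p2.
exists (fun g => (phi g).2); split=> [g h v|x v|x v].
- by rewrite phiM /= fstE.
- by rewrite p1.
- by rewrite p2.
Qed.
End Amalgam.

(** * Mayer-Vietoris gluing for the amalgam *)

Section MayerVietoris.
Variable p : nat.
Hypothesis p_pr : prime p.
Notation k := 'Z_p.
Variables (A G1 G2 P Q1 Q2 : group) (j1 : A -> G1) (j2 : A -> G2) (i1 : G1 -> P) (i2 : G2 -> P).
Variables (q1 : G1 -> Q1) (q2 : G2 -> Q2).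
Hypothesis am : is_amalgam j1 j2 i1 i2.
Hypotheses (j1M : is_hom j1).
Hypotheses (c1 : forall a g, gmul (j1 a) g = gmul g (j1 a)).
Hypotheses (c2 : forall a g, gmul (j2 a) g = gmul g (j2 a)).
Hypotheses (q1M : is_hom q1) (q2M : is_hom q2).
Hypotheses (q1_surj : forall u, exists x, q1 x = u) (q2_surj : forall u, exists x, q2 x = u).
Hypotheses (q1K : forall x, q1 x = gone <-> exists a, j1 a = x).
Hypotheses (q2K : forall x, q2 x = gone <-> exists a, j2 a = x).
Hypothesis eff1 : effaceable p (fun u : Q1 => u = gone).
Hypothesis eff2 : effaceable p (fun u : Q2 => u = gone).

Definition amalgam_base (x : P) := exists a, i1 (j1 a) = x.
Let B := amalgam_base.

Lemma amalgam_base_sub : is_subgroup B.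
Proof.
have [i1M i2M ij _] := am; split.
- by exists gone; rewrite (hom1 j1M) (hom1 i1M).
- by move=> _ _ [a <-] [b <-]; exists (a ⋅ b); rewrite j1M i1M.
- by move=> _ [a <-]; exists (ginv a); rewrite (homV j1M) (homV i1M).
Qed.

Lemma amalgam_base_central x : B x -> central x.
Proof. by move=> [a <-]; apply: (amalgam_central am). Qed.

Lemma retraction1 : exists pi : P -> Q1, [/\ is_hom pi, forall x, pi (i1 x) = q1 x &
  forall x, pi (i2 x) = gone].
Proof.
have [_ _ _ up] := am.
have [//||a|pi [piM pi1 pi2 _]] := up Q1 q1 (fun=> gone); last by exists pi.
- by move=> x y; rewrite gmul1.
- by apply/q1K; exists a.
Qed.

Lemma retraction2 : exists pi : P -> Q2, [/\ is_hom pi, forall x, pi (i2 x) = q2 x &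
  forall x, pi (i1 x) = gone].
Proof.
have [_ _ _ up] := am.
have [|//|a|pi [piM pi1 pi2 _]] := up Q2 (fun=> gone) q2; last by exists pi.
- by move=> x y; rewrite gmul1.
- by apply/esym/q2K; exists a.
Qed.

Theorem effaceable_amalgam : effaceable p B.
Proof.
have sB := amalgam_base_sub; have cB := amalgam_base_central.
have [i1M i2M ij _] := am.
(* In degree one the difference of the two local solutions would have its primitive on the empty
   list, where there is no head to evaluate the derivation at. *)
move=> [|m] N f pN BN fm fB fN df.
  by apply: (effaceable_degree1 p_pr (A := B) (N := N)) => // a x /cB.
have [pi1 [pi1M pi1E pi1i2]] := retraction1; have [pi2 [pi2M pi2E pi2i1]] := retraction2.
have [|b [a <-]|M1 [h1 [pM1 BM1 h1P]]] := local_solution p_pr i1M q1M pi1M q1_surj pi1E sB cB _ _ eff1 pN BN fm fB fN df.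
- by move=> x /q1K[a <-]; exists a.
- by rewrite pi1E; apply/q1K; exists a.
have [|b [a <-]|M2 [h2 [pM2 BM2 h2P]]] := local_solution p_pr i2M q2M pi2M q2_surj pi2E sB cB _ _ eff2 pN BN fm fB fN df.
- by move=> x /q2K[a <-]; exists a; rewrite ij.
- by rewrite pi2i1.
pose M x := M1 x /\ M2 x; have pM : pnormal p M by apply: pnormalI.
have BM x : B x -> M x by move=> Bx; split; [apply: BM1 | apply: BM2].
(* Both are primitives of the same cocycle, each equivariant under one factor, so [D y] is a
   coboundary [cobd (l y)]. Splitting [l] into a part invariant under each factor lets both
   solutions be corrected to a common one. *)
pose D y s := h1 y s - h2 y s.
have dD y s : cobd (D y) s = 0.
  have [_ _ _ _ e1] := h1P y; have [_ _ _ _ e2] := h2P y.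
  by rewrite cobdB e1 e2 subrr.
have Dm y : supp m.+2 (D y).
  by have [s1 _ _ _ _] := h1P y; have [s2 _ _ _ _] := h2P y; apply: suppB.
have DB y : cinv B (D y).
  by have [_ s1 _ _ _] := h1P y; have [_ s2 _ _ _] := h2P y; apply: cinvB.
have DM y n s : M n -> D (y ⋅ n) s = D y s.
  move=> [n1 n2]; have [_ _ e1 _ _] := h1P y; have [_ _ e2 _ _] := h2P y.
  by rewrite /D e1 ?e2.
pose l y s := D y (gone :: s).
have dl y s : cobd (l y) s = D y s by apply: cobd_cone.
have lm y : supp m.+1 (l y) by apply: supp_cone.
have lB y : cinv B (l y) by apply: cinv_cone.
have lM y n s : M n -> l (y ⋅ n) s = l y s by apply: DM.
pose act (g : P) (v : P * seq P) := (g ⋅ v.1, map (gmul g) v.2).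
have act1 v : act gone v = v by case: v => y s; rewrite /act /= gmul1 map_mul1.
have actM g h v : act (g ⋅ h) v = act g (act h v) by rewrite /act /= gmulA map_mulM.
pose l' (v : P * seq P) := l v.1 v.2.
have lact b v : B b -> l' (act b v) = l' v.
  case: v => y s Bb; rewrite /l' /= (cB _ Bb) lM; last exact: BM.
  exact: (cinv_central sB (fun a x Ba => cB a Ba x) (lB y)).
have [w [wM w1 w2]] := derivation_exists am act1 actM (fun a v => lact _ v (ex_intro _ a erefl)).
have w_one v : w gone v = 0.
  by have := wM gone gone v; rewrite gmul1 ginv1 act1 => /eqP; rewrite -subr_eq subrr eq_sym => /eqP.
have wV g v : w (ginv g) v = - w g (act g v).
  by apply/eqP; have := wM (ginv g) g v; rewrite gmulV w_one ginvK => /esym/eqP; rewrite addr_eq0.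
have wP g : [/\ forall y, supp m.+1 (fun s => w g (y, s)), forall y, cinv B (fun s => w g (y, s)) &
    forall y n s, M n -> w g (y ⋅ n, s) = w g (y, s)].
  apply: (amalgam_gen am (S := fun g => [/\ forall y, supp m.+1 (fun s => w g (y, s)),
    forall y, cinv B (fun s => w g (y, s)) & forall y n s, M n -> w g (y ⋅ n, s) = w g (y, s)])).
  - split.
    + by split=> [y s ns|y s t st|y n s Mn]; rewrite !w_one.
    + move=> a b [am1 a2 a3] [b1 b2 b3]; split=> [y s ns|y s t st|y n s Mn].
      * by rewrite wM (am1 y) // add0r b1 // size_map.
      * rewrite !wM (a2 y _ _ st); congr (_ + _); apply: b2; exact: F2_mul.
      * by rewrite !wM a3 // /act /= gmulA b3.
    + move=> a [am1 a2 a3]; split=> [y s ns|y s t st|y n s Mn]; rewrite !wV.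
      * by rewrite am1 ?oppr0 // size_map.
      * congr (- _); apply: a2; exact: F2_mul.
      * by rewrite /act /= gmulA a3.
  - move=> x; split=> [y s ns|y s t st|y n s Mn]; rewrite !w1 /l' /act /=.
    + by rewrite !lm ?subrr ?size_map.
    + by rewrite (lB y _ _ st); congr (_ - _); apply: lB; apply: F2_mul.
    + by rewrite gmulA !(lM _ n).
  - by move=> x; split=> [y s ns|y s t st|y n s Mn]; rewrite !w2.
have wB b v : B b -> w b v = 0.
  move=> Bb; case: (Bb) => a e; rewrite -e w1 e lact ?subrr //.
  exact: subV.
have wBl b x v : B b -> w (x ⋅ b) v = w x v.
  by move=> Bb; rewrite wM (wB b) // addr0.
(* On nonempty lists the action is free and the derivation is inner: [w g v] equals [L] at the
   translate of [v] by [ginv g], minus [L] at [v]. Since [w] vanishes on [G2], [L] is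
   [G2]-invariant; since [w] agrees on [G1] with the derivation of [l], the difference of [l] and
   [L] is [G1]-invariant. *)
pose L y (s : seq P) := if s is x :: _ then - w x (y, s) else 0.
have Lm y : supp m.+1 (L y).
  by move=> [|x s] ns //=; have [h _ _] := wP x; rewrite h ?oppr0.
have LB y : cinv B (L y).
  move=> s t st; case: st (st) => // x x' {}s {}t xx' _ st; rewrite /L.
  have [_ h _] := wP x; rewrite (h y _ _ st) -(wBl (ginv x ⋅ x')) //.
  by rewrite gmulVK.
have LM y n s : M n -> L (y ⋅ n) s = L y s.
  by case: s => [|x s] Mn //; rewrite /L; have [_ _ h] := wP x; rewrite h.
have actV g y t : act (ginv g) (g ⋅ y, map (gmul g) t) = (y, t).
  by rewrite /act /= gmulKV map_mulKV.
have Lact g y s : size s = m.+1 -> L (g ⋅ y) (map (gmul g) s) = L y s - w g (g ⋅ y, map (gmul g) s).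
  case: s => // x s _; transitivity (- w (g ⋅ x) (g ⋅ y, map (gmul g) (x :: s))) => //.
  by rewrite wM opprD addrC actV.
have supp_eq (u v : seq P -> k) n : supp n u -> supp n v ->
    (forall s, size s = n -> u s = v s) -> forall s, u s = v s.
  by move=> un vn uv s; have [/uv//|ns] := eqVneq (size s) n; rewrite un ?vn.
pose h y s := h2 y s + cobd (L y) s.
have hE y s : h y s = h1 y s - cobd (fun t => l y t - L y t) s.
  by rewrite cobdB dl /h /D; ring.
have hi2 x y s : h (i2 x ⋅ y) (map (gmul (i2 x)) s) = h y s.
  have [_ _ _ e _] := h2P y; rewrite /h e cobd_map; congr (_ + _); apply: eq_cobd.
  apply: (supp_eq _ _ m.+1) => // [t nt|t st]; first by rewrite Lm ?size_map.
  by rewrite Lact // w2 subr0.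
have hi1 x y s : h (i1 x ⋅ y) (map (gmul (i1 x)) s) = h y s.
  have [_ _ _ e _] := h1P y; rewrite !hE e cobd_map; congr (_ - _); apply: eq_cobd.
  apply: (supp_eq _ _ m.+1) => [t nt|t nt|t st].
  - by rewrite Lm ?lm ?size_map ?subrr.
  - by rewrite Lm ?lm ?subrr.
  - rewrite Lact // w1 actV /l' /=; ring.
have hinv g y s : h (g ⋅ y) (map (gmul g) s) = h y s.
  apply: (amalgam_gen am (S := fun g => forall y s, h (g ⋅ y) (map (gmul g) s) = h y s)) => //.
  split=> [{}y {}s|a b ha hb {}y {}s|a ha {}y {}s].
  - by rewrite gmul1 map_mul1.
  - by rewrite -gmulA map_mulM ha.
  - by rewrite -ha gmulVK map_mulVK.
have hM y n s : M n -> h (y ⋅ n) s = h y s.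
  move=> Mn; have [_ _ e _ _] := h2P y; rewrite /h e; last by case: Mn.
  by congr (_ + _); apply: eq_cobd => t; apply: LM.
exists M, (h gone); split=> //.
- by apply: suppD; [have [] := h2P gone | apply: supp_cobd].
- by apply: cinvD; [have [] := h2P gone | apply: cinv_cobd].
split=> [n s Mn|s].
  rewrite -(hM _ n) // gmul1 -[X in h X](gmulr1 n); exact: hinv.
have [_ _ _ _ e] := h2P gone.
by rewrite cobdD cobdK addr0 e ginv1 map_mul1.
Qed.
End MayerVietoris.

(** * Comparison with inhomogeneous cochains *)

Section Inhomogeneous.
Variables (G : group) (p : nat).
Notation k := 'Z_p.

Definition inhom n (s : seq G) : 'I_n -> G :=
  fun i => ginv (nth gone s i) ⋅ nth gone s i.+1.
Arguments inhom : clear implicits.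

Definition hom_cochain n (f : ('I_n -> G) -> k) (s : seq G) : k :=
  if size s == n.+1 then f (inhom n s) else 0.

Fixpoint partial_prod n (x : 'I_n -> G) (j : nat) : G :=
  if j is j'.+1 then
    partial_prod x j' ⋅ (if insub j' is Some i then x i else gone)
  else gone.

Definition hom_seq n (x : 'I_n -> G) : seq G := mkseq (partial_prod x) n.+1.

Lemma size_hom_seq n (x : 'I_n -> G) : size (hom_seq x) = n.+1.
Proof. exact: size_mkseq. Qed.

Lemma inhomK n (x : 'I_n -> G) : inhom n (hom_seq x) = x.
Proof.
apply: funext => i; rewrite /inhom !nth_mkseq ?ltnS ?(ltnW (ltn_ord i)) //=.
  by rewrite valK gmulKV.
Qed.

Lemma hom_seqK n s : size s = n.+1 ->
  map (gmul (head gone s)) (hom_seq (inhom n s)) = s.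
Proof.
move=> ss; apply: (eq_from_nth (x0 := gone)); first by rewrite size_map size_hom_seq ss.
move=> j; rewrite size_map size_hom_seq => jn.
rewrite (nth_map gone) ?size_hom_seq // nth_mkseq //.
elim: j jn => [|j IH] jn /=; first by rewrite gmulr1 nth0.
by rewrite gmulA IH ?(ltnW jn) // insubT /inhom /= gmulVK.
Qed.

Lemma hom_cochain_supp n f : supp n.+1 (@hom_cochain n f).
Proof. by move=> s ns; rewrite /hom_cochain (negbTE ns). Qed.

Lemma hom_cochain_inv n f : dinv (fun=> True) (@hom_cochain n f).
Proof.
move=> g s _; rewrite /hom_cochain size_map; case: eqP => // ss; congr f.
apply: funext => i; rewrite /inhom !(nth_map gone) ?ss ?ltnS //; last exact: ltnW.
by rewrite !grpE.
Qed.

Lemma hom_cochainE n f (x : 'I_n -> G) : hom_cochain f (hom_seq x) = f x.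
Proof. by rewrite /hom_cochain size_hom_seq eqxx inhomK. Qed.

Lemma hom_cochainK n (F : seq G -> k) : supp n.+1 F -> dinv (fun=> True) F ->
  forall s, hom_cochain (fun x : 'I_n -> G => F (hom_seq x)) s = F s.
Proof.
move=> Fn FG s; rewrite /hom_cochain; case: eqP => [ss|/eqP ns]; last by rewrite Fn.
by rewrite -(FG (head gone s)) // hom_seqK.
Qed.

Definition delete j (s : seq G) := take j s ++ drop j.+1 s.

Lemma nth_delete j s i : (j < size s)%N ->
  nth gone (delete j s) i = nth gone s (if (i < j)%N then i else i.+1).
Proof.
move=> js; rewrite nth_cat size_take js; case: ltnP => ij; first by rewrite nth_take.
by rewrite nth_drop addSn subnKC.
Qed.

Lemma size_delete j s : (j < size s)%N -> size (delete j s) = (size s).-1.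
Proof.
move=> js; rewrite size_cat size_take js size_drop.
by rewrite subnS -subn1 -subn1 addnBA ?subn_gt0 // subnKC // ltnW.
Qed.

Lemma cobd_sum_delete (F : seq G -> k) s :
  cobd F s = \sum_(j < size s) (-1) ^+ j * F (delete j s).
Proof.
elim: s F => [|x s IH] F; first by rewrite big_ord0.
rewrite /= IH big_ord_recl /= mul1r /delete /= drop0; congr (_ + _).
by rewrite -sumrN; apply: eq_bigr => j _; rewrite exprS mulN1r mulNr.
Qed.

(** Deleting an inner entry of the list multiplies the two adjacent successive quotients, which is
    the matching inhomogeneous face; deleting an end entry drops a quotient. *)
Lemma cobd_hom_cochain n (f : ('I_n -> G) -> k) s : size s = n.+2 ->
  cobd (hom_cochain f) s = coboundary_map (@gmul G) f (inhom n.+1 s).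
Proof.
move=> ss; have hd j : (j < n.+2)%N -> hom_cochain f (delete j s) = f (inhom n (delete j s)).
  by move=> jn; rewrite /hom_cochain size_delete ss ?eqxx.
rewrite cobd_sum_delete ss big_ord_recl big_ord_recr /= /coboundary_map addrA.
congr (_ + _ + _).
- rewrite mul1r hd //; congr f; apply: funext => i.
  by rewrite /inhom !nth_delete ?ss.
- apply: eq_bigr => j _; rewrite /bump /= add1n hd; last first.
    by rewrite ltnS; apply: ltnW; rewrite ltnS.
  congr (_ * f _); apply: funext => i; rewrite /face /inhom !nth_delete ?ss; last 2 first.
  + by rewrite !ltnS; apply: ltnW.
  + by rewrite !ltnS; apply: ltnW.
  rewrite !lift0 !ltnS; case: (ltngtP i j) => [ij|ij|ij] //=.
  by rewrite ij !grpE.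
- rewrite /bump /= add1n hd //; congr (_ * f _); apply: funext => i.
  by rewrite /inhom !nth_delete ?ss // !ltnS (ltnW (ltn_ord i)) ltn_ord.
Qed.

Lemma coboundary_hom n (f : ('I_n -> G) -> k) (x : 'I_n.+1 -> G) :
  coboundary_map (@gmul G) f x = cobd (hom_cochain f) (hom_seq x).
Proof. by rewrite cobd_hom_cochain ?size_hom_seq // inhomK. Qed.

Definition loc_const_inhom n (f : ('I_n -> G) -> k) := exists2 N, pnormal p N &
  forall x y, (forall i, cong N (x i) (y i)) -> f x = f y.

Lemma F2_nth (R : G -> G -> Prop) s t : Forall2 R s t -> R gone gone ->
  forall i, R (nth gone s i) (nth gone t i).
Proof. by move=> st R0; elim: st => [|x y {}s {}t xy _ IH] [|i] //=. Qed.

Lemma hom_cochain_lc n (f : ('I_n -> G) -> k) : loc_const_inhom f -> loc_const (hom_cochain f).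
Proof.
move=> [N pN Nf]; exists N; split=> // s t st; rewrite /hom_cochain (F2_size st).
case: eqP => // _; apply: Nf => i; have nN := pnormal_normal pN.
have h := F2_nth st (cong_refl (proj1 nN) gone).
by apply: congM => //; apply: congV.
Qed.

Lemma inhom_lc n (F : seq G -> k) : loc_const F ->
  loc_const_inhom (fun x : 'I_n -> G => F (hom_seq x)).
Proof.
move=> [N [pN NF]]; exists N => // x y xy; apply: NF.
have nN := pnormal_normal pN; have sN := proj1 nN.
have h j : cong N (partial_prod x j) (partial_prod y j).
  elim: j => [|j IH] /=; first exact: cong_refl.
  by apply: congM => //; case: insub => [i|]; [apply: xy | apply: cong_refl].
exact: F2_maps.
Qed.
End Inhomogeneous.
(** * The pro-p completion *)

From mathcomp Require Import classical_sets filter.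

Section Completion.
Variables (G : group) (p : nat).
Hypothesis p_pr : prime p.
Notation k := 'Z_p.
Notation T := (raw_hat G p).
Notation c := (@completion_map G p).

Lemma psub_normal (N : psub G p) : is_normal (sval N).
Proof. by case: N => N []. Qed.
Let nP := psub_normal.
Let sP (N : psub G p) := proj1 (nP N).

Lemma lcoset_rep (N : G -> Prop) (S : G -> Prop) g h : is_subgroup N -> is_lcoset N S ->
  S g -> (S h <-> cong N g h).
Proof.
move=> sN [a aS] /aS ag; rewrite aS; split=> [ah|gh].
  exact: cong_trans (cong_sym sN ag) ah.
exact: cong_trans ag gh.
Qed.

Lemma hat_nonempty (x : T) N : in_hat x -> exists g, x N g.
Proof.
by move=> [xN _]; have [g gP] := xN N; exists g; apply/gP; rewrite gmulV; apply: sub1.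
Qed.

Lemma hat_ext (x y : T) N g : in_hat x -> in_hat y -> x N g -> y N g ->
  forall h, x N h <-> y N h.
Proof.
move=> hx hy xg yg h.
by rewrite (lcoset_rep _ (sP N) (hx.1 N) xg) (lcoset_rep _ (sP N) (hy.1 N) yg).
Qed.

Lemma completion_in_hat g : in_hat (c g).
Proof. by split=> [N|N M NM h]; [exists g | apply: NM]. Qed.

Lemma completion_mul g h : hat_mul (c g) (c h) = c (g ⋅ h).
Proof.
apply: funext => N; apply: funext => u; apply/propext; split.
  move=> [a [ga]] hu; have := congM (nP N) ga hu.
  by rewrite /cong gmulVK.
move=> ghu; exists g; split; first exact: cong_refl (sP N) g.
by apply/(congM2l (sval N) g); rewrite gmulVK.
Qed.

Lemma hat_mul_rep (x y : T) N a b : x N a -> y N b -> hat_mul x y N (a ⋅ b).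
Proof. by move=> xa yb; exists a; split=> //; rewrite gmulKV. Qed.

Lemma hat_mul_in_hat (x y : T) : in_hat x -> in_hat y -> in_hat (hat_mul x y).
Proof.
move=> hx hy; split=> [N|N M NM g [a [xa yb]]]; last first.
  by exists a; split; [apply: hx.2 xa | apply: hy.2 yb].
have [a xa] := hat_nonempty N hx; have [b yb] := hat_nonempty N hy.
exists (a ⋅ b) => g; split.
  move=> [a' [xa' yb']].
  have := congM (nP N) ((lcoset_rep _ (sP N) (hx.1 N) xa).1 xa')
    ((lcoset_rep _ (sP N) (hy.1 N) yb).1 yb').
  by rewrite /cong gmulVK.
move=> abg; exists a; split=> //; apply/(lcoset_rep _ (sP N) (hy.1 N) yb).
by apply/(congM2l (sval N) a); rewrite gmulVK.
Qed.

Section Extension.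
Variables (n : nat) (N : psub G p) (u : ('I_n -> G) -> k).
Hypothesis uN : forall x y, (forall i, cong (sval N) (x i) (y i)) -> u x = u y.

Definition hat_extend (x : 'I_n -> T) : k := u (fun i => pick_one gone (x i N)).

Lemma hat_extendE x a : in_dom (@in_hat G p) x -> (forall i, x i N (a i)) -> hat_extend x = u a.
Proof.
move=> hx xa; apply: uN => i; apply: (cong_sym (sP N)).
apply/(lcoset_rep _ (sP N) ((hx i).1 N) (xa i)).
by apply: pick_oneP; exists (a i).
Qed.

Lemma hat_extend_continuous : hat_continuous hat_extend.
Proof.
move=> x _; exists (fun=> N) => y _ xy; congr u; apply: funext => i.
by apply: eq_pick_one => g; apply: xy.
Qed.

Lemma hat_extend_c x : hat_extend (fun i => c (x i)) = u x.
Proof.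
by apply: hat_extendE => i; [apply: completion_in_hat | apply: cong_refl (sP N) (x i)].
Qed.

Lemma hat_extend_coboundary x a : in_dom (@in_hat G p) x -> (forall i, x i N (a i)) ->
  coboundary_map (@hat_mul G p) hat_extend x = coboundary_map (@gmul G) u a.
Proof.
move=> hx xa; congr (_ + _ + _); last 1 first.
- by congr (_ * _); apply: hat_extendE => i; [apply: hx | apply: xa].
- by apply: hat_extendE => i; [apply: hx | apply: xa].
apply: eq_bigr => j _; congr (_ * _); apply: hat_extendE => i; rewrite /face.
  by case: ifP => _; [apply: hx | case: ifP => _; [apply: hat_mul_in_hat | apply: hx]].
by case: ifP => _ //; case: ifP => _ //; apply: hat_mul_rep.
Qed.
End Extension.

Lemma coboundary_c n (g : ('I_n -> T) -> k) (x : 'I_n.+1 -> G) :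
  coboundary_map (@hat_mul G p) g (fun i => c (x i)) =
  coboundary_map (@gmul G) (fun y => g (fun i => c (y i))) x.
Proof.
congr (_ + _ + _); apply: eq_bigr => j _; congr (_ * g _); apply: funext => i.
by rewrite /face; case: ifP => _ //; case: ifP => _ //; rewrite completion_mul.
Qed.

(* Compactness of the pro-p completion: otherwise an ultrafilter of
   counterexamples has a limit at which continuity fails. *)
Lemma hat_uniform n (g : ('I_n -> T) -> k) : hat_continuous g ->
  exists M : psub G p, forall x y, in_dom (@in_hat G p) x -> in_dom (@in_hat G p) y ->
    (forall i z, x i M z <-> y i M z) -> g x = g y.
Proof.
move=> gc; apply: contrapT => nuni.
have /choice[X XP] (M : psub G p) : exists xy : ('I_n -> T) * ('I_n -> T),
    [/\ in_dom (@in_hat G p) xy.1, in_dom (@in_hat G p) xy.2,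
    forall i z, xy.1 i M z <-> xy.2 i M z & g xy.1 <> g xy.2].
  apply: contrapT => nex; apply: nuni; exists M => x y hx hy xy.
  by apply: contrapT => gxy; apply: nex; exists (x, y).
(* The filter of tails for the direction of shrinking subgroups; closure under intersection comes
   from [pnormalI]. *)
pose F : set_system (psub G p) := fun S => exists M0 : psub G p,
  forall M : psub G p, (forall z, sval M z -> sval M0 z) -> S M.
have FF : ProperFilter F.
  apply: Build_ProperFilter_ex => [S [M0 SM]|]; first by exists M0; apply: SM.
  split.
  - by exists (exist _ _ (pnormalT p_pr G)).
  - move=> S S' [M1 S1] [M2 S2].
    exists (exist _ _ (pnormalI p_pr (svalP M1) (svalP M2))) => M MM.
    by split; [apply: S1 | apply: S2] => z /MM[].
  - by move=> S S' SS' [M1 S1]; exists M1 => M /S1/SS'.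
have [U [UU FU]] := ultraFilterLemma FF.
have PU : ProperFilter U by apply: ultra_proper.
have Uall (I : finType) (S : I -> psub G p -> Prop) : (forall i, U (S i)) ->
    U (fun N => forall i, S i N).
  by move=> US; apply: filter_forall.
(* Finitely many cosets of [M] cover [G], so the ultrafilter selects one of them: this is where
   finite index yields compactness. *)
have Uc (x : psub G p -> T) (hx : forall N, in_hat (x N)) M :
    exists a, U (fun N => x N M a).
  have [I [r [d [rd _]]]] := pnormal_cosets (svalP M).
  apply: contrapT => nex.
  have [|N /= hN] := filter_ex (Uall I (fun i N => ~ x N M (r i)) _).
    move=> i; have [xi|//] := in_ultra_setVsetC (fun N => x N M (r i)) UU.
    by exfalso; apply: nex; exists (r i).
  have [a xa] := hat_nonempty M (hx N); apply: (hN (d a)).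
  by apply/(lcoset_rep _ (sP M) ((hx N).1 M) xa); apply: (cong_sym (sP M)).
pose lim (x : psub G p -> T) : T := fun M a => U (fun N => x N M a).
have limE (x : psub G p -> T) (hx : forall N, in_hat (x N)) M :
    U (fun N => forall z, x N M z <-> lim x M z).
  have [a Ua] := Uc x hx M; apply: (filterS _ Ua) => N xa z.
  have ca := lcoset_rep _ (sP M) ((hx N).1 M) xa; rewrite ca; split=> [az|Uz].
    apply: (filterS _ Ua) => N' xa'.
    by apply/(lcoset_rep _ (sP M) ((hx N').1 M) xa').
  have [N' [xa' xz']] := filter_ex (filterI Ua Uz).
  by apply/(lcoset_rep _ (sP M) ((hx N').1 M) xa').
have lim_hat (x : psub G p -> T) : (forall N, in_hat (x N)) -> in_hat (lim x).
  move=> hx; split=> [M|M M' MM' z].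
    have [N eN] := filter_ex (limE x hx M).
    by have [a aP] := (hx N).1 M; exists a => z; rewrite -eN.
  by apply: filterS => N; apply: (hx N).2.
pose x i N := (X N).1 i; pose y i N := (X N).2 i.
have hx i N : in_hat (x i N) by have [h _ _ _] := XP N; apply: h.
have hy i N : in_hat (y i N) by have [_ h _ _] := XP N; apply: h.
have xy i : lim (x i) = lim (y i).
  apply: funext => M; apply: funext => z; apply/propext.
  have e : U (fun N => forall z, x i N M z <-> y i N M z).
    apply: FU; exists M => N NM z'.
    have [a xa] := hat_nonempty N (hx i N); have [_ _ xyN _] := XP N.
    have ya : y i N N a by apply/xyN.
    by apply: hat_ext => //; [apply: (hx i N).2 NM _ xa | apply: (hy i N).2 NM _ ya].
  by split=> Uz; apply: filterS (filterI e Uz) => N [eN xz]; apply/eN.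
have [Ns NsP] := gc (fun i => lim (x i)) (fun i => lim_hat _ (hx i)).
have Ux := Uall _ _ (fun i => limE (x i) (hx i) (Ns i)).
have Uy := Uall _ _ (fun i => limE (y i) (hy i) (Ns i)).
have [N [xN yN]] := filter_ex (filterI Ux Uy).
have [h1 h2 _ []] := XP N.
rewrite (NsP (X N).1) //.
by rewrite (NsP (X N).2) // => i z; rewrite xy; apply: yN.
Qed.

Lemma hat_continuous_lc n (g : ('I_n -> T) -> k) : hat_continuous g ->
  loc_const_inhom (fun x : 'I_n -> G => g (fun i => c (x i))).
Proof.
move=> /hat_uniform[M gM]; exists (sval M); first exact: svalP.
move=> x y xy; apply: gM => [i|i|i z]; try exact: completion_in_hat.
apply: (hat_ext (g := y i)); try exact: completion_in_hat.
  exact: xy.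
exact: (cong_refl (sP M)).
Qed.

Lemma lc_hat_extend n (u : ('I_n -> G) -> k) : loc_const_inhom u ->
  exists g : ('I_n -> T) -> k, [/\ hat_continuous g, forall x, g (fun i => c (x i)) = u x &
    is_cocycle (@gmul G) (fun=> True) u -> is_cocycle (@hat_mul G p) (@in_hat G p) g].
Proof.
move=> [N pN uN]; pose N' : psub G p := exist _ N pN.
exists (hat_extend N' u); split.
- exact: hat_extend_continuous.
- by move=> x; apply: hat_extend_c.
move=> cu x hx; have /choice[a xa] i := hat_nonempty N' (hx i).
by rewrite (hat_extend_coboundary (N := N') uN hx xa) cu.
Qed.

Lemma hat_coboundary n (g : ('I_n.+1 -> T) -> k) (u : ('I_n -> G) -> k) :
  hat_continuous g -> loc_const_inhom u ->
  (forall x, g (fun i => c (x i)) = coboundary_map (@gmul G) u x) ->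
  is_coboundary (@hat_mul G p) (@in_hat G p) (@hat_continuous G p) g.
Proof.
move=> gc [N pN uN] gu; pose N' : psub G p := exist _ N pN.
have [M gM] := hat_uniform gc.
exists (hat_extend N' u); split=> [|x hx]; first exact: hat_extend_continuous.
(* Density of the image of [G]: at a level inside both [M] and [N], each coordinate of [x] agrees
   with the image of some [a i], where the identity is known. *)
pose K : psub G p := exist _ _ (pnormalI p_pr (svalP M) pN).
have /choice[a xa] i := hat_nonempty K (hx i).
have xM i : x i M (a i) by apply: (hx i).2 (xa i) => z [].
have xN i : x i N' (a i) by apply: (hx i).2 (xa i) => z [].
rewrite (hat_extend_coboundary (N := N') uN hx xN) -gu; apply: gM => // [i|i z].
  exact: completion_in_hat.
apply: (hat_ext (g := a i)) => //; first exact: completion_in_hat.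
exact: (cong_refl (sP M)).
Qed.

Lemma coboundary_mapB n (f h : ('I_n -> G) -> k) x :
  coboundary_map (@gmul G) (fun y => f y - h y) x =
  coboundary_map (@gmul G) f x - coboundary_map (@gmul G) h x.
Proof.
rewrite /coboundary_map mulrBr (eq_bigr (fun j : 'I_n => (-1) ^+ j.+1 * f (face (@gmul G) j x)
  - (-1) ^+ j.+1 * h (face (@gmul G) j x))) ?sumrB => [|j _]; last by rewrite mulrBr.
ring.
Qed.

(** The long exact sequence of the quotient complex, made explicit: surjectivity applies acyclicity
    to the given cocycle, injectivity to the discrete cochain that bounds the continuous one, one
    degree lower. Degree 0 has no cochain below it and is checked directly. *)
Theorem acyclic_cohom_iso : lc_acyclic p G -> forall n, cohom_iso G p n.
Proof.
move=> acG [|n]; split.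
- move=> f _; exists (fun=> f (fun=> gone)); split.
  + by move=> x _; exists (fun=> exist _ _ (pnormalT p_pr G)).
  + by move=> x _; rewrite /coboundary_map big_ord0 addr0 expr1 mulN1r subrr.
  + by move=> x _; rewrite (_ : x = fun=> gone) ?subrr //; apply: funext; case.
- move=> g _ _ g0 x hx; have := g0 (fun=> gone) (fun _ => I).
  by congr (g _ = 0); apply: funext; case.
- move=> f cf; pose F := hom_cochain f.
  have dF s : cobd F s = 0.
    have [ss|ns] := eqVneq (size s) n.+3; last exact: (supp_cobd (hom_cochain_supp f)).
    by rewrite cobd_hom_cochain // cf.
  have [|||H [Hn HG lH]] := acG n.+1 F; try by [apply: hom_cochain_supp | apply: hom_cochain_inv].
    by exists (fun=> True); split; [apply: pnormalT | move=> s t _; rewrite !dF].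
  have [g [gc gE cg]] := lc_hat_extend (inhom_lc n.+1 lH).
  exists g; split=> //.
    apply: cg => x _; rewrite coboundary_hom.
    rewrite (eq_cobd (g := fun s => F s - cobd H s)) ?cobdB ?dF ?cobdK ?subrr //.
    apply: hom_cochainK; first by apply: suppB; [apply: hom_cochain_supp | apply: supp_cobd].
    by apply: dinvB; [apply: hom_cochain_inv | apply: dinv_cobd].
  exists (fun x => H (hom_seq x)); split=> // x _.
  rewrite gE /F hom_cochainE opprB addrC subrK coboundary_hom.
  by apply: eq_cobd => s; rewrite hom_cochainK.
- move=> g gc cg [h [_ hE]]; pose F := hom_cochain h.
  have dF s : cobd F s = hom_cochain (fun x : 'I_n.+1 -> G => g (fun i => c (x i))) s.
    rewrite /hom_cochain; case: eqP => [ss|/eqP ns]; last exact: (supp_cobd (hom_cochain_supp h)).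
    by rewrite cobd_hom_cochain // hE.
  have [|||H [Hn HG lH]] := acG n F; try by [apply: hom_cochain_supp | apply: hom_cochain_inv].
    by rewrite (funext dF); apply: hom_cochain_lc; apply: hat_continuous_lc.
  apply: (hat_coboundary gc (inhom_lc n lH)) => x.
  rewrite coboundary_hom (eq_cobd (g := fun s => F s - cobd H s)).
    by rewrite cobdB cobdK subr0 dF hom_cochainE.
  apply: hom_cochainK; first by apply: suppB; [apply: hom_cochain_supp | apply: supp_cobd].
  by apply: dinvB; [apply: hom_cochain_inv | apply: dinv_cobd].
Qed.

(** The coboundary of [F] extends to a continuous cocycle that bounds on [G], hence bounds a
    continuous [h] by injectivity. What [F] differs from [h] by is a discrete cocycle, and
    surjectivity makes it cohomologous to a continuous one. *)
Theorem cohom_iso_acyclic : (forall n, cohom_iso G p n) -> lc_acyclic p G.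
Proof.
move=> iso m F Fm FG lF.
pose f (x : 'I_m -> G) := F (hom_seq x).
have fE s : hom_cochain f s = F s by apply: hom_cochainK.
have df x : coboundary_map (@gmul G) f x = cobd F (hom_seq x).
  by rewrite coboundary_hom; apply: eq_cobd.
have [g [gc gE cg]] := lc_hat_extend (inhom_lc m.+1 lF).
have [_ inj] := iso m.+1.
have [||h [hc hE]] := inj g gc.
- apply: cg => x _; rewrite coboundary_hom (eq_cobd (g := cobd F)) ?cobdK //.
  by apply: hom_cochainK; [apply: supp_cobd | apply: dinv_cobd].
- by exists f; split=> // x _; rewrite gE df.
pose h0 x := h (fun i => c (x i)).
have dh0 x : coboundary_map (@gmul G) h0 x = coboundary_map (@gmul G) f x.
  rewrite -coboundary_c -hE ?gE ?df // => i; exact: completion_in_hat.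
have [surj _] := iso m.
have [|g' [g'c cg' bg']] := surj (fun x => f x - h0 x).
  by move=> x _; rewrite coboundary_mapB dh0 subrr.
have lcl : loc_const_inhom (fun x : 'I_m -> G => h0 x + g' (fun i => c (x i))).
  have [M pM hM] := hat_continuous_lc hc; have [M' pM' hM'] := hat_continuous_lc g'c.
  exists (fun x => M x /\ M' x); first exact: pnormalI.
  by move=> x y xy; congr (_ + _); [apply: hM | apply: hM'] => i; case: (xy i).
have key (H : seq G -> k) : supp m H -> dinv (fun=> True) H ->
    (forall x : 'I_m -> G, F (hom_seq x) - cobd H (hom_seq x) = h0 x + g' (fun i => c (x i))) ->
    loc_const (fun s => F s - cobd H s).
  move=> Hm HG e; have := hom_cochain_lc lcl; congr loc_const; apply: funext => s.
  rewrite -(funext e); apply: (hom_cochainK (F := fun s => F s - cobd H s)).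
    by apply: suppB => //; apply: supp_cobd.
  by apply: dinvB => //; apply: dinv_cobd.
case: m => [|m] in F Fm FG lF f fE df g gc gE cg inj h hc hE h0 dh0 surj g' g'c cg' bg' lcl key *.
  exists (fun=> 0); split=> //; apply: key => // x; rewrite cobd0 subr0 -/(f x).
  have /= := bg' x (fun _ => I) => /eqP; rewrite subr_eq0 => /eqP <-.
  by rewrite addrC subrK.
have [b [_ bE]] := bg'.
exists (hom_cochain b); split; [exact: hom_cochain_supp | exact: hom_cochain_inv |].
apply: key; [exact: hom_cochain_supp | exact: hom_cochain_inv | move=> x].
by rewrite -coboundary_hom -bE // -/(f x); ring.
Qed.
End Completion.

(** * From the hypotheses on the quotients to the amalgam *)

Lemma quotient_effaceable p (Q : group) : prime p -> in_class_C Q ->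
  effaceable p (fun u : Q => u = gone).
Proof.
move=> p_pr QC; apply: acyclic_effaceable => //; apply: cohom_iso_acyclic => // n.
exact: QC.
Qed.

Lemma hom_gen_by (G H : group) (f : G -> H) (S : seq G) : is_hom f ->
  (forall x, gen_by S x) -> (fun y => exists x, f x = y) = gen_by (map f S).
Proof.
move=> fM genS; apply: funext => y; apply/propext; split.
  move=> [x <-]; elim: (genS x) => [|u Su|u v _ hu _ hv|u _ hu].
  - by rewrite (hom1 fM); apply: gen_one.
  - by apply: gen_in; apply: List.in_map.
  - by rewrite fM; apply: gen_mul.
  - by rewrite (homV fM); apply: gen_inv.
elim=> [|u /List.in_map_iff[x [<- _]]|_ _ _ [x <-] _ [z <-]|_ _ [x <-]].
- by exists gone; apply: hom1.
- by exists x.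
- by exists (x ⋅ z).
- by exists (ginv x); apply: homV.
Qed.

Theorem theorem3p5 (A G1 G2 : group) (j1 : A -> G1) (j2 : A -> G2) :
  is_hom j1 -> injective j1 -> is_hom j2 -> injective j2 ->
  (forall a g, gmul (j1 a) g = gmul g (j1 a)) ->
  (forall a g, gmul (j2 a) g = gmul g (j2 a)) ->
  fin_gen A ->
  (exists Q1 : group, is_quotient Q1 (fun g => exists a, j1 a = g) /\ in_class_C Q1) ->
  (exists Q2 : group, is_quotient Q2 (fun g => exists a, j2 a = g) /\ in_class_C Q2) ->
  forall (P : group) (i1 : G1 -> P) (i2 : G2 -> P),
    is_amalgam j1 j2 i1 i2 -> in_class_C P.
Proof.
move=> j1M _ j2M _ c1 c2 [S genS] [Q1 [[q1 [q1M q1s q1K]] C1]] [Q2 [[q2 [q2M q2s q2K]] C2]].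
move=> P i1 i2 am p n p_pr.
have effB := effaceable_amalgam p_pr am j1M c1 c2 q1M q2M q1s q2s q1K q2K
  (quotient_effaceable p_pr C1) (quotient_effaceable p_pr C2).
have ijM : is_hom (fun a => i1 (j1 a)) by case: am => i1M _ _ _ x y; rewrite j1M i1M.
rewrite /amalgam_base (hom_gen_by ijM genS) in effB.
apply/(acyclic_cohom_iso p_pr)/(effaceable_acyclic p_pr).
apply: (effaceable_fin_gen p_pr) effB => x /List.in_map_iff[a [<- _]].
exact: (amalgam_central am).
Qed.
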